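(* Let $n\ge2$, let $\{K_t\}_{t\ge0}$ be a family of knots in $S^3$ twisted on $n$ coherently oriented strands, and let $\{D_t\}_{t\ge0}$ be a compatible family of diagrams. Define $$d_t=T^{tn(n-1)}\Big(T^{n(n-1)}\rho_1(K_{t+1})-\rho_1(K_t)\Big)\in\mathbb{Z}[T,T^{-1}]$$ for all $t\in\mathbb{N}$. Then the sequence $\{d_t\}$ stabilizes positively with limit $$\lim_{t\to\infty}d_t=T^{-\varphi(D_0)-w(D_0)}\sum_{k=1}^{n(n-1)}\widetilde{R}_1(c_k(\tau_\infty)),$$ where $\tau_\infty$ is the distinguished full twist in $D^\tau_\infty$, $c_1(\tau_\infty),\dots,c_{n(n-1)}(\tau_\infty)$ are its crossings, $\varphi(D_0)$ is the total turning number of $D_0$ and $w(D_0)$ is its writhe.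
   Context: **Twisted families.** Let $K$ be an oriented knot in $S^3$ and $U\subset S^3$ an oriented disk meeting $K$ transversally in $n$ points, all of the same sign. Set $K_0=K$ and, for $t>0$, let $K_t$ be obtained from $K$ by inserting $t$ positive full twists in the $n$ parallel strands of $K$ near $K\cap U$, i.e. inserting the braid $\Omega_n^t$, where $\Omega_n=(\sigma_1\cdots\sigma_{n-1})^n$ is the full twist in the $n$-strand braid group, all of whose $n(n-1)$ crossings are positive. Braids are oriented from bottom to top. **The invariant $\rho_1$.** Represent a knot $K$ by an upright long knot diagram $D$: an oriented immersed arc in the unit square with over/under information at transverse double points (crossings), entering at the bottom and leaving at the top, directed upward near its endpoints and such that near each crossing both intersecting pieces are directed upward. Let $\mathcal{C}$ be the set of crossings, $N=|\mathcal{C}|$. The strands are the components of $D-\mathcal{C}$, labeled consecutively $1,\dots,2N+1$ along the orientation. Let $\varphi_k\in\mathbb{Z}$ be the turning number of strand $k$ (full counterclockwise turns minus full clockwise turns), and $\varphi(D)=\sum_k\varphi_k$. Write a crossing $c$ as a triple $(\sigma,i,j)$: $\sigma=\pm1$ its sign, $i$ its incoming over-strand, $j$ its incoming under-strand; let $i^+,j^+$ be the outgoing over- and under-strands. The transition matrix $A$ of $D$ is the sum over crossings $(\sigma,i,j)$ of the matrices whose only nonzero entries are $a_{i,i^+}=T^{\sigma}$, $a_{i,j^+}=1-T^{\sigma}$, $a_{j,j^+}=1$. Then $I-A$ is invertible over $\mathbb{Z}(T)$; let $G=(g_{k\ell})=(I-A)^{-1}$ and $$R_1(c)=\sigma\big(g_{ji}(g_{j^+,j}+g_{j,j^+}-g_{ij})-g_{ii}(g_{j,j^+}-1)-\tfrac12\big).$$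 With $\Delta_K$ the symmetrized Alexander polynomial, $$\rho_1(K)=\Delta_K^2\Big(\sum_{c\in\mathcal{C}}R_1(c)-\sum_{k}\varphi_k(g_{kk}-\tfrac12)\Big)\in\mathbb{Z}[T,T^{-1}],$$ a knot invariant. **Compatible diagrams.** A sequence $\{D_t\}_{t\ge0}$ of upright long knot diagrams is compatible with $\{K_t\}$ if $D_t$ is a diagram of $K_t$ and $D_t$ is obtained from $D_0$ by inserting $t$ full twists on $n$ parallel (upward directed) strands in a fixed region $U_0\subset D_0$; the region replacing $U_0$ is the braid $\Omega_n^t$, drawn as $t$ stacked copies of a fixed braid diagram of $\Omega_n$. **Infinite twist vertices and $D_\infty^\tau$.** An infinite twist vertex of in-degree $n$ is a vertex with $n$ incoming edges $s_1,\dots,s_n$ and $n$ outgoing edges $t_1,\dots,t_n$ (each labeled left to right); it contributes the transition weights $$a(s_i,t_j)=\frac{T^{j-1}}{1+T+\cdots+T^{n-1}}\qquad(1\le i,j\le n)$$ and no other transitions. $D^\tau_\infty$ is the diagram obtained from $D_0$ by replacing $U_0$ by an infinite twist vertex, followed by a full twist $\tau_\infty$ (a copy of the diagram of $\Omega_n$), followed by a second infinite twist vertex (outgoing edges of the first vertex are the incoming strands of $\tau_\infty$; outgoing strands of $\tau_\infty$ are the incoming edges of the second vertex). Its states are the strands of $D_0-U_0$ and of $\tau_\infty$ (arcs between consecutive crossings/vertices/endpoints), and its transition matrix $A=A^\tau_\infty$ over $\mathbb{Z}(T)$ is given by the crossing weights above at crossings and the vertex weights at the two vertices. With $(\tilde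 g_{k\ell})=\mathrm{adj}(I-A^\tau_\infty)$ (adjugate matrix), for a crossing $c=(\sigma,i,j)$ of $\tau_\infty$ put $$\widetilde R_1(c)=\sigma\Big(\tilde g_{ji}(\tilde g_{j^+,j}+\tilde g_{j,j^+}-\tilde g_{ij})-\tilde g_{ii}\big(\tilde g_{j,j^+}-\det(I-A^\tau_\infty)\big)-\tfrac12\det(I-A^\tau_\infty)^2\Big).$$ The crossings of $\tau_\infty$, ordered from bottom to top, are $c_1(\tau_\infty),\dots,c_{n(n-1)}(\tau_\infty)$. **Convergence.** A sequence $\{p_t\}$ in $\mathbb{Z}[T,T^{-1}]$ stabilizes positively if for every $r_0\in\mathbb{Z}$ there is $t_0$ such that for all $t\ge t_0$ and $r\le r_0$ the coefficients of $T^r$ in $p_t$ and $p_{t_0}$ agree; its limit is the resulting formal Laurent series. Rational functions are identified with their Laurent expansions at $T=0$. *)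

(* Defs.v *)
From mathcomp Require Import all_boot all_order all_algebra.

Set Implicit Arguments.
Unset Strict Implicit.
Unset Printing Implicit Defensive.

Import Order.TTheory GRing.Theory Num.Theory.

(* Up to planar isotopy, an upright diagram is a stack of layers, listed from
   bottom to top.  A layer [(q, x)] is the elementary piece [x] with [q] vertical
   strands on its left (and the remaining ones on its right).  The level line
   below layer [h] is level [h]; the diagram meets it in points [(h, 0)],
   [(h, 1)], ..., numbered from left to right. *)

Inductive piece : Type :=
| Crossing of bool     (* both strands upward; [true] is the positive crossing *)
| Cup of bool          (* local minimum; [true] when the left leg is upward *)
| Cap of bool          (* local maximum; [true] when the left leg is upward *)
| TwistVertex of nat.  (* infinite twist vertex, of the given in-degree *)

Definition layer : Type := (nat * piece)%type.
Definition diagram : Type := seq layer.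
Definition point : Type := (nat * nat)%type.

(* Orientations ([true] is upward) of the strands on the bottom and top sides. *)
Definition bottom_side (x : piece) : seq bool :=
  match x with
  | Crossing _ => [:: true; true]
  | Cup _ => [::]
  | Cap b => [:: b; ~~ b]
  | TwistVertex n => nseq n true
  end.

Definition top_side (x : piece) : seq bool :=
  match x with
  | Crossing _ => [:: true; true]
  | Cup b => [:: b; ~~ b]
  | Cap _ => [::]
  | TwistVertex n => nseq n true
  end.

Definition layer_fits (l : layer) (b : seq bool) : bool :=
  (l.1 <= size b) && prefix (bottom_side l.2) (drop l.1 b).

Definition apply_layer (b : seq bool) (l : layer) : seq bool :=
  take l.1 b ++ top_side l.2 ++ drop (l.1 + size (bottom_side l.2)) b.

Section Diagram.
Variable D : diagram.

Definition layer_at (h : nat) : layer := nth (0, Cup true) D h.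
Definition lpos (h : nat) : nat := (layer_at h).1.

Definition is_crossing (h : nat) : bool :=
  if (layer_at h).2 is Crossing _ then true else false.
Definition is_positive (h : nat) : bool :=
  if (layer_at h).2 is Crossing s then s else false.
Definition is_node (h : nat) : bool :=
  match (layer_at h).2 with
  | Crossing _ | TwistVertex _ => true
  | _ => false
  end.

(* Orientations of the strands at level [h]. *)
Definition level (h : nat) : seq bool :=
  foldl apply_layer [:: true] (take h D).

Definition well_formed : bool :=
  all (fun h => layer_fits (layer_at h) (level h)) (iota 0 (size D))
  && (level (size D) == [:: true]).

Definition points : seq point :=
  [seq (h, p) | h <- iota 0 (size D).+1, p <- iota 0 (size (level h))].

(* The point following [x] along the orientation.  The traversal crosses over
   at a crossing.  At an infinite twist vertex it goes from [s_i] to [t_i]; this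
   only serves to number the strands. *)
Definition next (x : point) : point :=
  let: (h, p) := x in
  if nth true (level h) p then
    if h < size D then
      let: (q, e) := layer_at h in
      let a := size (bottom_side e) in
      if p < q then (h.+1, p)
      else if q + a <= p then (h.+1, p - a + size (top_side e))
      else match e with
           | Crossing _ => (h.+1, q + (1 - (p - q)))
           | Cap _ => (h, q + (1 - (p - q)))
           | _ => (h.+1, p)
           end
    else x
  else
    let: (q, e) := layer_at h.-1 in
    let b := size (top_side e) in
    if p < q then (h.-1, p)
    else if q + b <= p then (h.-1, p - b + size (bottom_side e))
    else (h, q + (1 - (p - q))).

Definition traversal : seq point := traject next (0, 0) (size points).

(* Points at which a strand leaves a crossing or an infinite twist vertex. *)
Definition leaves_node (x : point) : bool :=
  let: (h, p) := x in
  [&& 0 < h, is_node h.-1, lpos h.-1 <= p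
    & p < lpos h.-1 + size (top_side (layer_at h.-1).2)].

(* The strands are numbered 0, 1, ..., [last_strand] along the orientation;
   [strand x] is the strand through the point [x]. *)
Definition last_strand : nat := count leaves_node traversal.

Definition strand (x : point) : 'I_last_strand.+1 :=
  inord (count leaves_node (take (index x traversal).+1 traversal)).

(* The second condition says that the diagram has a single component. *)
Definition long_knot : Prop :=
  [/\ well_formed, perm_eq traversal points
    & all (fun l : layer => if l.2 is TwistVertex _ then false else true) D].

(* At a positive crossing, the over-strand enters on the left and leaves on the
   right; at a negative one, it enters on the right and leaves on the left. *)
Definition over_in h := strand (h, lpos h + ~~ is_positive h).
Definition under_in h := strand (h, lpos h + is_positive h).
Definition over_out h := strand (h.+1, lpos h + is_positive h).
Definition under_out h := strand (h.+1, lpos h + ~~ is_positive h).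

Definition csign (h : nat) : int := if is_positive h then 1%R else (-1)%R.

Local Open Scope ring_scope.

Definition writhe : int := \sum_(h < size D | is_crossing h) csign h.

(* Number of counterclockwise minus number of clockwise half turns of strand
   [k]: going right along a cup is counterclockwise, going right along a cap is
   clockwise. *)
Definition half_turns (k : 'I_last_strand.+1) : int :=
  \sum_(h < size D)
    match (layer_at h).2 with
    | Cup b => if strand (h.+1, lpos h) == k then (if b then -1 else 1) else 0
    | Cap b => if strand (h : nat, lpos h) == k then (if b then -1 else 1) else 0
    | _ => 0
    end.

(* Strands start and end upward, so that the division is exact. *)
Definition turning (k : 'I_last_strand.+1) : int := (half_turns k %/ 2)%Z.

Definition total_turning : int := \sum_k turning k.

Definition ZT : fieldType := {fraction {poly int}}.
Definition T : ZT := tofrac 'X.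

Definition crossing_weights (h : nat) : 'M[ZT]_last_strand.+1 :=
  T ^ csign h *: delta_mx (over_in h) (over_out h)
  + (1 - T ^ csign h) *: delta_mx (over_in h) (under_out h)
  + delta_mx (under_in h) (under_out h).

Definition vertex_weights (h n : nat) : 'M[ZT]_last_strand.+1 :=
  \sum_(i < n) \sum_(j < n)
    (T ^+ j / \sum_(k < n) T ^+ k)
      *: delta_mx (strand (h, lpos h + i)%N) (strand (h.+1, lpos h + j)%N).

Definition transition : 'M[ZT]_last_strand.+1 :=
  \sum_(h < size D)
    match (layer_at h).2 with
    | Crossing _ => crossing_weights h
    | TwistVertex n => vertex_weights h n
    | _ => 0
    end.

Definition green : 'M[ZT]_last_strand.+1 := invmx (1%:M - transition).

Definition R1 (h : nat) : ZT :=
  let g := green in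
  let i := over_in h in let j := under_in h in let j' := under_out h in
  (csign h)%:~R * (g j i * (g j' j + g j j' - g i j) - g i i * (g j j' - 1)
                   - 1 / 2%:R).

Definition R1_tilde (h : nat) : ZT :=
  let g := \adj (1%:M - transition) in
  let d := \det (1%:M - transition) in
  let i := over_in h in let j := under_in h in let j' := under_out h in
  (csign h)%:~R * (g j i * (g j' j + g j j' - g i j) - g i i * (g j j' - d)
                   - 1 / 2%:R * d ^+ 2).

(* Fox Jacobian of the Wirtinger presentation with one generator [x_k] per
   strand and, at each crossing (s, i, j), the relations [x_i+ = x_i] (row [i])
   and [x_j+ = x_i^s x_j x_i^-s] (row [j]).  The row of the last strand is 0. *)
Definition wirtinger_matrix : 'M[ZT]_last_strand.+1 :=
  \sum_(h < size D | is_crossing h)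
    (delta_mx (over_in h) (over_out h) - delta_mx (over_in h) (over_in h)
     + delta_mx (under_in h) (under_out h)
     - T ^ csign h *: delta_mx (under_in h) (under_in h)
     - (1 - T ^ csign h) *: delta_mx (under_in h) (over_in h)).

Definition alexander_minor : ZT :=
  \det (row' ord_max (col' ord0 wirtinger_matrix)).

Definition laurent (m : nat) (c : int -> int) : ZT :=
  \sum_(i < (2 * m).+1) (c (i%:Z - m%:Z))%:~R * T ^ (i%:Z - m%:Z).

(* The Alexander polynomial is only defined up to units of Z[T, 1/T]; the
   representative with Delta(1/T) = Delta(T) and Delta(1) = 1 is unique. *)
Definition symmetrized_alexander (Delta : ZT) : Prop :=
  (exists (b : bool) (k : int), Delta = (-1) ^+ b * T ^ k * alexander_minor)
  /\ exists (m : nat) (c : int -> int),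
      [/\ Delta = laurent m c, forall r, c (- r) = c r
        & \sum_(i < (2 * m).+1) c (i%:Z - m%:Z) = 1].

Definition is_rho1 (rho : ZT) : Prop :=
  exists2 Delta : ZT, symmetrized_alexander Delta
    & rho = Delta ^+ 2 *
            (\sum_(h < size D | is_crossing h) R1 h
             - \sum_k (turning k)%:~R * (green k k - 1 / 2%:R)).

End Diagram.

(* Braid group words: [(true, i)] is the generator exchanging positions [i] and
   [i.+1] (counted from 0), [(false, i)] its inverse. *)
Inductive braid_eq (n : nat) : seq (bool * nat) -> seq (bool * nat) -> Prop :=
| braid_refl u : braid_eq n u u
| braid_sym u v : braid_eq n u v -> braid_eq n v u
| braid_trans u v w : braid_eq n u v -> braid_eq n v w -> braid_eq n u w
| braid_cancel u v e i : i.+1 < n ->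
    braid_eq n (u ++ [:: (e, i); (~~ e, i)] ++ v) (u ++ v)
| braid_far u v i j : i.+1 < j -> j.+1 < n ->
    braid_eq n (u ++ [:: (true, i); (true, j)] ++ v)
               (u ++ [:: (true, j); (true, i)] ++ v)
| braid_artin u v i : i.+2 < n ->
    braid_eq n (u ++ [:: (true, i); (true, i.+1); (true, i)] ++ v)
               (u ++ [:: (true, i.+1); (true, i); (true, i.+1)] ++ v).

(* [w] is a positive braid diagram of the full twist on [n] strands. *)
Definition full_twist (n : nat) (w : seq nat) : Prop :=
  all (fun i => i.+1 < n) w
  /\ braid_eq n [seq (true, i) | i <- w]
       [seq (true, i) | i <- flatten (nseq n (iota 0 n.-1))].

Definition braid_diagram (w : seq nat) : diagram :=
  [seq (i, Crossing true) | i <- w].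

(* The region [U_0] between two consecutive layers of the diagram
   [below ++ above], starting on the right of the leftmost [offset] strands. *)
Record region : Type := Region {below : diagram; above : diagram; offset : nat}.

Definition base (U : region) : diagram := below U ++ above U.

Definition insert (U : region) (E : diagram) : diagram :=
  below U ++ [seq (offset U + l.1, l.2) | l <- E] ++ above U.

Definition compatible (n : nat) (U : region) (w : seq nat)
    (D : nat -> diagram) : Prop :=
  [/\ long_knot (base U),
      take n (drop (offset U) (level (base U) (size (below U)))) = nseq n true,
      full_twist n w
    & forall t, D t = insert U (braid_diagram (flatten (nseq t w)))].

Definition D_infty (n : nat) (U : region) (w : seq nat) : diagram :=
  insert U ((0, TwistVertex n) :: braid_diagram w ++ [:: (0, TwistVertex n)]).

(* The layer of [D_infty n U w] holding the [k]-th crossing (from 0) of the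
   distinguished full twist. *)
Definition tau_crossing (U : region) (k : nat) : nat := size (below U) + 1 + k.

Local Open Scope ring_scope.

Definition laurent_coefs (f : ZT) (c : int -> int) : Prop :=
  exists2 m : nat, forall r : int, (m < `|r|)%N -> c r = 0 & f = laurent m c.

(* [s] is the Laurent expansion of [f] at T = 0. *)
Definition laurent_expansion (f : ZT) (s : int -> int) : Prop :=
  (exists m : int, forall r, r < m -> s r = 0)
  /\ exists p q : {poly int},
      [/\ q != 0, f = tofrac p / tofrac q
        & forall r : int, \sum_(i < size q) q`_i * s (r - i%:Z)
                          = if r is Posz k then p`_k else 0].

Definition stabilizes_positively (c : nat -> int -> int) : Prop :=
  forall r0 : int, exists t0 : nat,
    forall (t : nat) (r : int), (t0 <= t)%N -> r <= r0 -> c t r = c t0 r.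

Definition limit_of (c : nat -> int -> int) (s : int -> int) : Prop :=
  forall r : int, exists t0 : nat, forall t : nat, (t0 <= t)%N -> c t r = s r.

(* Main.v *)
Require Import Defs.
From mathcomp Require Import all_boot all_order all_algebra.
From mathcomp Require Import fingroup perm generic_quotient zify ring.
Import Order.TTheory GRing.Theory Num.Theory.
Set Implicit Arguments.
Unset Strict Implicit.
Unset Printing Implicit Defensive.
Local Open Scope ring_scope.

(** Write A for the transition matrix of a diagram D, d for the determinant of
    1 - A, phi for the total turning number and w for the writhe.  The proof has
    an exact part, which turns the invariant into a polynomial expression in the
    twist matrices, and an analytic part, which lets the number of twists grow.

    Exact part.  The matrix 1 - A is, up to transposition and conjugation by the
    Alexander numbering of the regions, the Fox Jacobian of the Wirtinger
    presentation ([alexander_minor_det]).  Its first order expansion at T = 1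
    counts the crossings passed first below ([det_jet]), and a formula of Whitney
    type expresses this count through phi + w ([turning_writhe]).  Together they
    fix the power of T in the symmetrized Alexander polynomial, so that
    [rho_formula] holds: rho_1 = T^(-phi - w) times a bracket in which d and the
    adjugate of 1 - A replace the Green function.  The t-fold twisted diagram has
    phi(D_t) = phi(D_0) and w(D_t) = w(D_0) + t n (n - 1), whence d_t is
    T^(-phi(D_0) - w(D_0)) times the difference of the brackets of D_(t+1) and D_t.

    To compare brackets of different sizes, the states of the walk are refined
    from strands to points ([det_points], [adj_points]), the twist region is
    replaced by a stack of matrices ([sdet_insert], [sadj_insert]), and
    consecutive matrices are merged into their product ([sdet_merge],
    [sadj_merge]) by eliminating the points between them.  The transition matrix
    of the full twist is its Burau matrix, and the Burau matrix of k full twists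
    is P + T^(nk) (1 - P), where P is the matrix of an infinite twist vertex
    ([burau_twist_pow]).  In this form the bracket of D_t is a sum of outer terms,
    which depend on the matrix of t twists, and of terms f(a, b), one for each of
    the t full twists, with a full twists below it and b = t - 1 - a above it
    ([bracket_twisted]).

    Analytic part.  The matrices of k twists converge to P in the T-adic order, at
    a rate proportional to k, and determinants and adjugates are polynomials in
    the entries.  So f(a, b) hardly depends on a large argument, and f(a, b) tends
    to the sum of the terms of the full twist between two infinite twist vertices.
    In the difference of the sums over a + b = t and a + b = t - 1 all terms cancel
    in pairs up to order t / 2, except for one with a and b close to t / 2
    ([bracket_gap]); this one gives the limit. *)

(** * Determinants and adjugates indexed by sequences *)

Section SeqDet.
Variable R : comNzRingType.

Definition tdet (X : eqType) n (t : n.-tuple X) (M : X -> X -> R) : R :=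
  \det (\matrix_(i < n, j < n) M (tnth t i) (tnth t j)).
(** Determinants over a sequence of labels make it possible to delete or
   rename rows of a matrix indexed by the points of a diagram without casts
   between ordinal types. *)
Definition sdet (X : eqType) (s : seq X) (M : X -> X -> R) : R :=
  tdet (in_tuple s) M.
(** Replacing row [y] by a unit row at [x] turns a determinant into the
   [(x, y)] entry of the adjugate; every statement on [sdet] then has an
   analogue for [sadj]. *)
Definition row_set (X : eqType) (M : X -> X -> R) (x y : X) : X -> X -> R :=
  fun u v => if u == y then (v == x)%:R else M u v.
Definition sadj (X : eqType) (s : seq X) (M : X -> X -> R) (x y : X) : R :=
  sdet s (row_set M x y).

Lemma tdetE (X : eqType) n (t : n.-tuple X) M : tdet t M = sdet t M.
Proof.
case: t => s e; rewrite /sdet /=; have e1 := eqP e.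
case: n / e1 e => e; rewrite /tdet; congr (\det _); apply/matrixP => i j.
by rewrite !mxE; congr (M _ _); rewrite /tnth /=; apply: set_nth_default.
Qed.

Section One.
Variable X : eqType.
Implicit Types (s J K : seq X) (M : X -> X -> R).

Lemma eq_sdet s M M' : {in s &, M =2 M'} -> sdet s M = sdet s M'.
Proof.
move=> E; congr (\det _); apply/matrixP => i j; rewrite !mxE; apply: E; exact: mem_tnth.
Qed.

Lemma sdet_perm s s' M : perm_eq s s' -> sdet s M = sdet s' M.
Proof.
move=> pss'; have e := perm_size pss'.
have es : size s == size s' by rewrite e.
pose t := Tuple es; rewrite -[s]/(tval t) -tdetE.
have /tuple_permP[p Ep] : perm_eq t (in_tuple s') by [].
rewrite /sdet /tdet.
have -> : \matrix_(i, j) M (tnth t i) (tnth t j)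
  = row_perm p (col_perm p (\matrix_(i, j) M (tnth (in_tuple s') i) (tnth (in_tuple s') j))).
  have Et : t = [tuple tnth (in_tuple s') (p i) | i < size s'] by apply: val_inj.
  by apply/matrixP => i j; rewrite !mxE Et !tnth_mktuple.
rewrite row_permE col_permE !det_mulmx !det_perm odd_permV.
by rewrite [X in _ * X]mulrC mulrA -signr_addb addbb mul1r.
Qed.

(** Gaussian elimination of the labels of [K]: if the columns of [H] solve
   the equations of the rows in [K], column operations with [H] make the
   matrix block triangular.  Giving [H] explicitly avoids inverting the block
   of [K]. *)
Lemma sdet_elim J K M H :
  (forall k j, k \in K -> j \in J -> M k j + \sum_(l <- K) M k l * H l j = 0) ->
  sdet (J ++ K) M
  = sdet J (fun u v => M u v + \sum_(l <- K) M u l * H l v) * sdet K M.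
Proof.
move=> hH; pose tJ := in_tuple J; pose tK := in_tuple K.
rewrite -[J ++ K]/(tval (cat_tuple tJ tK)) -tdetE /tdet.
set A := \matrix_(i, j) _.
pose B := block_mx (\matrix_(i, j) M (tnth tJ i) (tnth tJ j)) (\matrix_(i, j) M (tnth tJ i) (tnth tK j))
   (\matrix_(i, j) M (tnth tK i) (tnth tJ j)) (\matrix_(i, j) M (tnth tK i) (tnth tK j)).
have -> : A = B.
  apply/matrixP => i j; rewrite !mxE.
  by case: (splitP i) => i' Ei; rewrite !mxE; case: (splitP j) => j' Ej; rewrite !mxE;
   (have -> : i = lshift _ i' by apply: val_inj) || (have -> : i = rshift _ i' by apply: val_inj);
   (have -> : j = lshift _ j' by apply: val_inj) || (have -> : j = rshift _ j' by apply: val_inj);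
   rewrite ?tnth_lshift ?tnth_rshift.
pose HH : 'M_(size K, size J) := \matrix_(i, j) H (tnth tK i) (tnth tJ j).
have dC : \det (block_mx 1%:M 0 HH 1%:M) = 1 :> R by rewrite det_lblock !det1 mulr1.
rewrite -[\det B]mulr1 -{1}dC -det_mulmx mulmx_block !mulmx1 !mulmx0 !add0r.
have sumK (F : X -> R) : \sum_(l <- K) F l = \sum_(l < size K) F (tnth tK l).
  by rewrite -[in LHS](in_tupleE K) big_tuple.
set Z := (X in block_mx _ _ X _); have -> : Z = 0.
  apply/matrixP => i j; rewrite !mxE -[RHS](hH (tnth tK i) (tnth tJ j)) ?mem_tnth //.
  by rewrite sumK; congr (_ + _); apply: eq_bigr => l _; rewrite !mxE.
rewrite det_ublock; congr (\det _ * _); apply/matrixP => i j; rewrite !mxE sumK.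
by congr (_ + _); apply: eq_bigr => l _; rewrite !mxE.
Qed.

(** Ordering the labels by rank makes the matrix unitriangular. *)
Lemma sdet_rank (rk : X -> nat) s M : uniq s ->
  {in s, forall x, M x x = 1} ->
  {in s &, forall x y, x != y -> (rk y <= rk x)%N -> M x y = 0} -> sdet s M = 1.
Proof.
move=> us M1 M0; pose le := fun x y => (rk x <= rk y)%N.
rewrite -(sdet_perm (s := sort le s)); last by rewrite perm_sort.
set s' := sort le s.
have us' : uniq s' by rewrite sort_uniq.
have ms' : s' =i s by apply: mem_sort.
have so : sorted le s' by apply: sort_sorted => x y; exact: leq_total.
have letr : transitive le by move=> y x z; exact: leq_trans.
rewrite /sdet /tdet -det_tr det_trig.
  rewrite big1 // => i _; rewrite !mxE M1 // -ms' mem_tnth //.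
apply/is_trig_mxP => i j lij; rewrite !mxE.
have x0 : X := tnth (in_tuple s') i.
rewrite !(tnth_nth x0) /=.
apply: M0; rewrite -?ms' ?mem_nth //.
  by rewrite nth_uniq // ?neq_ltn ?lij ?orbT.
by apply: (sorted_ltn_nth letr x0 so); rewrite ?inE.
Qed.

Lemma sdet0_rank s M : uniq s ->
  {in s &, forall x y, M x y = (x == y)%:R} -> sdet s M = 1.
Proof.
move=> us hM; apply: (@sdet_rank (fun=> 0%N)) => //.
  by move=> x xs; rewrite hM // eqxx.
by move=> x y xs ys /negPf nxy _; rewrite hM // nxy.
Qed.

Lemma sadj_perm s s' M x y : perm_eq s s' -> sadj s M x y = sadj s' M x y.
Proof. exact: sdet_perm. Qed.

Lemma eq_sadj s M M' x y : {in s &, M =2 M'} -> sadj s M x y = sadj s M' x y.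
Proof.
by move=> E; apply: eq_sdet => u v us vs; rewrite /row_set; case: eqP => // _; apply: E.
Qed.

Lemma sadj_elim J K M H x y : x \notin K -> y \notin K ->
  (forall k j, k \in K -> j \in J -> M k j + \sum_(l <- K) M k l * H l j = 0) ->
  sadj (J ++ K) M x y
  = sadj J (fun u v => M u v + \sum_(l <- K) M u l * H l v) x y * sdet K M.
Proof.
move=> xK yK hH; rewrite /sadj (@sdet_elim _ _ _ H); last first.
  move=> k j kK jJ; rewrite /row_set; case: eqP => [E|_]; first by rewrite -E kK in yK.
  exact: hH.
congr (_ * _); apply: eq_sdet => u v us vs; rewrite /row_set.
  case: (u =P y) => // _; rewrite big_seq big1 ?addr0 // => l lK.
  by case: (l =P x) => [E|_]; [rewrite -E lK in xK | rewrite mul0r].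
by case: (u =P y) => [E|_] //; rewrite -E us in yK.
Qed.

End One.

Lemma sdet_map (X Y : eqType) (f : X -> Y) s M :
  sdet (map f s) M = sdet s (fun x y => M (f x) (f y)).
Proof.
rewrite -[map f s]/(tval (map_tuple f (in_tuple s))) -tdetE.
by congr (\det _); apply/matrixP => i j; rewrite !mxE !tnth_map.
Qed.

Lemma sadj_map (X Y : eqType) (f : X -> Y) s M x y :
  {in x :: y :: s &, injective f} ->
  sadj (map f s) M (f x) (f y) = sadj s (fun x y => M (f x) (f y)) x y.
Proof.
move=> fi; rewrite /sadj sdet_map; apply: eq_sdet => u v us vs; rewrite /row_set.
by rewrite !(inj_in_eq fi) ?inE ?us ?vs ?eqxx ?orbT.
Qed.

Lemma sdet_ord n (M : 'M[R]_n) : sdet (enum 'I_n) (fun i j => M i j) = \det M.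
Proof.
rewrite -[enum 'I_n]/(tval (ord_tuple n)) -tdetE; congr (\det _).
by apply/matrixP => i j; rewrite !mxE !tnth_ord_tuple.
Qed.

(** Expansion along the replaced row leaves a single cofactor. *)
Lemma sadj_ord n (M : 'M[R]_n) i j :
  sadj (enum 'I_n) (fun i j => M i j) i j = \adj M i j.
Proof.
rewrite /sadj; pose M' : 'M[R]_n := \matrix_(u, v) row_set (fun i j => M i j) i j u v.
transitivity (sdet (enum 'I_n) (fun i j => M' i j)).
  by apply: eq_sdet => u v _ _; rewrite mxE.
rewrite sdet_ord (expand_det_row _ j) (bigD1 i) //= big1 ?addr0.
  rewrite !mxE /row_set eqxx eqxx mul1r /cofactor; congr (_ * \det _).
  by apply/matrixP => u v; rewrite !mxE /row_set eq_sym (negPf (neq_lift _ _)).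
by move=> k /negPf nk; rewrite !mxE /row_set eqxx nk mul0r.
Qed.

End SeqDet.

(** * Order at T = 0, Laurent polynomials, and convergence *)

Lemma T_neq0 : T != 0.
Proof. by rewrite /T tofrac_eq0 polyX_eq0. Qed.
Lemma TexpD (k l : int) : T ^ (k + l) = T ^ k * T ^ l.
Proof. by rewrite expfzDr // T_neq0. Qed.
Lemma Texpn (k : nat) : T ^ k%:Z = tofrac 'X^k.
Proof. by rewrite /T tofracXn. Qed.

(** The order of [f] at T = 0 is at least [k].  The denominator only has to
   be nonzero at 0, so that rational numbers have order 0. *)
Definition Vge (k : int) (f : ZT) : Prop :=
  exists p q : {poly int}, q`_0 != 0 /\ tofrac q * f = T ^ k * tofrac p.

Lemma Vge0 k : Vge k 0.
Proof. by exists 0, 1; rewrite coef1 /= !mulr0; split. Qed.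
Lemma VgeM k l f g : Vge k f -> Vge l g -> Vge (k + l) (f * g).
Proof.
move=> [p [q [q0 e]]] [p' [q' [q'0 e']]]; exists (p * p'), (q * q'); split.
  by rewrite coefM big_ord1 mulf_neq0.
by rewrite TexpD !tofracM mulrACA e e' mulrACA.
Qed.
Lemma VgeT k : Vge k (T ^ k).
Proof. by exists 1, 1; rewrite coef1 mulr1 mul1r; split. Qed.
Lemma Vge_poly p : Vge 0 (tofrac p).
Proof. by exists p, 1; rewrite coef1 expr0z !mul1r; split. Qed.
Lemma Vge_inv (q : {poly int}) : q`_0 != 0 -> Vge 0 (tofrac q)^-1.
Proof.
move=> q0; exists 1, q; split => //; rewrite divff ?expr0z ?mul1r ?tofrac1 //.
by rewrite tofrac_eq0; apply: contraNneq q0 => ->; rewrite coef0.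
Qed.
Lemma Vge_leq k l f : k <= l -> Vge l f -> Vge k f.
Proof.
move=> kl [p [q [q0 e]]]; have [n En] : exists n : nat, l = k + n%:Z.
  by exists (absz (l - k)); lia.
exists ('X^n * p), q; split => //.
by rewrite e En TexpD tofracM Texpn mulrA.
Qed.
Lemma VgeD k f g : Vge k f -> Vge k g -> Vge k (f + g).
Proof.
move=> [p [q [q0 e]]] [p' [q' [q'0 e']]]; exists (q' * p + q * p'), (q * q'); split.
  by rewrite coefM big_ord1 mulf_neq0.
have -> : tofrac (q * q') * (f + g) = tofrac q' * (tofrac q * f) + tofrac q * (tofrac q' * g).
  by rewrite tofracM; ring.
by rewrite e e' tofracD !tofracM; ring.
Qed.
Lemma VgeN k f : Vge k f -> Vge k (- f).
Proof. by move=> [p [q [q0 e]]]; exists (- p), q; rewrite tofracN !mulrN e; split. Qed.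
Lemma VgeB k f g : Vge k f -> Vge k g -> Vge k (f - g).
Proof. by move=> h1 h2; apply: VgeD => //; apply: VgeN. Qed.
Lemma Vge_sum k (I : Type) (r : seq I) (P : pred I) (F : I -> ZT) :
  (forall i, P i -> Vge k (F i)) -> Vge k (\sum_(i <- r | P i) F i).
Proof. by move=> h; elim/big_ind: _ => //; [apply: Vge0 | apply: VgeD]. Qed.
Lemma Vge1 : Vge 0 1.
Proof. by rewrite -tofrac1; apply: Vge_poly. Qed.
Lemma Vge_int (z : int) : Vge 0 z%:~R.
Proof. by rewrite -[z%:~R](rmorph_int (@tofrac _)); apply: Vge_poly. Qed.
Lemma Vge_nat (z : nat) : Vge 0 z%:R.
Proof. exact: (Vge_int z%:Z). Qed.

Lemma frac_ex (f : ZT) : exists p q : {poly int}, q != 0 /\ f = tofrac p / tofrac q.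
Proof.
elim/quotW: f => x; exists (frac x).1, (frac x).2; split; first exact: denom_ratioP.
have d0 : tofrac (frac x).2 != 0 :> ZT by rewrite tofrac_eq0 denom_ratioP.
apply: (mulIf d0); rewrite mulfVK //.
unlock tofrac; rewrite -[LHS]FracField.pi_mul; apply/eqmodP.
rewrite /= FracField.equivfE /FracField.mulf !numden_Ratio ?mulf_neq0 ?oner_neq0 ?denom_ratioP //.
by rewrite !mulr1 mulrC.
Qed.

Lemma Vge_ex f : exists k, Vge k f.
Proof.
have [p [q [q0 ->]]] := frac_ex f.
have [m [q' q'0 Eq]] := multiplicity_XsubC q 0.
move: q'0; rewrite q0 /= /root horner_coef0 => q'0.
exists (- m%:Z), p, q'; split => //.
have q'F : tofrac q' != 0 :> ZT.
  by rewrite tofrac_eq0; apply: contraNneq q'0 => ->; rewrite coef0.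
rewrite Eq subr0 tofracM -Texpn -invr_expz invfM mulrCA (mulrA (tofrac q')) divff //.
by rewrite mul1r mulrC.
Qed.

(** The first nonzero coefficient of [P] would survive, multiplied by the
   constant coefficient of the denominator. *)
Lemma Vge_coef e P : Vge e (tofrac P) -> forall k : nat, k%:Z < e -> P`_k = 0.
Proof.
move=> [p [q [q0 E]]] k; elim/ltn_ind: k => k IH ke.
have [n En] : exists n : nat, e = n%:Z by exists `|e|%N; lia.
move: E; rewrite En Texpn -!tofracM => /eqP; rewrite tofrac_eq => /eqP E.
have := congr1 (fun s : {poly int} => s`_k) E.
rewrite coefXnM; have -> : (k < n)%N by lia.
rewrite coefM big_ord_recl /= subn0 big1 ?addr0.
  by move/eqP; rewrite mulf_eq0 (negPf q0) /= => /eqP.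
by move=> i _; have li := ltn_ord i; rewrite IH ?mulr0 //= /bump /=; lia.
Qed.

(** Membership in the ring of integer Laurent polynomials. *)
Definition is_laurent (f : ZT) : Prop := exists m : nat, exists p : {poly int}, T ^+ m * f = tofrac p.

Lemma laurent_poly p : is_laurent (tofrac p).
Proof. by exists 0%N, p; rewrite expr0 mul1r. Qed.
Lemma laurentM f g : is_laurent f -> is_laurent g -> is_laurent (f * g).
Proof.
by move=> [m [p e]] [m' [p' e']]; exists (m + m')%N, (p * p'); rewrite exprD tofracM mulrACA e e'.
Qed.
Lemma laurentD f g : is_laurent f -> is_laurent g -> is_laurent (f + g).
Proof.
move=> [m [p e]] [m' [p' e']]; exists (m + m')%N, ('X^m' * p + 'X^m * p').
rewrite tofracD !tofracM -e -e' !tofracXn -/T exprD; ring.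
Qed.
Lemma laurent_int (z : int) : is_laurent z%:~R.
Proof. by rewrite -[z%:~R](rmorph_int (@tofrac _)); apply: laurent_poly. Qed.
Lemma laurent0 : is_laurent 0. Proof. exact: (laurent_int 0). Qed.
Lemma laurent1 : is_laurent 1. Proof. exact: (laurent_int 1). Qed.
Lemma laurentN f : is_laurent f -> is_laurent (- f).
Proof. by move=> h; rewrite -mulN1r; apply: laurentM => //; apply: (laurent_int (-1)). Qed.
Lemma laurentB f g : is_laurent f -> is_laurent g -> is_laurent (f - g).
Proof. by move=> h1 h2; apply: laurentD => //; apply: laurentN. Qed.
Lemma laurent_sum (I : Type) (r : seq I) (P : pred I) (F : I -> ZT) :
  (forall i, P i -> is_laurent (F i)) -> is_laurent (\sum_(i <- r | P i) F i).
Proof. by move=> h; elim/big_ind: _ => //; [apply: laurent0 | apply: laurentD]. Qed.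
Lemma laurent_prod (I : Type) (r : seq I) (P : pred I) (F : I -> ZT) :
  (forall i, P i -> is_laurent (F i)) -> is_laurent (\prod_(i <- r | P i) F i).
Proof. by move=> h; elim/big_ind: _ => //; [apply: laurent1 | apply: laurentM]. Qed.
Lemma laurent_T (k : int) : is_laurent (T ^ k).
Proof.
case: k => k; first by rewrite Texpn; apply: laurent_poly.
by exists k.+1, 1; rewrite tofrac1 NegzE -invr_expz divff ?expf_neq0 ?T_neq0.
Qed.
Lemma laurent_det n (A : 'M[ZT]_n) : (forall i j, is_laurent (A i j)) -> is_laurent (\det A).
Proof.
move=> h; apply: laurent_sum => s _; apply: laurentM; last by apply: laurent_prod.
by rewrite -signr_odd; case: odd; [apply: (laurent_int (-1)) | apply: laurent1].
Qed.
Lemma laurent_adj n (A : 'M[ZT]_n) : (forall i j, is_laurent (A i j)) -> forall i j, is_laurent (\adj A i j).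
Proof.
move=> h i j; rewrite mxE /cofactor; apply: laurentM.
  by rewrite -signr_odd; case: odd; [apply: (laurent_int (-1)) | apply: laurent1].
by apply: laurent_det => u v; rewrite !mxE.
Qed.

(** Coefficient of T^r in the Laurent polynomial T^(-m) p. *)
Definition lcoef (m : nat) (p : {poly int}) (r : int) : int :=
  if r + m%:Z is Posz k then p`_k else 0.

(** Coefficients below the order of the difference agree, whichever powers
   of T are used to clear denominators. *)
Lemma lcoef_eq m p m' p' f g e : T ^+ m * f = tofrac p -> T ^+ m' * g = tofrac p' ->
  Vge e (f - g) -> forall r : int, r < e -> lcoef m p r = lcoef m' p' r.
Proof.
move=> Ef Eg Vfg r re.
have V2 : Vge (e + (m + m')%:Z) (tofrac ('X^m' * p - 'X^m * p')).
  have -> : tofrac ('X^m' * p - 'X^m * p') = (f - g) * T ^ (m + m')%:Z.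
    by rewrite tofracB !tofracM -Ef -Eg PoszD TexpD -!Texpn -![T ^+ _]/(T ^ (_%:Z)); ring.
  by apply: VgeM => //; apply: VgeT.
rewrite /lcoef; case E : (r + m%:Z) => [k|k].
  have := Vge_coef V2 (k := (k + m')%N); rewrite coefB !coefXnM ltnNge leq_addl /= addnK.
  have -> : ((k + m')%N%:Z < e + (m + m')%:Z) by lia.
  move=> /(_ isT) /eqP; rewrite subr_eq0 => /eqP ->.
  case E' : (r + m'%:Z) => [k'|k']; last by case: ltnP => //; lia.
  case: ltnP => h; first lia.
  by congr (_`_ _); lia.
case E' : (r + m'%:Z) => [k'|k'] //.
have := Vge_coef V2 (k := (k' + m)%N); rewrite coefB !coefXnM [X in _ - X]ifN -?leqNgt ?leq_addl // addnK.
have -> : ((k' + m)%N%:Z < e + (m + m')%:Z) by lia.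
move=> /(_ isT); case: ltnP => h; last by lia.
by rewrite sub0r => /eqP; rewrite oppr_eq0 => /eqP.
Qed.

Lemma shift_index (m s i : nat) : (s + i)%N%:Z - (m + s)%N%:Z + m%:Z = i%:Z.
Proof. lia. Qed.

Lemma lcoef_laurent m (p : {poly int}) (f : ZT) : T ^+ m * f = tofrac p -> laurent_coefs f (lcoef m p).
Proof.
move=> E; exists (m + size p)%N => [r hr|].
  rewrite /lcoef; case Er : (r + m%:Z) => [k|k] //.
  by apply: nth_default; move: hr Er; move: (size p) => sp hr Er; lia.
apply: (mulfI (expf_neq0 m T_neq0)); rewrite E /laurent mulr_sumr.
set S := size p.
have -> : (2 * (m + S)).+1 = (S + (S + (2 * m).+1))%N by lia.
rewrite !big_split_ord /= big1 ?add0r => [|i _]; last first.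
  rewrite /lcoef; case Er : (_ + m%:Z) => [k|k]; last by rewrite mul0r mulr0.
  by have := ltn_ord i; lia.
rewrite [X in _ = _ + X]big1 ?addr0 => [|i _]; last first.
  rewrite /lcoef; case Er : (_ + m%:Z) => [k|k]; last by rewrite mul0r mulr0.
  by rewrite nth_default ?mul0r ?mulr0 // -/S; move: Er; clearbody S; move: (nat_of_ord i) => /= i'; lia.
rewrite -[in LHS](coefK p) poly_def rmorph_sum; apply: eq_bigr => i _ /=.
rewrite -mul_polyC tofracM -Texpn mulrCA; congr (_ * _).
  rewrite /lcoef shift_index -[in RHS](rmorph_int (@tofrac _)) -(rmorph_int polyC) /=.
  by rewrite intz.
rewrite -[T ^+ m]/(T ^ m%:Z) -TexpD; congr (_ ^ _).
by rewrite addrC shift_index.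
Qed.

Lemma lcoefM m (p q : {poly int}) (r : int) : lcoef m (q * p) r = \sum_(i < size q) q`_i * lcoef m p (r - i%:Z).
Proof.
rewrite {1}/lcoef; case E : (r + m%:Z) => [k|k]; last first.
  rewrite big1 // => i _; rewrite /lcoef; case E' : (_ + m%:Z) => [k'|k']; last by rewrite mulr0.
  lia.
rewrite coefM.
rewrite (big_ord_widen (k.+1 + size q)%N (fun i => q`_i * p`_(k - i))) ?leq_addr //.
rewrite [RHS](big_ord_widen (k.+1 + size q)%N (fun i => q`_i * lcoef m p (r - i%:Z))) ?leq_addl //.
rewrite big_mkcond [RHS]big_mkcond; apply: eq_bigr => i _; case: ltnP => h1; case: ltnP => h2 //.
- rewrite /lcoef; case E' : (_ + m%:Z) => [k'|k']; last lia.
  by congr (_ * _`_ _); lia.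
- by rewrite nth_default ?mul0r.
- rewrite /lcoef; case E' : (_ + m%:Z) => [k'|k']; last by rewrite mulr0.
  lia.
Qed.

(** Convergence in the T-adic order is what positive stabilization means:
   the coefficient of T^r of [d t] is the same for all large [t], and for these
   [t] the products q (d t) and q l = p agree up to T^r, which is the defining
   equation of the expansion of [l].  The bound [t / 2 - C] is the rate at
   which the invariants of twisted knots converge. *)
Lemma laurent_limit (d : nat -> ZT) (l : ZT) (t1 C : nat) :
  (forall t, is_laurent (d t)) ->
  (forall t, (t1 <= t)%N -> Vge ((t./2)%:Z - C%:Z) (d t - l)) ->
  exists (c : nat -> int -> int) (s : int -> int),
    [/\ forall t : nat, laurent_coefs (d t) (c t),
        stabilizes_positively c,
        limit_of c s
      & laurent_expansion l s].
Proof.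
move=> dL dl.
have dL' t : exists x : nat * {poly int}, T ^+ x.1 * d t == tofrac x.2.
  by have [m [p e]] := dL t; exists (m, p); apply/eqP.
pose x t := xchoose (dL' t).
have xP t : T ^+ (x t).1 * d t = tofrac (x t).2 by apply/eqP/(xchooseP (dL' t)).
pose c t := lcoef (x t).1 (x t).2.
(* from t0 r on, the coefficients up to T^r are final *)
pose t0 (r : int) : nat := maxn t1 (2 * (`|r| + C + 1)).
have t0P r t : (t0 r <= t)%N -> Vge (r + 1) (d t - l).
  by rewrite geq_max => /andP[h1 h2]; apply: Vge_leq (dl t h1); lia.
have cE r t t' : (t0 r <= t)%N -> (t0 r <= t')%N -> c t r = c t' r.
  move=> h h'; apply: (lcoef_eq (xP t) (xP t') (e := r + 1)); last lia.
  have -> : d t - d t' = (d t - l) - (d t' - l) by ring.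
  by apply: VgeB; apply: t0P.
pose s r := c (t0 r) r.
exists c, s; split.
- by move=> t; apply: lcoef_laurent.
- move=> r0; exists (t0 r0) => t r ht hr; apply: (lcoef_eq (xP t) (xP (t0 r0)) (e := r0 + 1)); last lia.
  have -> : d t - d (t0 r0) = (d t - l) - (d (t0 r0) - l) by ring.
  by apply: VgeB; apply: t0P.
- by move=> r; exists (t0 r) => t ht; apply: cE.
split.
  have [k Vk] := Vge_ex l; exists k => r rk.
  have V0 : Vge (r + 1) (d (t0 r) - 0).
    rewrite subr0 -[d _](subrK l); apply: VgeD; first exact: t0P.
    by apply: Vge_leq Vk; lia.
  have Z0 : T ^+ 0 * 0 = tofrac 0 :> ZT by rewrite mulr0.
  rewrite /s /c (lcoef_eq (xP _) Z0 V0); last lia.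
  by rewrite /lcoef; case: (_ + _) => // k0; rewrite coef0.
have [p [q [q0 E]]] := frac_ex l.
exists p, q; split => // r.
pose t := maxn (t0 r) (\max_(i < size q) t0 (r - i%:Z)%R).
have ht (i : 'I_(size q)) : (t0 (r - i%:Z)%R <= t)%N.
  by rewrite leq_max (leq_bigmax i) orbT.
have -> : \sum_(i < size q) q`_i * s (r - i%:Z) = lcoef (x t).1 (q * (x t).2) r.
  transitivity (\sum_(i < size q) q`_i * c t (r - i%:Z)); last by rewrite -lcoefM.
  by apply: eq_bigr => i _; rewrite /s (cE _ _ _ (leqnn _) (ht i)).
have Eq : T ^+ (x t).1 * (tofrac q * d t) = tofrac (q * (x t).2).
  by rewrite tofracM -(xP t) mulrCA.
have Ep : T ^+ 0 * (tofrac p) = tofrac p by rewrite expr0 mul1r.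
rewrite (lcoef_eq Eq Ep (e := r + 1)); last lia.
  by rewrite /lcoef addr0.
have -> : tofrac p = tofrac q * l by rewrite E mulrC divfK // tofrac_eq0.
rewrite -mulrBr -[r + 1]add0r; apply: VgeM; first exact: Vge_poly.
by apply: t0P; apply: leq_maxl.
Qed.

(** * The Burau representation and the full twist *)

Section Burau.
Variables (F : fieldType) (tau : F).
Implicit Types (f g : nat -> F) (u v : seq (bool * nat)).

(** Burau matrices act on functions of the position: a walker at [a] below
   the crossing leaves it at [b] with the weight of the crossing, and the
   result at [a] is the weighted sum of the values of [f]. *)
Definition burau_step (x : bool * nat) f (a : nat) : F :=
  let: (e, i) := x in
  if e then if a == i then (1 - tau) * f i + tau * f i.+1
            else if a == i.+1 then f i else f a
  else if a == i then f i.+1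
       else if a == i.+1 then (f i - (1 - tau) * f i.+1) / tau else f a.
Definition burau u f : nat -> F := foldr burau_step f u.

Lemma burau_cat u v f : burau (u ++ v) f = burau u (burau v f).
Proof. by rewrite /burau foldr_cat. Qed.

Lemma eq_burau_step x f g : f =1 g -> burau_step x f =1 burau_step x g.
Proof. by case: x => e i E a; rewrite /burau_step !E. Qed.
Lemma eq_burau u f g : f =1 g -> burau u f =1 burau u g.
Proof. by move=> E; elim: u => //= x u IH; apply: eq_burau_step. Qed.

Hypothesis tau0 : tau != 0.

(** The weights of the exits of a crossing add up to 1. *)
Lemma burau_affine u c f a : burau u (fun b => c + f b) a = c + burau u f a.
Proof.
elim: u a => //= -[e i] u IH a; rewrite /burau_step !IH.
by case: e; case: ifP => _ //; try ring; case: ifP => _ //; field.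
Qed.

(** The Burau weights satisfy the braid relations.  Hence the action of a
   braid diagram of the full twist can be computed on the standard word. *)
Lemma burau_braid n u v : braid_eq n u v -> forall f a, burau u f a = burau v f a.
Proof.
have cong u1 v1 w1 w2 : (forall f a, burau w1 f a = burau w2 f a) ->
    forall f a, burau (u1 ++ w1 ++ v1) f a = burau (u1 ++ w2 ++ v1) f a.
  by move=> E f a; rewrite !burau_cat; apply: eq_burau => b; apply: E.
elim=> {u v} //.
- by move=> u v w _ IH _ IH' f a; rewrite IH IH'.
- move=> u v e i hi f a; rewrite -[u ++ v]/(u ++ [::] ++ v); apply: cong => {}f {}a /=.
  have e1 : (i == i.+1) = false by lia.
  have e2 : (i.+1 == i) = false by lia.
  rewrite /burau_step; case: (a =P i) => [->|_].
    by case: e => /=; rewrite ?(eqxx, e1, e2) //; field.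
  case: (a =P i.+1) => [->|_]; last by case: e.
  by case: e => /=; rewrite ?(eqxx, e1, e2) //; field.
- move=> u v i j ij _; apply: cong => f a /=; rewrite /burau_step.
  have e1 : (i == j) = false by lia.
  have e2 : (i == j.+1) = false by lia.
  have e3 : (i.+1 == j) = false by lia.
  have e4 : (i.+1 == j.+1) = false by lia.
  have e5 : (j == i) = false by lia.
  have e6 : (j == i.+1) = false by lia.
  have e7 : (j.+1 == i) = false by lia.
  have e8 : (j.+1 == i.+1) = false by lia.
  rewrite ?(e1, e2, e3, e4, e5, e6, e7, e8).
  case: (a =P i) => [->|_]; rewrite ?(e1, e2, e3, e4, e5, e6, e7, e8) //.
  by case: (a =P i.+1) => [->|_]; rewrite ?(e1, e2, e3, e4, e5, e6, e7, e8) //.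
- move=> u v i _; apply: cong => f a /=; rewrite /burau_step.
  have e1 : (i == i.+1) = false by lia.
  have e2 : (i.+1 == i) = false by lia.
  have e3 : (i == i.+2) = false by lia.
  have e4 : (i.+2 == i) = false by lia.
  have e5 : (i.+1 == i.+2) = false by lia.
  have e6 : (i.+2 == i.+1) = false by lia.
  case: (a =P i) => [->|n1]; rewrite ?(eqxx, e1, e2, e3, e4, e5, e6); first by ring.
  by case: (a == i.+1) => //; case: (a == i.+2).
Qed.

Lemma burau_iota k m f a : burau [seq (true, i) | i <- iota k m] f a
  = if (a < k)%N || (k + m < a)%N then f a
    else if a == k then (1 - tau) * \sum_(j < m) tau ^+ j * f (k + j)%N + tau ^+ m * f (k + m)%N
    else f a.-1.
Proof.
elim: m k a => [|m IH] k a /=.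
  rewrite big_ord0 addn0; case: ltngtP => //= ->.
  by rewrite mulr0 add0r expr0 mul1r.
rewrite !IH ltnSn /= ltnn /= eqxx.
have -> : (k.+1 + m < k.+1)%N = false by lia.
case: (a =P k) => [->|n1].
  rewrite ltnn /= ifF; last lia.
  rewrite big_ord_recl /= expr0 mul1r addn0 addSnnS mulrDr mulrDr -addrA; congr (_ + _).
  rewrite exprS -mulrA; congr (_ + _); rewrite mulrCA; congr (_ * _).
  rewrite mulr_sumr; apply: eq_bigr => j _.
  by rewrite /bump /= add1n exprS mulrA addSnnS.
case: (a =P k.+1) => [->|n2].
  by rewrite ifF //; lia.
case: ifP => h; case: ifP => h' //; lia.
Qed.

Variable n : nat.
Hypothesis n_gt0 : (0 < n)%N.

Definition tausum := \sum_(j < n) tau ^+ j.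
(** Mean of [f] with geometric weights; [f] is sent to the constant
   [taumean f] by the matrix of an infinite twist vertex. *)
Definition taumean f := (\sum_(j < n) tau ^+ j * f j) / tausum.
Hypothesis tausum0 : tausum != 0.
Definition braid_word (w : seq nat) := [seq (true, i) | i <- w].
Notation C := (burau (braid_word (iota 0 n.-1))).

Lemma burau_cycleE f a : (a < n)%N ->
  C f a = if a == 0%N then (1 - tau) * (\sum_(j < n) tau ^+ j * f j) + tau ^+ n * f n.-1
          else f a.-1.
Proof.
move=> an; rewrite burau_iota ltn0 /= add0n ifF; last lia.
case: eqP => // _; move: n_gt0; case: (n) => // m _ /=.
rewrite big_ord_recr /=.
under eq_bigr do rewrite add0n.
by rewrite exprS; ring.
Qed.

(** The mean is invariant because the row of powers of [tau] is a left
   fixed vector of the Burau matrices. *)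
Lemma burau_cycle_sum f : \sum_(j < n) tau ^+ j * C f j = \sum_(j < n) tau ^+ j * f j.
Proof.
have H := burau_cycleE f; move: H n_gt0; set g := C f; case: (n) => // m H _.
rewrite big_ord_recl /= H // eqxx.
under eq_bigr => i _ do rewrite H /bump /= ?add1n ?ltnS ?ltn_ord //.
rewrite [RHS]big_ord_recr big_ord_recr /= expr0 mul1r mulrDr.
have -> : \sum_(i < m) tau ^+ i.+1 * f i = tau * \sum_(i < m) tau ^+ i * f i.
  by rewrite mulr_sumr; apply: eq_bigr => i _; rewrite exprS mulrA.
rewrite exprS; ring.
Qed.

(** On functions of mean zero, [C] shifts the values by one position and
   multiplies the value that wraps around by tau^n. *)
Lemma burau_cycle_pow k f a : (k <= n)%N -> \sum_(j < n) tau ^+ j * f j = 0 -> (a < n)%N ->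
  iter k C f a = if (a < k)%N then tau ^+ n * f (a + n - k)%N else f (a - k)%N.
Proof.
move=> kn f0; have s0 l : \sum_(j < n) tau ^+ j * iter l C f j = 0.
  by elim: l => //= l IH; rewrite burau_cycle_sum.
elim: k kn a => [|k IH] kn a an; first by rewrite /= subn0.
rewrite iterS burau_cycleE // s0 mulr0 add0r.
case: eqP => [->|n1].
  rewrite IH ?ltn0Sn //=; try lia.
  by rewrite ifF ?add0n; [congr (_ * f _) | ]; lia.
rewrite IH; try lia; case: ifP => h; case: ifP => h'; try lia; congr (_ * f _) || congr (f _); lia.
Qed.

Definition twist_word := flatten (nseq n (iota 0 n.-1)).

Lemma burau_twist_iter f a : burau (braid_word twist_word) f a = iter n C f a.
Proof.
suff H k b : burau (braid_word (flatten (nseq k (iota 0 n.-1)))) f b = iter k C f b by apply: H.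
elim: k b => //= k IH b.
by rewrite /braid_word map_cat burau_cat; apply: eq_burau.
Qed.

(** Applying [C] n times multiplies every value of the mean zero part by
   tau^n, and the constant part is fixed. *)
Lemma burau_full_twist f a : (a < n)%N ->
  burau (braid_word twist_word) f a = taumean f + tau ^+ n * (f a - taumean f).
Proof.
move=> an; set c := taumean f.
transitivity (burau (braid_word twist_word) (fun b => c + (f b - c)) a).
  by apply: eq_burau => b; rewrite addrC subrK.
rewrite burau_affine burau_twist_iter burau_cycle_pow //.
  by rewrite an addnK.
under eq_bigr do rewrite mulrBr.
by rewrite sumrB -mulr_suml /c /taumean mulrC divfK ?subrr.
Qed.

Lemma taumean_twist c f : taumean (fun a => taumean f + c * (f a - taumean f)) = taumean f.
Proof.
rewrite {1}/taumean; apply: (mulIf tausum0); rewrite divfK //.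
have E : \sum_(j < n) tau ^+ j * f j = taumean f * tausum by rewrite divfK.
set m := taumean f in E *.
transitivity (\sum_(j < n) (tau ^+ j * (m * (1 - c)) + c * (tau ^+ j * f j))).
  by apply: eq_bigr => j _; ring.
by rewrite big_split /= -mulr_suml -mulr_sumr E -/tausum; ring.
Qed.

Lemma eq_taumean f g : (forall a, (a < n)%N -> f a = g a) -> taumean f = taumean g.
Proof. by move=> E; congr (_ / _); apply: eq_bigr => i _; rewrite E. Qed.

(** The t-th power of the full twist is P + tau^(nt) (1 - P), where P is
   the projection onto the constants.  As t grows it tends to P, the matrix
   of an infinite twist vertex. *)
Lemma burau_twist_pow w t f a : full_twist n w -> (a < n)%N ->
  burau (braid_word (flatten (nseq t w))) f a = taumean f + (tau ^+ n) ^+ t * (f a - taumean f).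
Proof.
move=> [hw bw]; elim: t a => [|t IH] a an /=; first by rewrite expr0 mul1r addrC subrK.
rewrite /braid_word map_cat burau_cat -/(braid_word w) (burau_braid bw).
rewrite -/(braid_word twist_word) burau_full_twist //.
rewrite (eq_taumean IH) IH // taumean_twist exprS; ring.
Qed.

End Burau.

Lemma braid_eq_size n u v : braid_eq n u v ->
  \sum_(x <- u) (-1) ^+ (~~ x.1) = \sum_(x <- v) (-1) ^+ (~~ x.1) :> int.
Proof.
elim=> {u v} //.
- by move=> u v w _ -> _ ->.
- by move=> u v e i _; rewrite !big_cat /= !big_cons big_nil; case: e; rewrite /= ?expr0 ?expr1; ring.
- by move=> u v i j _ _; rewrite !big_cat /= !big_cons.
- by move=> u v i _; rewrite !big_cat /= !big_cons.
Qed.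

(** The exponent sum is invariant under the braid relations. *)
Lemma full_twist_size n w : full_twist n w -> size w = (n * (n - 1))%N.
Proof.
have E (s : seq nat) : \sum_(x <- [seq (true, i) | i <- s]) (-1) ^+ (~~ x.1) = (size s)%:Z.
  elim: s => [|x s IH]; first by rewrite big_nil.
  by rewrite /= big_cons IH /=; lia.
move=> [_ /braid_eq_size]; rewrite !E => - [->].
by elim: {1 3}n => //= k IH; rewrite size_cat size_iota IH; lia.
Qed.

(** The strand at position [a] below a crossing at [i] is at [wstep a i]
   above it. *)
Definition wstep (a i : nat) : nat := if a == i then i.+1 else if a == i.+1 then i else a.
Definition wperm (w : seq nat) (a : nat) : nat := foldl wstep a w.

Lemma burau_wperm (w : seq nat) (f : nat -> rat) a : burau 1 (braid_word w) f a = f (wperm w a).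
Proof.
elim: w a => //= i w IH a; rewrite /burau_step !IH /wstep subrr mul0r add0r mul1r.
by case: eqP => // _; case: eqP.
Qed.

(** At tau = 1 the Burau matrices are the permutation matrices of the
   braid, and the full twist acts trivially. *)
Lemma full_twist_perm n w a : full_twist n w -> (a < n)%N -> wperm w a = a.
Proof.
move=> fw an; have n_gt0 : (0 < n)%N by lia.
have s0 : tausum (1 : rat) n != 0.
  by rewrite /tausum; under eq_bigr do rewrite expr1n; rewrite sumr_const card_ord pnatr_eq0 -lt0n.
have := burau_twist_pow (oner_neq0 rat) n_gt0 s0 1 (fun k => k%:R) fw an.
rewrite /= cats0 burau_wperm !expr1n mul1r addrC subrK => /eqP.
by rewrite eqr_nat => /eqP.
Qed.

(** * First order expansions at T = 1 *)

(** The expansion of [f] at T = 1 is a + b (T - 1) up to order 2, with a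
   Laurent polynomial as remainder. *)
Definition jet1 (f : ZT) (a b : int) : Prop :=
  exists2 g, is_laurent g & f = a%:~R + b%:~R * (T - 1) + (T - 1) ^+ 2 * g.

Lemma jet1_const (a : int) : jet1 a%:~R a 0.
Proof. by exists 0; [exact: laurent0 | rewrite mul0r mulr0 !addr0]. Qed.
Lemma laurent_T1 : is_laurent (T - 1). Proof. by apply: laurentB; [exact: (laurent_T 1) | exact: laurent1]. Qed.
Lemma jet1_eq f a b a' b' : jet1 f a b -> a = a' -> b = b' -> jet1 f a' b'.
Proof. by move=> h <- <-. Qed.
Lemma jet1D f g a b a' b' : jet1 f a b -> jet1 g a' b' -> jet1 (f + g) (a + a') (b + b').
Proof.
by move=> [h Lh ->] [h' Lh' ->]; exists (h + h'); [exact: laurentD | rewrite !rmorphD /=; ring].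
Qed.
Lemma jet1M f g a b a' b' : jet1 f a b -> jet1 g a' b' -> jet1 (f * g) (a * a') (a * b' + b * a').
Proof.
have LT := laurent_T1; have Li := laurent_int.
move=> [h Lh ->] [h' Lh' ->]; exists (b%:~R * b'%:~R + a%:~R * h' + a'%:~R * h +
   (T - 1) * (b%:~R * h' + b'%:~R * h) + (T - 1) ^+ 2 * h * h').
  by rewrite expr2; repeat first [exact: LT | exact: Li | assumption | apply: laurentD | apply: laurentM].
by rewrite !rmorphD !rmorphM /=; ring.
Qed.
Lemma jet1_sum (I : Type) (r : seq I) (P : pred I) (F : I -> ZT) A B :
  (forall i, P i -> jet1 (F i) (A i) (B i)) ->
  jet1 (\sum_(i <- r | P i) F i) (\sum_(i <- r | P i) A i) (\sum_(i <- r | P i) B i).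
Proof.
move=> h; elim: r => [|x r IH]; first by rewrite !big_nil; exact: (jet1_const 0).
by rewrite !big_cons; case: ifP => // px; apply: jet1D => //; apply: h.
Qed.
Lemma jet1N f a b : jet1 f a b -> jet1 (- f) (- a) (- b).
Proof.
move=> h; have := jet1M (jet1_const (-1)) h.
by rewrite mul0r addr0 rmorphN rmorph1 !mulN1r.
Qed.
Lemma jet1B f g a b a' b' : jet1 f a b -> jet1 g a' b' -> jet1 (f - g) (a - a') (b - b').
Proof. by move=> h h'; apply: jet1D => //; apply: jet1N. Qed.
(** The expansion of the inverse of T, with exact remainder. *)
Lemma inv_jet (F : fieldType) (x : F) : x != 0 -> x^-1 = 1 - (x - 1) + (x - 1) ^+ 2 * x^-1.
Proof. by move=> x0; field. Qed.
Lemma jet1_T (k : int) : jet1 (T ^ k) 1 k.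
Proof.
have P (n : nat) : jet1 (T ^+ n) 1 n%:Z.
  elim: n => [|n IH]; first exact: (jet1_const 1).
  have h1 : jet1 T 1 1 by exists 0; [exact: laurent0 | ring].
  by rewrite exprS; apply: (jet1_eq (jet1M h1 IH)); lia.
have N (n : nat) : jet1 (T^-1 ^+ n) 1 (- n%:Z).
  elim: n => [|n IH]; first exact: (jet1_const 1).
  have h1 : jet1 T^-1 1 (-1).
    exists T^-1; first exact: (laurent_T (-1)).
    by rewrite {1}(inv_jet T_neq0) rmorphN rmorph1 mulN1r.
  by rewrite exprS; apply: (jet1_eq (jet1M h1 IH)); lia.
by case: k => k; [exact: P | have := N k.+1; rewrite exprVn NegzE].
Qed.

(** After clearing the power of T, the value and the derivative of a
   polynomial at 1 determine a and b. *)
Lemma jet1_uniq f a b a' b' : jet1 f a b -> jet1 f a' b' -> a = a' /\ b = b'.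
Proof.
move=> h1 h2; have := jet1B h1 h2; rewrite subrr => -[g [m [p Ep]]].
move: (a - a') (subr_eq0 a a') (b - b') (subr_eq0 b b') => x Ex y Ey E.
have : tofrac ('X^m * (x%:P + y%:P * ('X - 1)) + ('X - 1) ^+ 2 * p) = 0 :> ZT.
  rewrite !(tofracD, tofracM, tofracXn, tofracN, tofrac1) -Ep -/T.
  have i z : tofrac z%:P = z%:~R :> ZT.
    by rewrite -[in RHS](rmorph_int (@tofrac _)) -(rmorph_int polyC) /= intz.
  by rewrite !i -[RHS](mulr0 (T ^+ m)) E; ring.
move=> /eqP; rewrite tofrac_eq0 => /eqP E0.
have H1 := congr1 (fun q : {poly int} => q.[1]) E0.
move: H1; rewrite !(hornerE, horner_exp) expr1n mul1r => x0.
have H2 := congr1 (fun q : {poly int} => q^`().[1]) E0.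
move: H2; rewrite !derivE !(hornerE, horner_exp) /=.
rewrite x0 expr1n mulr0 !addr0 add0r mul1r mulr1 => y0.
by move: Ex Ey; rewrite x0 y0 eqxx => /esym/eqP -> /esym/eqP ->.
Qed.

(** Modulo (T - 1)^2 only the identity permutation contributes: any other
   permutation has two nonfixed points, hence two factors divisible by T - 1. *)
Lemma jet1_det n (B : 'M[ZT]_n) (b : 'I_n -> 'I_n -> int) :
  (forall k l, jet1 (B k l) (k == l)%:Z (b k l)) ->
  jet1 (\det B) 1 (\sum_k b k k).
Proof.
move=> hB; rewrite /determinant (bigD1 (1%g : 'S_n)) //=.
apply: (@jet1_eq _ (1 + 0) (\sum_k b k k + 0)); [apply: jet1D | exact: addr0 | exact: addr0].
  rewrite odd_perm1 expr0 mul1r.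
  elim: (index_enum _) => [|k s IH]; first by rewrite !big_nil; apply: (jet1_const 1).
  rewrite !big_cons perm1; have := jet1M (hB k k) IH.
  by rewrite eqxx !mul1r mulr1 addrC.
apply: jet1_eq; [apply: (@jet1_sum _ (index_enum _) (fun s : 'S_n => s != 1%g) _ (fun=> 0 : int) (fun=> 0 : int))  | by rewrite big1 | by rewrite big1].
move=> s sn1.
have [i0 hi0] : exists i, s i != i.
  apply/existsP; apply: contraR sn1; rewrite negb_exists => /forallP h.
  by apply/eqP/permP => i; rewrite perm1; apply/eqP; move: (h i); rewrite negbK.
(* i0 and s i0 are two points moved by s *)
have hi1 : s (s i0) != s i0 by rewrite (inj_eq perm_inj).
rewrite (bigD1 i0) //= (bigD1 (s i0)) //=.
have hr : exists a c, jet1 (\prod_(i | (i != i0) && (i != s i0)) B i (s i)) a c.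
  elim/big_rec: _ => [|i x _ [a [c hx]]]; first by exists 1, 0; apply: (jet1_const 1).
  by exists ((i == s i)%:Z * a), ((i == s i)%:Z * c + b i (s i) * a); apply: jet1M.
have [a [c hac]] := hr.
have hs : exists a, jet1 ((-1) ^+ s) a 0.
  by case: (odd_perm s); [exists (-1); apply: (jet1_const (-1)) | exists 1; apply: (jet1_const 1)].
have [e he] := hs.
have := jet1M he (jet1M (hB i0 (s i0)) (jet1M (hB (s i0) (s (s i0))) hac)).
by rewrite eq_sym (negPf hi0) eq_sym (negPf hi1) !(mul0r, mulr0, add0r, addr0).
Qed.

(** By symmetry the derivative at 1 vanishes. *)
Lemma jet1_laurent m (c : int -> int) : (forall r, c (- r) = c r) ->
  \sum_(i < (2 * m).+1) c (i%:Z - m%:Z) = 1 -> jet1 (laurent m c) 1 0.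
Proof.
move=> cs c1.
have c2 : \sum_(i < (2 * m).+1) c (i%:Z - m%:Z) * (i%:Z - m%:Z) = 0.
  set S := LHS; suff : S = - S by lia.
  rewrite {1}/S (reindex_inj rev_ord_inj) /= -sumrN; apply: eq_bigr => i _.
  have -> : ((2 * m).+1 - i.+1)%N%:Z - m%:Z = - (i%:Z - m%:Z) by have := ltn_ord i; lia.
  by rewrite cs mulrN.
apply: (jet1_eq (a := \sum_(i < (2 * m).+1) c (i%:Z - m%:Z))
  (b := \sum_(i < (2 * m).+1) c (i%:Z - m%:Z) * (i%:Z - m%:Z))) => //.
apply: jet1_sum => i _.
by have := jet1M (jet1_const (c (i%:Z - m%:Z))) (jet1_T (i%:Z - m%:Z)); rewrite mulr1 mul0r addr0.
Qed.

(** The normalization of the Alexander polynomial is determined by its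
   expansion 1 + 0 (T - 1) at T = 1, which fixes the power of T; squaring
   removes the sign. *)
Lemma symmetrized_alexander_sq D Delta b : symmetrized_alexander D Delta ->
  jet1 (alexander_minor D) 1 b ->
  Delta ^+ 2 = T ^ (- (b * 2)) * alexander_minor D ^+ 2.
Proof.
move=> [[e [k ED]] [m [c [El cs c1]]]] jm.
have j1 := jet1_laurent cs c1; rewrite -El ED in j1.
have je : jet1 ((-1) ^+ e) ((-1) ^+ e) 0.
  by case: (e); [apply: (jet1_const (-1)) | apply: (jet1_const 1)].
have [E1 E2] := jet1_uniq j1 (jet1M (jet1M je (jet1_T k)) jm).
have Ek : k = - b.
  by move: E1 E2; case: (e); rewrite ?expr0 ?expr1; lia.
rewrite ED !exprMn -exprM mulnC exprM sqrrN !expr1n mul1r Ek.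
by rewrite [(T ^ (- b)) ^+ 2]exprnP exprz_exp mulNr.
Qed.

(** * Geometry of layered diagrams *)

Local Open Scope nat_scope.

Arguments Defs.next : simpl never.

Section Geometry.
Variable D : diagram.
Hypothesis wf : well_formed D.

Notation level := (level D).
Notation lpos := (Defs.lpos D).
Notation next := (Defs.next D).
Notation piece_at h := (layer_at D h).2.
Notation bot h := (bottom_side (piece_at h)).
Notation top h := (top_side (piece_at h)).
Notation E := ((size D, 0) : point).
Definition up (x : point) : bool := nth true (level x.1) x.2.
Definition enters_node (x : point) : bool :=
  [&& x.1 < size D, is_node D x.1, lpos x.1 <= x.2 & x.2 < lpos x.1 + size (bot x.1)].

Lemma level0 : level 0 = [:: true].
Proof. by rewrite /Defs.level take0. Qed.
Lemma level_end : level (size D) = [:: true].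
Proof. by case/andP: wf => _ /eqP. Qed.
Lemma fits h : h < size D -> layer_fits (layer_at D h) (level h).
Proof. by case/andP: wf => /allP hw _ hh; apply: hw; rewrite mem_iota. Qed.
Lemma levelS h : h < size D -> level h.+1 = apply_layer (level h) (layer_at D h).
Proof.
by move=> hh; rewrite /Defs.level (take_nth (0, Cup true)) // foldl_rcons.
Qed.
Lemma level_split h : h < size D ->
  exists A B, [/\ size A = lpos h, level h = A ++ bot h ++ B & level h.+1 = A ++ top h ++ B].
Proof.
move=> hh; have /andP[h1 /prefixP[B EB]] := fits hh.
exists (take (lpos h) (level h)), B; split; first by rewrite size_take_min; apply/minn_idPl.
  by rewrite -EB cat_take_drop.
rewrite levelS // /apply_layer; congr (_ ++ _ ++ _).
by rewrite addnC -drop_drop EB drop_size_cat.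
Qed.
Lemma size_bot h : h < size D -> lpos h + size (bot h) <= size (level h).
Proof. by case/level_split => A [B [<- -> _]]; rewrite !size_cat addnA leq_addr. Qed.
Lemma size_levelS h : h < size D -> size (level h.+1) + size (bot h) = size (level h) + size (top h).
Proof. by case/level_split => A [B [_ -> ->]]; rewrite !size_cat; lia. Qed.
Lemma up_left h p : h < size D -> p < lpos h -> up (h.+1, p) = up (h, p).
Proof. by rewrite /up /= => /level_split [A [B [<- -> ->]]] hp; rewrite !nth_cat hp. Qed.
Lemma up_right h p : h < size D -> up (h.+1, lpos h + size (top h) + p) = up (h, lpos h + size (bot h) + p).
Proof.
rewrite /up /= => /level_split [A [B [<- -> ->]]]; rewrite !nth_cat -!addnA !ltnNge !leq_addr /=.
by rewrite ![size A + _]addnC !addnK !leq_addr /= ![size _ + p]addnC !addnK.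
Qed.
Lemma up_bot h i : h < size D -> i < size (bot h) -> up (h, lpos h + i) = nth true (bot h) i.
Proof.
rewrite /up /= => /level_split [A [B [<- -> _]]] hi.
by rewrite !nth_cat ltnNge leq_addr /= addnC addnK hi.
Qed.
Lemma up_top h i : h < size D -> i < size (top h) -> up (h.+1, lpos h + i) = nth true (top h) i.
Proof.
rewrite /up /= => /level_split [A [B [<- _ ->]]] hi.
by rewrite !nth_cat ltnNge leq_addr /= addnC addnK hi.
Qed.

Lemma mem_points x : (x \in points D) = (x.1 <= size D) && (x.2 < size (level x.1)).
Proof.
case: x => h p /=; apply/allpairsPdep/idP.
  by move=> [h' [p' []]]; rewrite !mem_iota !add0n /= => h1 h2 [-> ->]; rewrite -ltnS h1.
by move=> /andP[h1 h2]; exists h, p; split => //; rewrite mem_iota.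
Qed.
Lemma uniq_points : uniq (points D).
Proof.
rewrite /points; apply: allpairs_uniq_dep; rewrite ?iota_uniq //.
  by move=> *; apply: iota_uniq.
by move=> [h p] [h' p'] _ _ /= [-> ->].
Qed.

Lemma next_up_left h p : h < size D -> p < lpos h -> up (h, p) -> next (h, p) = (h.+1, p).
Proof. by rewrite /up /Defs.next /Defs.lpos /= => -> hp ->; case: (layer_at D h) hp => q e /= ->. Qed.
Lemma next_up_right h p : h < size D -> up (h, lpos h + size (bot h) + p) ->
  next (h, lpos h + size (bot h) + p) = (h.+1, lpos h + size (top h) + p).
Proof.
rewrite /up /Defs.next /Defs.lpos /= => -> ->; case: (layer_at D h) => q e /=.
rewrite ifF; last by lia.
by rewrite ifT; [congr pair | ]; lia.
Qed.
Lemma next_down_left h p : h < size D -> p < lpos h -> ~~ up (h.+1, p) -> next (h.+1, p) = (h, p).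
Proof.
by rewrite /up /Defs.next /Defs.lpos /= => _ hp /negPf ->; case: (layer_at D h) hp => q e /= ->.
Qed.
Lemma next_down_right h p : h < size D -> ~~ up (h.+1, lpos h + size (top h) + p) ->
  next (h.+1, lpos h + size (top h) + p) = (h, lpos h + size (bot h) + p).
Proof.
rewrite /up /Defs.next /Defs.lpos /= => _ /negPf ->; case: (layer_at D h) => q e /=.
rewrite ifF; last by lia.
by rewrite ifT; [congr pair | ]; lia.
Qed.
Lemma next_crossing h s i : h < size D -> piece_at h = Crossing s -> i < 2 ->
  next (h, lpos h + i) = (h.+1, lpos h + (1 - i)).
Proof.
move=> hh e i2; have := up_bot (i := i) hh; rewrite e => /(_ i2).
have -> : nth true (bottom_side (Crossing s)) i = true by case: i i2 => [|[|]].
rewrite /up /Defs.next /Defs.lpos /= => ->; rewrite hh.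
case: (layer_at D h) e => q _ /= ->.
rewrite ifF; last by lia.
rewrite ifF; last by rewrite /=; lia.
by rewrite addKn.
Qed.
Lemma next_vertex h n i : h < size D -> piece_at h = TwistVertex n -> i < n ->
  next (h, lpos h + i) = (h.+1, lpos h + i).
Proof.
move=> hh e i2; have := up_bot (i := i) hh; rewrite e /= size_nseq => /(_ i2).
rewrite nth_nseq i2.
rewrite /up /Defs.next /Defs.lpos /= => ->; rewrite hh.
case: (layer_at D h) e => q _ /= ->.
rewrite ifF; last by lia.
by rewrite ifF // size_nseq; lia.
Qed.
(** The legs are numbered from left to right and the upward one is leg 0
   when [b] holds, hence leg [~~ b]; the turn goes from it to leg [b]. *)
Lemma next_cap h b : h < size D -> piece_at h = Cap b ->
  next (h, lpos h + ~~ b) = (h, lpos h + b).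
Proof.
move=> hh e; have := up_bot (i := ~~ b) hh; rewrite e => /(_ (ltac:(by case: (b)))).
have -> : nth true (bottom_side (Cap b)) (~~ b) = true by case: b {e}.
rewrite /up /Defs.next /Defs.lpos /= => ->; rewrite hh.
case: (layer_at D h) e => q _ /= ->.
rewrite ifF; last by lia.
rewrite ifF; last by rewrite /=; case: (b); lia.
by rewrite addKn; case: b.
Qed.
Lemma next_cup h b : h < size D -> piece_at h = Cup b ->
  next (h.+1, lpos h + b) = (h.+1, lpos h + ~~ b).
Proof.
move=> hh e; have := up_top (i := b) hh; rewrite e => /(_ (ltac:(by case: (b)))).
have -> : nth true (top_side (Cup b)) b = false by case: b {e}.
rewrite /up /Defs.next /Defs.lpos /= => ->.
case: (layer_at D h) e => q _ /= ->.
rewrite ifF; last by lia.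
rewrite ifF; last by rewrite /=; case: (b); lia.
by rewrite addKn; case: b.
Qed.

Lemma bottom_cases (P : nat -> Prop) h : h < size D ->
  (forall p, p < lpos h -> P p) -> (forall i, i < size (bot h) -> P (lpos h + i)) ->
  (forall p, lpos h + size (bot h) + p < size (level h) -> P (lpos h + size (bot h) + p)) ->
  forall p, p < size (level h) -> P p.
Proof.
move=> hh h1 h2 h3 p hp; case: (ltnP p (lpos h)) => a1; first exact: h1.
case: (ltnP p (lpos h + size (bot h))) => a2.
  by rewrite -(subnKC a1); apply: h2; lia.
by rewrite -(subnKC a2); apply: h3; rewrite subnKC.
Qed.
Lemma top_cases (P : nat -> Prop) h : h < size D ->
  (forall p, p < lpos h -> P p) -> (forall i, i < size (top h) -> P (lpos h + i)) ->
  (forall p, lpos h + size (bot h) + p < size (level h) -> P (lpos h + size (top h) + p)) ->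
  forall p, p < size (level h.+1) -> P p.
Proof.
move=> hh h1 h2 h3 p hp; case: (ltnP p (lpos h)) => a1; first exact: h1.
case: (ltnP p (lpos h + size (top h))) => a2.
  by rewrite -(subnKC a1); apply: h2; lia.
rewrite -(subnKC a2); apply: h3; have := size_levelS hh; lia.
Qed.

Lemma leaves_up x : x \in points D -> leaves_node D x -> up x.
Proof.
case: x => -[|h] p //; rewrite mem_points /= => /andP[h1 h2] /and3P[nd h3 h4].
rewrite -(subnKC h3) up_top //; last by lia.
have : p - lpos h < size (top h) by lia.
move: nd; rewrite /is_node; case: (piece_at h) => //= n; rewrite ?size_nseq.
  by case: (p - lpos h) => [|[|]].
by move=> _ l; rewrite nth_nseq l.
Qed.
Lemma enters_up x : enters_node x -> up x.
Proof.
case: x => h p /and4P[/= h1 nd h3 h4].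
rewrite -(subnKC h3) up_bot //; last by lia.
have : p - lpos h < size (bot h) by lia.
move: nd; rewrite /is_node; case: (piece_at h) => //= n; rewrite ?size_nseq.
  by case: (p - lpos h) => [|[|]].
by move=> _ l; rewrite nth_nseq l.
Qed.

Lemma upP x : x \in points D -> up x -> x != E -> x.1 < size D.
Proof.
case: x => h p; rewrite mem_points /= leq_eqVlt => /andP[/orP[/eqP ->|//]].
by rewrite level_end /=; case: p => //= _ _; rewrite eqxx.
Qed.
Lemma downP x : x \in points D -> ~~ up x -> exists h, x.1 = h.+1 /\ h < size D.
Proof.
case: x => -[|h] p; rewrite mem_points /=; first by rewrite /up level0; case: p => //=.
by move=> /andP[h1 _] _; exists h.
Qed.

(** Every step of the traversal follows a vertical strand on either side of
   a layer, upward or downward, or goes through a crossing, a twist vertex, a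
   cap or a cup. *)
Lemma next_ind (P : point -> point -> Prop) :
  (forall h p, h < size D -> p < lpos h -> (h, p) \in points D -> up (h, p) -> P (h, p) (h.+1, p)) ->
  (forall h p, h < size D -> p < lpos h -> (h.+1, p) \in points D -> ~~ up (h.+1, p) -> P (h.+1, p) (h, p)) ->
  (forall h p, let x := (h, lpos h + size (bot h) + p) in let y := (h.+1, lpos h + size (top h) + p) in
     h < size D -> x \in points D -> up x -> P x y) ->
  (forall h p, let x := (h, lpos h + size (bot h) + p) in let y := (h.+1, lpos h + size (top h) + p) in
     h < size D -> y \in points D -> ~~ up y -> P y x) ->
  (forall h s i, h < size D -> piece_at h = Crossing s -> i < 2 ->
     P (h, lpos h + i) (h.+1, lpos h + (1 - i))) ->
  (forall h n i, h < size D -> piece_at h = TwistVertex n -> i < n ->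
     P (h, lpos h + i) (h.+1, lpos h + i)) ->
  (forall h b, h < size D -> piece_at h = Cap b -> P (h, lpos h + ~~ b) (h, lpos h + b)) ->
  (forall h b, h < size D -> piece_at h = Cup b -> P (h.+1, lpos h + b) (h.+1, lpos h + ~~ b)) ->
  forall x, x \in points D -> x != E -> P x (next x).
Proof.
move=> PLu PLd PRu PRd PX PV Pcap Pcup x px xE; have [u|d] := boolP (up x).
  have := upP px u xE; case: x px xE u => h p px xE u /= hh.
  have hp : p < size (level h) by move: px; rewrite mem_points /= => /andP[].
  move: p hp px u {xE}; apply: (bottom_cases hh) => [p hp|i hi|p hp] px u.
  - by rewrite next_up_left //; apply: PLu.
  - case e : (piece_at h) hi => [s|b|b|n] /= hi.
    + by rewrite (next_crossing hh e) //; apply: PX e hi.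
    + by [].
    + have Ei : i = ~~ b.
        by move: u; rewrite up_bot ?e //=; clear -hi; case: b i hi => -[|[|]].
      by rewrite Ei (next_cap hh e); apply: Pcap.
    + by rewrite size_nseq in hi; rewrite (next_vertex hh e) //; apply: PV e hi.
  - by rewrite next_up_right //; apply: PRu.
have [h [Eh hh]] := downP px d; case: x Eh px xE d => _ p /= -> px xE d.
have hp : p < size (level h.+1) by move: px; rewrite mem_points /= => /andP[].
move: p hp px d {xE}; apply: (top_cases hh) => [p hp|i hi|p hp] px d.
- by rewrite next_down_left //; apply: PLd.
- move: d; rewrite up_top //; case e : (piece_at h) hi => [s|b|b|n] //= hi.
  + by case: i hi px => [|[|]].
  + move=> d; have Ei : i = b by move: d hi; clear; case: b; case: i => [|[|]].
    by rewrite Ei (next_cup hh e); apply: Pcup.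
  + by rewrite size_nseq in hi; rewrite nth_nseq hi.
- by rewrite next_down_right //; apply: PRd.
Qed.

(** A step enters a node at its start exactly when it leaves a node at its
   end; this makes the strand number increase by one at each node. *)
Lemma next_spec x : x \in points D -> x != E ->
  next x \in points D /\ leaves_node D (next x) = enters_node x.
Proof.
have NL y : y \in points D -> ~~ up y -> leaves_node D y = false.
  by move=> py uy; apply/negP => /(leaves_up py); apply/negP.
have NE y : ~~ up y -> enters_node y = false.
  by move=> uy; apply/negP => /enters_up; apply/negP.
have sl h : h < size D -> lpos h + size (bot h) <= size (level h) /\
    size (level h.+1) + size (bot h) = size (level h) + size (top h).
  by move=> hh; split; [apply: size_bot | apply: size_levelS].
move: x; apply: (next_ind (P := fun x y => y \in points D /\ leaves_node D y = enters_node x)).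
- move=> h p hh hp px u; have [h1 h2] := sl h hh.
  rewrite mem_points /enters_node /= hh [lpos h <= p]leqNgt hp !andbF; split => //; lia.
- move=> h p hh hp px u; have [h1 h2] := sl h hh.
  have px' : (h, p) \in points D by rewrite mem_points /= ltnW //=; lia.
  by rewrite NE // NL // -up_left.
- move=> h p x y hh; rewrite !mem_points /enters_node /= hh => /andP[_ hp] u.
  by have [h1 h2] := sl h hh; split; lia.
- move=> h p x y hh py u; have [h1 h2] := sl h hh.
  have px' : x \in points D by move: py; rewrite !mem_points /= => /andP[_ hp]; rewrite ltnW //=; lia.
  by rewrite NE // NL // /x -up_right.
- move=> h s i hh e hi; have [] := sl h hh; rewrite e /= => h1 h2.
  rewrite mem_points /enters_node /is_node /= e /= hh; split; lia.
- move=> h n i hh e hi; have [] := sl h hh; rewrite e /= size_nseq => h1 h2.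
  rewrite mem_points /enters_node /is_node /= e /= hh size_nseq; split; lia.
- move=> h b hh e; have [h1 h2] := sl h hh; rewrite e /= in h1 h2.
  have pt : (h, lpos h + b) \in points D by rewrite mem_points /= ltnW //; case: (b); lia.
  split=> //; rewrite NL // ?up_bot ?e /=; try by case: (b).
  by rewrite /enters_node /is_node /= e andbF.
- move=> h b hh e; have [] := sl h hh; rewrite e /= => h1 h2.
  rewrite mem_points /= hh /is_node e /=; split; first by case: (b); lia.
  by rewrite NE // up_top ?e; case: (b).
Qed.

Lemma next_end : next E = E.
Proof. by rewrite /Defs.next level_end /= ltnn. Qed.
Lemma E_point : E \in points D.
Proof. by rewrite mem_points /= leqnn level_end. Qed.
Lemma O_point : (0, 0) \in points D.
Proof. by rewrite mem_points /= level0. Qed.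

End Geometry.

Local Open Scope ring_scope.

(** * Numbering of points and strands *)

Local Open Scope nat_scope.

Lemma count_take_ex (X : Type) (x0 : X) (P : pred X) (s : seq X) l : l < count P s ->
  exists i, [/\ i < size s, P (nth x0 s i) & count P (take i s) = l].
Proof.
elim: s l => //= x s IH l; case: (boolP (P x)) => Px /=; last first.
  rewrite add0n => /IH [i [h1 h2 h3]]; exists i.+1; split=> //=.
  by rewrite (negPf Px) h3.
case: l => [_|l]; first by exists 0.
rewrite add1n ltnS => /IH [i [h1 h2 h3]]; exists i.+1; split=> //=.
by rewrite Px h3.
Qed.

Section Strands.
Variable D : diagram.
Hypothesis wf : well_formed D.
Hypothesis good : perm_eq (traversal D) (points D).

Notation lpos := (Defs.lpos D).
Notation next := (Defs.next D).
Notation piece_at h := (layer_at D h).2.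
Notation bot h := (bottom_side (piece_at h)).
Notation top h := (top_side (piece_at h)).
Notation E := ((size D, 0) : point).
Notation O := ((0, 0) : point).
Notation strand := (Defs.strand D).
Definition idx (x : point) : nat := index x (traversal D).

Lemma size_traversal : size (traversal D) = size (points D).
Proof. by rewrite size_traject. Qed.
Lemma uniq_traversal : uniq (traversal D).
Proof. by rewrite (perm_uniq good) uniq_points. Qed.
Lemma mem_traversal : traversal D =i points D.
Proof. exact: perm_mem. Qed.
Lemma idx_lt x : x \in points D -> idx x < size (points D).
Proof. by rewrite -mem_traversal -size_traversal index_mem. Qed.
Lemma nth_idx x : x \in points D -> nth O (traversal D) (idx x) = x.
Proof. by move=> px; rewrite nth_index // mem_traversal. Qed.
Lemma idx_inj : {in points D &, injective idx}.
Proof. by move=> x y px py e; rewrite -(nth_idx px) e nth_idx. Qed.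
Lemma iter_idx x : x \in points D -> iter (idx x) next O = x.
Proof. by move=> px; rewrite -{2}(nth_idx px) nth_traject // idx_lt. Qed.
Lemma idx_iter k : k < size (points D) -> idx (iter k next O) = k.
Proof.
move=> hk; rewrite -(nth_traject next hk O) /idx.
by rewrite index_uniq ?uniq_traversal // size_traject.
Qed.
Lemma idx_O : idx O = 0.
Proof. by rewrite -[O in idx O]/(iter 0 next O) idx_iter //; case: (points D) (O_point D). Qed.
Lemma idx_E : (idx E).+1 = size (points D).
Proof.
apply/eqP; rewrite eqn_leq idx_lt ?E_point //= leqNgt; apply/negP => h.
have := idx_iter h; rewrite iterS iter_idx ?E_point // next_end //; lia.
Qed.
Lemma idx_next x : x \in points D -> x != E -> idx (next x) = (idx x).+1.
Proof.
move=> px xE; rewrite -{1}(iter_idx px) -iterS idx_iter //.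
rewrite -idx_E ltnS ltn_neqAle; have := idx_lt px; rewrite -idx_E ltnS => ->.
by rewrite andbT; apply: contraNneq xE => /(idx_inj px (E_point wf)) ->.
Qed.
Lemma idx_le_E x : x \in points D -> idx x <= idx E.
Proof. by move=> px; have := idx_lt px; rewrite -idx_E. Qed.

Definition snum (x : point) : nat := count (leaves_node D) (take (idx x).+1 (traversal D)).
Lemma snum_le x : snum x <= last_strand D.
Proof.
by rewrite /snum /last_strand -{2}(cat_take_drop (idx x).+1 (traversal D)) count_cat leq_addr.
Qed.
Lemma strandE x : strand x = snum x :> nat.
Proof. by rewrite inordK // ltnS snum_le. Qed.
Lemma snum_O : snum O = 0.
Proof.
rewrite /snum idx_O; have : 0 < size (traversal D).
  by rewrite size_traversal -idx_E.
by rewrite /traversal; case: (size (points D)) => //= n _; rewrite take0.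
Qed.
Lemma snum_E : snum E = last_strand D.
Proof. by rewrite /snum idx_E -size_traversal take_size. Qed.
(** The strand number counts the nodes entered so far. *)
Lemma snum_next x : x \in points D -> x != E -> snum (next x) = snum x + enters_node D x.
Proof.
move=> px xE; have [pn ln] := next_spec wf px xE.
rewrite /snum idx_next // (take_nth O) ?size_traversal; last first.
  by rewrite -idx_next // idx_lt.
by rewrite -cats1 count_cat /= addn0 -idx_next // nth_idx // ln.
Qed.
Lemma snum_mono x y : idx x <= idx y -> snum x <= snum y.
Proof.
move=> h; by rewrite /snum -(subnKC h) -addSn takeD count_cat leq_addr.
Qed.
Lemma snum_enter x y : x \in points D -> x != E -> enters_node D x -> idx x < idx y -> snum x < snum y.
Proof.
move=> px xE ex h; have := snum_next px xE; rewrite ex addn1 => e.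
by rewrite -e; apply: snum_mono; rewrite idx_next.
Qed.
Lemma leave_pred y : y \in points D -> y != O -> exists2 x, x \in points D & x != E /\ next x = y.
Proof.
move=> py yO; have iy : 0 < idx y.
  rewrite lt0n -idx_O; apply: contraNneq yO => /(idx_inj py) -> //; exact: O_point.
have hl : (idx y).-1 < size (points D) by have := idx_lt py; lia.
exists (iter (idx y).-1 next O).
  by rewrite -mem_traversal -(nth_traject next hl O) mem_nth // size_traversal.
split; last by rewrite -iterS prednK // iter_idx.
apply: contraTneq isT => e; have := idx_iter hl; rewrite e.
have := idx_le_E py; lia.
Qed.
Lemma leaves_neqO y : leaves_node D y -> y != O.
Proof. by case: y => [[|h] p]. Qed.
Lemma snum_leave x y : y \in points D -> leaves_node D y -> idx x < idx y -> snum x < snum y.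
Proof.
move=> py ly h; have [z pz [zE e]] := leave_pred py (leaves_neqO ly).
have [_ lz] := next_spec wf pz zE; rewrite e ly in lz.
have := snum_next pz zE; rewrite -lz e => ->; rewrite addn1 ltnS; apply: snum_mono.
by move: h; rewrite -e idx_next.
Qed.

Lemma enters_neqE x : x \in points D -> enters_node D x -> x != E.
Proof. by case: x => h p _ /andP[h1 _]; apply/eqP => -[e _]; rewrite e ltnn in h1. Qed.

(** A strand other than the last one ends at exactly one node, so it is
   determined by the point where it enters that node. *)
Lemma enter_inj x y : x \in points D -> y \in points D -> enters_node D x -> enters_node D y ->
  snum x = snum y -> x = y.
Proof.
move=> px py ex ey e; have xE := enters_neqE px ex; have yE := enters_neqE py ey.
case: (ltngtP (idx x) (idx y)) => h; last exact: idx_inj.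
  by have := snum_enter px xE ex h; rewrite e ltnn.
by have := snum_enter py yE ey h; rewrite e ltnn.
Qed.
(** A strand other than the first one starts at exactly one node. *)
Lemma leave_inj x y : x \in points D -> y \in points D -> leaves_node D x -> leaves_node D y ->
  snum x = snum y -> x = y.
Proof.
move=> px py ex ey e; case: (ltngtP (idx x) (idx y)) => h; last exact: idx_inj.
  by have := snum_leave py ey h; rewrite e ltnn.
by have := snum_leave px ex h; rewrite e ltnn.
Qed.
Lemma leave_ex l : 0 < l <= last_strand D ->
  exists y, [/\ y \in points D, leaves_node D y & snum y = l].
Proof.
case: l => // l /= hl; have [i [hi Pi ci]] := count_take_ex O hl.
have py : nth O (traversal D) i \in points D by rewrite -mem_traversal mem_nth.
exists (nth O (traversal D) i); split => //.
rewrite /snum /idx index_uniq ?uniq_traversal // (take_nth O) //.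
by rewrite -cats1 count_cat ci /= Pi !addn0 addn1.
Qed.
Lemma enter_ex k : k < last_strand D ->
  exists x, [/\ x \in points D, enters_node D x & snum x = k].
Proof.
move=> hk; have [y [py ly sy]] := @leave_ex k.+1 hk.
have [x px [xE e]] := leave_pred py (leaves_neqO ly).
have [_ lx] := next_spec wf px xE; rewrite e ly in lx.
exists x; split => //; have := snum_next px xE; rewrite -lx e sy addn1 => - [].
by [].
Qed.
Lemma snum_enter_lt x : x \in points D -> enters_node D x -> snum x < last_strand D.
Proof.
move=> px ex; rewrite -snum_E; have xE := enters_neqE px ex.
apply: snum_enter => //; rewrite ltn_neqAle idx_le_E // andbT.
by apply: contraNneq xE => /(idx_inj px (E_point wf)) ->.
Qed.
Lemma snum_leave_gt0 y : y \in points D -> leaves_node D y -> 0 < snum y.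
Proof.
move=> py ly; rewrite -snum_O; apply: snum_leave => //.
rewrite idx_O lt0n -idx_O; apply: contraNneq (leaves_neqO ly) => /(idx_inj py (O_point D)) -> //.
Qed.
Lemma snum_ex k : k <= last_strand D -> exists2 x, x \in points D & snum x = k.
Proof.
rewrite leq_eqVlt => /orP[/eqP ->|h]; first by exists E; rewrite ?snum_E ?E_point.
by have [x [px _ sx]] := enter_ex h; exists x.
Qed.
End Strands.

Local Open Scope ring_scope.

(** * From strands to points *)

Definition crossing_weight (s : bool) (i j : nat) : ZT :=
  if i == ~~ s then (if j == s then T ^ (if s then 1 else -1 : int) else 1 - T ^ (if s then 1 else -1 : int))
  else (j == ~~ s)%:R.
Definition vertex_weight (n i j : nat) : ZT := T ^+ j / \sum_(k < n) T ^+ k.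
Definition node_weight (e : piece) (i j : nat) : ZT :=
  match e with
  | Crossing s => crossing_weight s i j
  | TwistVertex n => vertex_weight n i j
  | _ => 0
  end.

Definition ports (e : piece) : nat :=
  match e with Crossing _ => 2 | TwistVertex n => n | _ => 0%N end.

Section PointWeights.
Variable D : diagram.

(** The transition matrix with one state for each point of the diagram: at
   a node the walker follows the weights, elsewhere it moves along the strand.
   Inserting layers renumbers the points by a shift of the levels, whereas
   the strands are renumbered along the whole knot. *)
Definition point_weight (x y : point) : ZT :=
  let e := (layer_at D x.1).2 in let q := lpos D x.1 in
  if enters_node D x then
    if [&& y.1 == x.1.+1, (q <= y.2)%N & (y.2 < q + ports e)%N]
    then node_weight e (x.2 - q) (y.2 - q) else 0
  else if x == ((size D, 0%N) : point) then 0 else (y == Defs.next D x)%:R.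

Notation A := (transition D).
Notation str h i := (strand D (h : nat, (lpos D h + i)%N)).

Lemma transition_sum k l : A k l = \sum_(h < size D) \sum_(i < ports (layer_at D h).2)
   \sum_(j < ports (layer_at D h).2)
     node_weight (layer_at D h).2 i j *
       ((k == str h i)%:R * (l == strand D (h.+1, (lpos D h + j)%N))%:R).
Proof.
rewrite /transition summxE; apply: eq_bigr => h _.
case e : (layer_at D h).2 => [s|b|b|n] /=; rewrite ?mxE ?big_ord0 //.
  rewrite !big_ord_recl !big_ord0 /= !addr0 /bump /= addn0.
  rewrite /crossing_weights ?mxE /over_in /over_out /under_in /under_out /csign /is_positive e /crossing_weight.
  by case: s {e}; rewrite /= ?addn0 ?addn1 -!mulnb !natrM; ring.
rewrite /vertex_weights summxE; apply: eq_bigr => i _; rewrite summxE; apply: eq_bigr => j _.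
by rewrite !mxE -mulnb natrM.
Qed.

Hypothesis wf : well_formed D.

Lemma ports_bot (h : nat) : is_node D h -> size (bottom_side (layer_at D h).2) = ports (layer_at D h).2.
Proof. by rewrite /is_node; case: (_.2) => //= n; rewrite size_nseq. Qed.
Lemma ports_top (h : nat) : is_node D h -> size (top_side (layer_at D h).2) = ports (layer_at D h).2.
Proof. by rewrite /is_node; case: (_.2) => //= n; rewrite size_nseq. Qed.
Lemma ports_node h i : (i < ports (layer_at D h).2)%N -> is_node D h.
Proof. by rewrite /is_node; case: (_.2). Qed.
Lemma port_enter h i : (h < size D)%N -> (i < ports (layer_at D h).2)%N ->
  (h, (lpos D h + i)%N) \in points D /\ enters_node D (h, (lpos D h + i)%N).
Proof.
move=> hh hi; have nd := ports_node hi; have pb := ports_bot nd; split.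
  by rewrite mem_points /= ltnW //=; have := size_bot wf hh; lia.
by rewrite /enters_node /= hh nd leq_addr pb ltn_add2l.
Qed.
Lemma port_leave h i : (h < size D)%N -> (i < ports (layer_at D h).2)%N ->
  (h.+1, (lpos D h + i)%N) \in points D /\ leaves_node D (h.+1, (lpos D h + i)%N).
Proof.
move=> hh hi; have nd := ports_node hi; have pb := ports_bot nd; have pt := ports_top nd; split.
  by rewrite mem_points /= hh /=; have := size_bot wf hh; have := size_levelS wf hh; lia.
by rewrite /leaves_node /= nd leq_addr pt ltn_add2l.
Qed.
Lemma enterP x : enters_node D x -> exists h i,
  [/\ (h < size D)%N, (i < ports (layer_at D h).2)%N & x = (h, (lpos D h + i)%N)].
Proof.
case: x => h p /and4P[/= h1 nd h2]; rewrite ports_bot // => h3.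
by exists h, (p - lpos D h)%N; split => //; [lia | rewrite subnKC].
Qed.
Lemma leaveP y : y \in points D -> leaves_node D y -> exists h i,
  [/\ (h < size D)%N, (i < ports (layer_at D h).2)%N & y = (h.+1, (lpos D h + i)%N)].
Proof.
case: y => -[|h] p // ; rewrite mem_points /= => /andP[h1 _] /and3P[nd h2]; rewrite ports_top // => h3.
by exists h, (p - lpos D h)%N; split => //; [lia | rewrite subnKC].
Qed.

Hypothesis good : perm_eq (traversal D) (points D).

Lemma strand_eq x y : (strand D x == strand D y) = (snum D x == snum D y).
Proof. by rewrite -val_eqE /= !strandE. Qed.

(** A strand enters only one node, and a strand leaves only one node, so a
   single term of the sum over ports survives. *)
Lemma transition_points x y : x \in points D -> y \in points D ->
  enters_node D x -> leaves_node D y ->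
  A (strand D x) (strand D y) = point_weight x y.
Proof.
move=> px py ex ly; rewrite transition_sum /point_weight ex.
have [hx [ix [hhx hix Ex]]] := enterP ex; have [hy [iy [hhy hiy Ey]]] := leaveP py ly.
rewrite (bigD1 (Ordinal hhx)) //= [X in _ + X]big1 ?addr0; last first.
  move=> h nh; apply: big1 => i _; apply: big1 => j _.
  rewrite strand_eq; case: eqP => [e|_]; last by rewrite mul0r mulr0.
  have [p2 e2] := port_enter (ltn_ord h) (ltn_ord i).
  have := enter_inj wf good px p2 ex e2 e; rewrite Ex => -[eh _].
  by case/eqP: nh; apply: val_inj.
rewrite (bigD1 (Ordinal hix)) //= [X in _ + X]big1 ?addr0; last first.
  move=> i ni; apply: big1 => j _.
  rewrite strand_eq; case: eqP => [e|_]; last by rewrite mul0r mulr0.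
  have [p2 e2] := port_enter hhx (ltn_ord i).
  have := enter_inj wf good px p2 ex e2 e; rewrite Ex => -[ei].
  by case/eqP: ni; apply: val_inj => /=; lia.
rewrite -Ex eqxx Ex Ey /= eqSS addKn.
have H (j : 'I_(ports (layer_at D hx).2)) :
    (strand D (hy.+1, (lpos D hy + iy)%N) == strand D (hx.+1, (lpos D hx + j)%N))
    = ((hy, (lpos D hy + iy)%N) == (hx, (lpos D hx + j)%N)).
  rewrite strand_eq; have [p2 l2] := port_leave hhx (ltn_ord j).
  rewrite Ey in py ly; apply/eqP/eqP => [e|[-> ->] //].
  by have := leave_inj wf good py p2 ly l2 e => -[-> ->].
under eq_bigr do rewrite H mul1r xpair_eqE.
case: eqP => [e|ne]; last by rewrite big1 // => j _; rewrite mulr0.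
rewrite e in hiy *; rewrite leq_addr ltn_add2l hiy addKn (bigD1 (Ordinal hiy)) //= eqxx mulr1.
rewrite big1 ?addr0 // => j /negPf nj; rewrite eqn_add2l eq_sym.
by move: nj; rewrite -val_eqE /= => ->; rewrite mulr0.
Qed.

Lemma transition_last l : A (strand D (size D, 0%N)) l = 0.
Proof.
rewrite transition_sum big1 // => h _; apply: big1 => i _; apply: big1 => j _.
have [p2 e2] := port_enter (ltn_ord h) (ltn_ord i).
rewrite strand_eq snum_E //; have := snum_enter_lt wf good p2 e2.
by rewrite ltn_neqAle eq_sym => /andP[/negPf -> _]; rewrite mul0r mulr0.
Qed.
Lemma transition_first k : A k (strand D (0%N, 0%N)) = 0.
Proof.
rewrite transition_sum big1 // => h _; apply: big1 => i _; apply: big1 => j _.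
have [p2 e2] := port_leave (ltn_ord h) (ltn_ord j).
rewrite strand_eq snum_O //; have := snum_leave_gt0 wf good p2 e2.
by rewrite ltn_neqAle => /andP[/negPf -> _]; rewrite !mulr0.
Qed.

Lemma point_weight_leaves x y : x \in points D -> enters_node D x -> point_weight x y != 0 ->
  leaves_node D y /\ y \in points D.
Proof.
move=> px ex; rewrite /point_weight ex; case: ifP; last by rewrite eqxx.
have [hx [ix [hhx hix ->]]] := enterP ex; case: y => h p /= /and3P[/eqP -> h1 h2] _.
have hp : (p - lpos D hx < ports (layer_at D hx).2)%N by lia.
by rewrite -(subnKC h1); have [] := port_leave hhx hp.
Qed.

Section Reps.
Variable rep : 'I_(last_strand D).+1 -> point.
Hypothesis rep_pt : forall k, rep k \in points D.
Hypothesis repK : forall k, strand D (rep k) = k.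

Let before y := (idx D y <= idx D (rep (strand D y)))%N.
(** Weight with which the walk started at [y] first reaches the
   representative of the strand [l]. *)
Definition hit (y : point) (l : 'I_(last_strand D).+1) : ZT :=
  if before y then (l == strand D y)%:R else A (strand D y) l.

(** First step analysis. *)
Lemma hit_step x l : x \in points D -> \sum_(y <- points D) point_weight x y * hit y l
  = if (idx D x < idx D (rep (strand D x)))%N then (l == strand D x)%:R else A (strand D x) l.
Proof.
move=> px; have [->|xE] := eqVneq x ((size D, 0%N) : point).
  rewrite ltnNge idx_le_E //= transition_last big1 // => y _.
  have -> : point_weight (size D, 0%N) y = 0; last by rewrite mul0r.
  by rewrite /point_weight /enters_node /= ltnn /= eqxx.
have [ex|nx] := boolP (enters_node D x); last first.
  have [pn _] := next_spec wf px xE.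
  have sn : strand D (Defs.next D x) = strand D x.
    by apply/eqP; rewrite strand_eq snum_next // (negPf nx) addn0.
  have pw y : point_weight x y = (y == Defs.next D x)%:R.
    by rewrite /point_weight (negPf nx) (negPf xE).
  rewrite (bigD1_seq (Defs.next D x)) ?uniq_points //= [X in _ + X]big1 ?addr0.
    by rewrite pw eqxx mul1r /hit /before sn idx_next.
  by move=> y /negPf ny; rewrite pw ny mul0r.
have -> : (idx D x < idx D (rep (strand D x)))%N = false.
  apply/negP => h; have := snum_enter wf good px xE ex h.
  by rewrite -!strandE repK ltnn.
rewrite big_seq; transitivity (\sum_(y <- points D | y \in points D)
    point_weight x y * (l == strand D y)%:R).
  apply: eq_bigr => y py; have [->|nz] := eqVneq (point_weight x y) 0; first by rewrite !mul0r.
  have [ly _] := point_weight_leaves px ex nz; congr (_ * _).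
  rewrite /hit ifT // /before leqNgt; apply/negP => h.
  by have := snum_leave wf good py ly h; rewrite -!strandE repK ltnn.
rewrite -big_seq.
have [l0|ln0] := posnP l.
  have -> : l = strand D (0%N, 0%N) by apply: val_inj; rewrite /= strandE snum_O.
  rewrite transition_first big1_seq // => y /andP[_ py].
  have [->|nz] := eqVneq (point_weight x y) 0; first by rewrite !mul0r.
  have [ly _] := point_weight_leaves px ex nz.
  rewrite strand_eq snum_O //; have := snum_leave_gt0 wf good py ly.
  by rewrite ltn_neqAle => /andP[/negPf -> _]; rewrite mulr0.
have hl : (0 < l <= last_strand D)%N by rewrite ln0 -ltnS ltn_ord.
have [z [pz lz sz]] := leave_ex good hl.
have Ez : l = strand D z by apply: val_inj; rewrite /= strandE sz.
rewrite Ez transition_points // (bigD1_seq z) ?uniq_points //= eqxx mulr1 big1_seq ?addr0 //.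
move=> y /andP[ny py].
have [->|nz] := eqVneq (point_weight x y) 0; first by rewrite !mul0r.
have [ly _] := point_weight_leaves px ex nz.
rewrite strand_eq; case: eqP => [e|_]; last by rewrite mulr0.
by have := leave_inj wf good pz py lz ly e => e'; rewrite e' eqxx in ny.
Qed.

Let J := [seq rep k | k <- enum 'I_(last_strand D).+1].
Let K := [seq x <- points D | rep (strand D x) != x].
Let M (x y : point) : ZT := (x == y)%:R - point_weight x y.

Lemma rep_inj : injective rep.
Proof. by move=> k l e; rewrite -(repK k) e repK. Qed.

Lemma perm_reps : perm_eq (points D) (J ++ K).
Proof.
have mJ x : (x \in J) = (x \in points D) && (rep (strand D x) == x).
  apply/mapP/andP => [[k _ ->]|[_ /eqP e]]; first by rewrite repK.
  by exists (strand D x); rewrite ?mem_enum.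
apply: uniq_perm; first exact: uniq_points.
  rewrite cat_uniq filter_uniq ?uniq_points // map_inj_uniq ?enum_uniq; last exact: rep_inj.
  rewrite andbT /=; apply/hasPn => x; rewrite mem_filter => /andP[h1 _].
  by apply/negP => /= xJ; move: (mJ x); rewrite [X in X = _]xJ (negPf h1) andbF.
by move=> x; rewrite [RHS]mem_cat [X in X || _]mJ mem_filter; case: (x \in points D); case: eqP.
Qed.

(** Outside the representatives the walk cannot return: it follows a strand
   from its representative to a node, then a new strand from its start to its
   representative.  Ranking the points accordingly gives a unitriangular
   matrix. *)
Lemma sdet_K : sdet K M = 1.
Proof.
(* the points after their representative come first in the walk *)
pose rk x := (idx D x + (if before x then size (points D) else 0))%N.
have pw0 x y : x \in K -> y \in K -> (rk y <= rk x)%N -> point_weight x y = 0.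
  rewrite !mem_filter => /andP[rx px] /andP[ry py] h.
  have [xE|xE] := eqVneq x ((size D, 0%N) : point).
    by rewrite /point_weight xE /enters_node /= ltnn /= eqxx.
  have [ex|nx] := boolP (enters_node D x).
    apply/eqP; apply: contraTT h => nz; have [ly _] := point_weight_leaves px ex nz.
    rewrite -ltnNge /rk.
    have -> : before y.
      rewrite /before leqNgt; apply/negP => h.
      by have := snum_leave wf good py ly h; rewrite -!strandE repK ltnn.
    have -> : before x = false.
      apply/negP; rewrite /before leq_eqVlt => /orP[/eqP e|h].
        by have := idx_inj good px (rep_pt _) e => e'; rewrite -e' eqxx in rx.
      have := snum_enter wf good px xE ex h.
      by rewrite -!strandE repK ltnn.
    have := idx_lt good px; lia.
  rewrite /point_weight (negPf nx) (negPf xE); case: eqP => // e.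
  have sn : strand D y = strand D x.
    by apply/eqP; rewrite e strand_eq snum_next // (negPf nx) addn0.
  have iy : idx D y = (idx D x).+1 by rewrite e idx_next.
  move: h; rewrite /rk /before sn iy.
  have : idx D x != idx D (rep (strand D x)).
    by apply: contraNneq rx => e'; rewrite -(idx_inj good px (rep_pt _) e').
  move: (idx D (rep _)) (idx D x) => r i hne h; move: h.
  have -> : (i < r)%N = (i <= r)%N by lia.
  by case: ifP => _; lia.
apply: (sdet_rank (rk := rk)).
- by rewrite filter_uniq // uniq_points.
- by move=> x xK; rewrite /M eqxx pw0 // subr0.
- by move=> x y xK yK /negPf nxy h; rewrite /M nxy pw0 // subrr.
Qed.

Let H x z := hit x (strand D z).

Lemma hit_rep k l : hit (rep k) l = (l == k)%:R.
Proof. by rewrite /hit /before repK leqnn. Qed.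

Lemma point_split x l : \sum_(y <- points D) point_weight x y * hit y l
  = point_weight x (rep l) + \sum_(z <- K) point_weight x z * hit z l.
Proof.
rewrite (perm_big _ perm_reps) big_cat big_map big_enum /= (bigD1 l) //= hit_rep eqxx mulr1.
rewrite [X in _ + X + _]big1 ?addr0 // => k nk; rewrite hit_rep eq_sym (negPf nk) mulr0; done.
Qed.

Lemma rep_equation k j : k \in K -> j \in J -> M k j + \sum_(l <- K) M k l * H l j = 0.
Proof.
rewrite mem_filter => /andP[rk pk] /mapP[l _ ->]; rewrite /M /H repK.
under eq_bigr do rewrite mulrBl.
rewrite sumrB.
have kK : k \in K by rewrite mem_filter rk.
rewrite (bigD1_seq k) ?filter_uniq ?uniq_points //= eqxx mul1r big1 ?addr0; last first.
  by move=> y ny; rewrite eq_sym (negPf ny) mul0r.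
have -> : (k == rep l) = false.
  by apply/negP => /eqP e; rewrite e repK eqxx in rk.
rewrite sub0r addrC -addrA -opprD [X in _ - X]addrC -point_split hit_step // /hit /before.
have : idx D k != idx D (rep (strand D k)).
  by apply: contraNneq rk => e'; rewrite -(idx_inj good pk (rep_pt _) e').
by case: ltngtP => // _ _; rewrite subrr.
Qed.

(** Eliminating the points other than the representatives leaves the
   transition matrix on strands. *)
Lemma rep_schur k l : M (rep k) (rep l) + \sum_(z <- K) M (rep k) z * H z (rep l)
  = (1%:M - A) k l.
Proof.
rewrite /M /H repK; under eq_bigr do rewrite mulrBl.
rewrite sumrB big1_seq ?sub0r; last first.
  move=> y /=; rewrite mem_filter => /andP[ry _].
  have -> : (rep k == y) = false by apply/negP => /eqP e; rewrite -e repK eqxx in ry.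
  by rewrite mul0r.
rewrite -addrA -opprD -point_split hit_step // repK ltnn (inj_eq rep_inj) !mxE.
by rewrite mulrb.
Qed.

Lemma sdet_points : sdet (points D) M = \det (1%:M - A).
Proof.
rewrite (sdet_perm _ perm_reps) (sdet_elim rep_equation) sdet_K mulr1 sdet_map.
by rewrite -sdet_ord; apply: eq_sdet => k l _ _; apply: rep_schur.
Qed.

Lemma sadj_points k l : sadj (points D) M (rep k) (rep l) = \adj (1%:M - A) k l.
Proof.
have nK i : rep i \notin K by rewrite mem_filter repK eqxx.
rewrite (sadj_perm _ _ _ perm_reps) (sadj_elim _ _ rep_equation) // sdet_K mulr1.
rewrite sadj_map; last by move=> ? ? _ _; apply: rep_inj.
by rewrite -sadj_ord; apply: eq_sadj => i j _ _; apply: rep_schur.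
Qed.

End Reps.

Definition pointM (x y : point) : ZT := (x == y)%:R - point_weight x y.

(** Any point may be chosen as representative of its strand.  Two distinct
   points of the same strand cannot both be representatives, whence the side
   condition. *)
Lemma adj_points x y : x \in points D -> y \in points D ->
  (x == y) || (strand D x != strand D y) ->
  \adj (1%:M - A) (strand D x) (strand D y) = sadj (points D) pointM x y.
Proof.
move=> px py hxy.
pose rep k := if k == strand D x then x else if k == strand D y then y else
  nth (0%N, 0%N) (points D) (find (fun z => strand D z == k) (points D)).
have hasp k : has (fun z => strand D z == k) (points D).
  have [z pz sz] := snum_ex wf good (ltnSE (ltn_ord k)).
  by apply/hasP; exists z => //; apply/eqP/val_inj; rewrite /= strandE.
have rpt k : rep k \in points D.
  rewrite /rep; case: ifP => // _; case: ifP => // _; apply: mem_nth.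
  by rewrite -has_find.
have rK k : strand D (rep k) = k.
  rewrite /rep; case: eqP => [->|_] //; case: eqP => [->|_] //.
  exact/eqP/(nth_find _ (hasp k)).
rewrite -(sadj_points rpt rK).
have -> : rep (strand D x) = x by rewrite /rep eqxx.
suff -> : rep (strand D y) = y by [].
rewrite /rep eqxx; case: eqP => // e.
by move: hxy; rewrite e eqxx orbF => /eqP.
Qed.

Lemma det_points : \det (1%:M - A) = sdet (points D) pointM.
Proof.
pose rep k := nth (0%N, 0%N) (points D) (find (fun z => strand D z == k) (points D)).
have hasp k : has (fun z => strand D z == k) (points D).
  have [z pz sz] := snum_ex wf good (ltnSE (ltn_ord k)).
  by apply/hasP; exists z => //; apply/eqP/val_inj; rewrite /= strandE.
rewrite -(@sdet_points rep) // => k; last exact/eqP/(nth_find _ (hasp k)).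
by apply: mem_nth; rewrite -has_find.
Qed.

End PointWeights.

(** * Sums over the levels of a diagram *)

Section Psum.
Variables (X : eqType) (f : X -> X -> int).
Fixpoint psum (s : seq X) : int :=
  if s is x :: s' then \sum_(y <- s') f x y + psum s' else 0.
Lemma psum_cat s1 s2 : psum (s1 ++ s2) = psum s1 + psum s2 + \sum_(x <- s1) \sum_(y <- s2) f x y.
Proof.
elim: s1 => [|x s1 IH] /=; first by rewrite big_nil addr0 add0r.
by rewrite IH big_cat big_cons /=; ring.
Qed.
Lemma psum_cat3 s1 s2 s3 : psum (s1 ++ s2 ++ s3) = psum s1 + psum s2 + psum s3
  + \sum_(x <- s1) \sum_(y <- s2) f x y + \sum_(x <- s1) \sum_(y <- s3) f x y
  + \sum_(x <- s2) \sum_(y <- s3) f x y.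
Proof.
rewrite !psum_cat; under [X in _ + X = _]eq_bigr do rewrite big_cat.
by rewrite big_split /=; ring.
Qed.
End Psum.

Lemma eq_psum (X I : eqType) (f : X -> X -> int) (s : seq I) (g g' : I -> X) : uniq s ->
  {in s &, forall x y, x != y -> f (g x) (g y) = f (g' x) (g' y)} ->
  psum f (map g s) = psum f (map g' s).
Proof.
elim: s => //= x s IH /andP[xs us] H; rewrite IH //; last first.
  by move=> a b ha hb; apply: H; rewrite inE ?ha ?hb orbT.
congr (_ + _); rewrite !big_map; apply: eq_big_seq => y ys.
by apply: H; rewrite ?inE ?eqxx ?ys ?orbT //; apply: contraNneq xs => ->.
Qed.

Lemma sum_iota (V : zmodType) n (F : nat -> V) : \sum_(i < n) F i = \sum_(i <- iota 0 n) F i.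
Proof. by rewrite -(big_mkord xpredT F) /index_iota subn0. Qed.

Section Levels.
Variable D : diagram.
Hypothesis wf : well_formed D.

Notation lpos := (Defs.lpos D).
Notation next := (Defs.next D).
Notation level := (Defs.level D).
Notation piece_at h := (layer_at D h).2.
Notation bot h := (bottom_side (piece_at h)).
Notation top h := (top_side (piece_at h)).
Notation E := ((size D, 0%N) : point).
Notation O := ((0%N, 0%N) : point).
Notation idx := (idx D).

Definition lvl h : seq point := [seq (h, p) | p <- iota 0 (size (level h))].
Definition nright h := (size (level h) - (lpos h + size (bot h)))%N.

Definition leftb (h p : nat) : point := (h, p).
Definition leftt (h p : nat) : point := (h.+1, p).
Definition rightb (h p : nat) : point := (h, lpos h + size (bot h) + p)%N.
Definition rightt (h p : nat) : point := (h.+1, lpos h + size (top h) + p)%N.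
Definition midb (h p : nat) : point := (h, lpos h + p)%N.
Definition midt (h p : nat) : point := (h.+1, lpos h + p)%N.

Lemma lvl_bot h : (h < size D)%N -> lvl h = map (leftb h) (iota 0 (lpos h))
  ++ map (midb h) (iota 0 (size (bot h))) ++ map (rightb h) (iota 0 (nright h)).
Proof.
move=> hh; have := size_bot wf hh; rewrite /lvl /nright => /subnKC {1}<-.
rewrite -addnA !iotaD !map_cat; congr (_ ++ _ ++ _).
  by rewrite add0n -[X in iota X _]addn0 iotaDl -map_comp.
by rewrite add0n -[X in iota X _]addn0 iotaDl -map_comp.
Qed.
Lemma lvl_top h : (h < size D)%N -> lvl h.+1 = map (leftt h) (iota 0 (lpos h))
  ++ map (midt h) (iota 0 (size (top h))) ++ map (rightt h) (iota 0 (nright h)).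
Proof.
move=> hh; have e : size (level h.+1) = (lpos h + (size (top h) + nright h))%N.
  by have := size_bot wf hh; have := size_levelS wf hh; rewrite /nright; lia.
rewrite /lvl e !iotaD !map_cat; congr (_ ++ _ ++ _).
  by rewrite add0n -[X in iota X _]addn0 iotaDl -map_comp.
by rewrite add0n -[X in iota X _]addn0 iotaDl -map_comp.
Qed.

(** Both ends of a vertical strand beside the piece of a layer. *)
Definition side (x x' : point) : Prop := exists h, (h < size D)%N /\
  ((exists2 p, (p < lpos h)%N & x = leftb h p /\ x' = leftt h p) \/
   (exists2 p, (p < nright h)%N & x = rightb h p /\ x' = rightt h p)).

Definition adj x x' := next x = x' /\ x != E \/ next x' = x /\ x' != E.

Lemma neqE_up x : up D x -> (x.1 < size D)%N -> x != E.
Proof. by case: x => h p _ /= hh; apply/eqP => -[e _]; rewrite e ltnn in hh. Qed.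
Lemma neqE_down x : ~~ up D x -> x != E.
Proof. by apply: contraNneq => ->; rewrite /up /= level_end. Qed.

Lemma side_points x x' : side x x' -> [/\ x \in points D, x' \in points D,
  up D x' = up D x, adj x x' & enters_node D x = false /\ leaves_node D x' = false].
Proof.
have nd (h p : nat) : (p < lpos h)%N || (lpos h + size (bot h) <= p)%N -> enters_node D (h, p) = false.
  by move=> H; rewrite /enters_node /=; lia.
have nd' (h p : nat) : (p < lpos h)%N || (lpos h + size (top h) <= p)%N -> leaves_node D (h.+1, p) = false.
  by move=> H; rewrite /leaves_node /=; lia.
case=> h [hh]; have := size_bot wf hh; have := size_levelS wf hh => h1 h2.
case=> -[p hp [-> ->]].
  rewrite nd ?hp // nd' ?hp // !mem_points /= hh (ltnW hh) /=; split => //; try lia.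
    by rewrite /leftt up_left.
  have [u|d] := boolP (up D (leftb h p)); [left | right].
    by rewrite next_up_left //; split => //; apply: neqE_up.
  have d' : ~~ up D (leftt h p) by rewrite /leftt up_left.
  by rewrite next_down_left //; split => //; apply: neqE_down.
have := hp; rewrite /nright => hp'.
rewrite nd ?nd' ?leq_addr ?orbT // !mem_points /= hh (ltnW hh) /=; split => //; try lia.
  by rewrite /rightt up_right.
have [u|d] := boolP (up D (rightb h p)); [left | right].
  by rewrite next_up_right //; split => //; apply: neqE_up.
have d' : ~~ up D (rightt h p) by rewrite /rightt up_right.
by rewrite next_down_right //; split => //; apply: neqE_down.
Qed.

Hypothesis good : perm_eq (traversal D) (points D).

Lemma adj_idx x x' : x \in points D -> x' \in points D -> adj x x' ->
  idx x' = (idx x).+1 \/ idx x = (idx x').+1.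
Proof.
by move=> px px' [[e n]|[e n]]; [left | right]; rewrite -e idx_next.
Qed.

(** Such a strand meets no node, so it has one number. *)
Lemma side_snum x x' : side x x' -> snum D x = snum D x'.
Proof.
move=> S; have [px px' u [[e n]|[e n]] [h1 h2]] := side_points S.
  by rewrite -e snum_next // h1 addn0.
rewrite -e snum_next //.
have [ux|dx] := boolP (up D x'); last first.
  have -> : enters_node D x' = false by apply/negP => /(enters_up wf); apply/negP.
  by rewrite addn0.
have [e2 nE] : next x = x' /\ x != E.
  rewrite u in ux; case: S ux => h [hh [[p hp [-> ->]]|[p hp [-> ->]]]] ux.
    by rewrite next_up_left //; split => //; apply: neqE_up.
  by rewrite next_up_right //; split => //; apply: neqE_up.
have := idx_next wf good px nE; rewrite e2.
have := idx_next wf good px' n; rewrite e => i1 i2.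
by move: (ltnSn (idx x)); rewrite {1}i1 i2 ltnS ltnNge leqnSn.
Qed.

(** The sums of [F] over consecutive levels differ only by the ports of the
   piece between them; the sums at both ends have a single term. *)
Lemma level_telescope (V : zmodType) (F : point -> V) :
  (forall x x', side x x' -> F x = F x') ->
  \sum_(h < size D) (\sum_(i < size (top h)) F (midt h i) - \sum_(i < size (bot h)) F (midb h i))
  = F E - F O.
Proof.
move=> HF; pose G h := \sum_(x <- lvl h) F x.
have GS h : (h < size D)%N ->
  \sum_(i < size (top h)) F (midt h i) - \sum_(i < size (bot h)) F (midb h i) = G h.+1 - G h.
  move=> hh; rewrite /G (lvl_bot hh) (lvl_top hh) !big_cat !big_map /=.
  rewrite (sum_iota _ (fun i => F (midt h i))) (sum_iota _ (fun i => F (midb h i))).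
  have -> : \sum_(p <- iota 0 (lpos h)) F (leftt h p) = \sum_(p <- iota 0 (lpos h)) F (leftb h p).
    apply: eq_big_seq => p; rewrite mem_iota add0n /= => hp; symmetry; apply: HF.
    by exists h; split => //; left; exists p.
  have -> : \sum_(p <- iota 0 (nright h)) F (rightt h p) = \sum_(p <- iota 0 (nright h)) F (rightb h p).
    apply: eq_big_seq => p; rewrite mem_iota add0n /= => hp; symmetry; apply: HF.
    by exists h; split => //; right; exists p.
  set a := \sum_(p <- _) F (leftb _ _); set b := \sum_(p <- _) F (rightb _ _).
  by rewrite opprD opprD addrACA subrr add0r addrACA subrr addr0.
under eq_bigr do rewrite GS ?ltn_ord //.
rewrite -(big_mkord xpredT (fun h => G h.+1 - G h)) telescope_sumr //.
by rewrite /G /lvl level_end // level0 /= !big_seq1.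
Qed.

End Levels.

(** * Half turns of a strand *)

Lemma strand_ends_count (a l : nat) : (a <= l)%N ->
  (a == l)%:R - (a == 0%N)%:R - ((0 < a)%N%:R - (a < l)%N%:R) = 0 :> int.
Proof. by case: posnP => [->|a0]; case: ltngtP => //; case: eqP; lia. Qed.

Section HalfTurns.
Variable D : diagram.
Hypothesis wf : well_formed D.
Hypothesis good : perm_eq (traversal D) (points D).

Notation lpos := (Defs.lpos D).
Notation next := (Defs.next D).
Notation level := (Defs.level D).
Notation piece_at h := (layer_at D h).2.
Notation bot h := (bottom_side (piece_at h)).
Notation top h := (top_side (piece_at h)).
Notation E := ((size D, 0%N) : point).
Notation O := ((0%N, 0%N) : point).
Notation idx := (idx D).
Notation midb := (midb D).
Notation midt := (midt D).
Notation snum := (snum D).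

(** Existence and uniqueness of the node at which a strand ends. *)
Lemma enter_port_sum (R : nzRingType) k : (k <= last_strand D)%N ->
  \sum_(h < size D) \sum_(i < ports (piece_at h)) (snum (midb h i) == k)%:R
  = (k < last_strand D)%N%:R :> R.
Proof.
move=> _; case: ltnP => hk; last first.
  rewrite big1 // => h _; apply: big1 => i _.
  have [p e] := port_enter wf (ltn_ord h) (ltn_ord i).
  have := snum_enter_lt wf good p e; rewrite /midb; case: eqP => // ->.
  by rewrite ltnNge hk.
have [x [px ex sx]] := enter_ex wf good hk.
have [h [i [hh hi Ex]]] := enterP wf ex; rewrite -/(midb h i) in Ex.
have U h' i' : (h' < size D)%N -> (i' < ports (piece_at h'))%N -> snum (midb h' i') = k ->
    (h', i') = (h, i).
  move=> hh' hi' e; have [p2 e2] := port_enter wf hh' hi'.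
  rewrite -sx Ex in e; rewrite Ex in px ex.
  by have := enter_inj wf good p2 px e2 ex e => -[->] /addnI ->.
rewrite (bigD1 (Ordinal hh)) //= (bigD1 (Ordinal hi)) //= -Ex sx eqxx.
rewrite big1 ?addr0 => [|i' ni]; last first.
  case: eqP => // /(U _ _ hh (ltn_ord i')) [e]; case/eqP: ni; exact: val_inj.
rewrite big1 ?addr0 // => h' nh; apply: big1 => i' _.
case: eqP => // /(U _ _ (ltn_ord h') (ltn_ord i')) [e _]; case/eqP: nh; exact: val_inj.
Qed.

(** Existence and uniqueness of the node at which a strand starts. *)
Lemma leave_port_sum (R : nzRingType) k : (k <= last_strand D)%N ->
  \sum_(h < size D) \sum_(i < ports (piece_at h)) (snum (midt h i) == k)%:R
  = (0 < k)%N%:R :> R.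
Proof.
move=> kl; case: posnP => hk.
  rewrite big1 // => h _; apply: big1 => i _.
  have [p e] := port_leave wf (ltn_ord h) (ltn_ord i).
  have := snum_leave_gt0 wf good p e; rewrite /midt; case: eqP => // ->.
  by rewrite hk.
have hk' : (0 < k <= last_strand D)%N by rewrite hk.
have [x [px ex sx]] := leave_ex good hk'.
have [h [i [hh hi Ex]]] := leaveP wf px ex; rewrite -/(midt h i) in Ex.
have U h' i' : (h' < size D)%N -> (i' < ports (piece_at h'))%N -> snum (midt h' i') = k ->
    (h', i') = (h, i).
  move=> hh' hi' e; have [p2 e2] := port_leave wf hh' hi'.
  rewrite -sx Ex in e; rewrite Ex in px ex.
  by have := leave_inj wf good p2 px e2 ex e => -[->] /addnI ->.
rewrite (bigD1 (Ordinal hh)) //= (bigD1 (Ordinal hi)) //= -Ex sx eqxx.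
rewrite big1 ?addr0 => [|i' ni]; last first.
  case: eqP => // /(U _ _ hh (ltn_ord i')) [e]; case/eqP: ni; exact: val_inj.
rewrite big1 ?addr0 // => h' nh; apply: big1 => i' _.
case: eqP => // /(U _ _ (ltn_ord h') (ltn_ord i')) [e _]; case/eqP: nh; exact: val_inj.
Qed.

Lemma cup_points h b : (h < size D)%N -> piece_at h = Cup b ->
  [/\ midt h 0 \in points D, midt h 1 \in points D, up D (midt h 0) = b, up D (midt h 1) = ~~ b
    & (idx (midt h (~~ b)) = (idx (midt h b)).+1) /\ snum (midt h 1) = snum (midt h 0)].
Proof.
move=> hh e; have h1 := size_bot wf hh; have h2 := size_levelS wf hh.
rewrite e /= in h1 h2.
have p0 : midt h 0 \in points D by rewrite mem_points /= hh /=; lia.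
have p1 : midt h 1 \in points D by rewrite mem_points /= hh /=; lia.
have u0 : up D (midt h 0) = b by rewrite /midt up_top ?e.
have u1 : up D (midt h 1) = ~~ b by rewrite /midt up_top ?e.
have pb : midt h b \in points D by case: (b).
have ub : up D (midt h b) = false by case: (b) u0 u1 => [_ ->|].
have nE : midt h b != E by apply: neqE_down; rewrite ?ub.
have en : enters_node D (midt h b) = false.
  by apply/negP => /(enters_up wf); rewrite ub.
have := idx_next wf good pb nE; rewrite (next_cup wf hh e) => i1.
have := snum_next wf good pb nE; rewrite (next_cup wf hh e) en addn0 => s1.
split=> //; split => //; move: s1; rewrite -![(h.+1, _)]/(midt h _).
by case: (b) => /=.
Qed.

Lemma cap_points h b : (h < size D)%N -> piece_at h = Cap b ->
  [/\ midb h 0 \in points D, midb h 1 \in points D, up D (midb h 0) = b, up D (midb h 1) = ~~ b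
    & (idx (midb h b) = (idx (midb h (~~ b))).+1) /\ snum (midb h 1) = snum (midb h 0)].
Proof.
move=> hh e; have h1 := size_bot wf hh; rewrite e /= in h1.
have p0 : midb h 0 \in points D by rewrite mem_points /= (ltnW hh) /=; lia.
have p1 : midb h 1 \in points D by rewrite mem_points /= (ltnW hh) /=; lia.
have u0 : up D (midb h 0) = b by rewrite /midb up_bot ?e.
have u1 : up D (midb h 1) = ~~ b by rewrite /midb up_bot ?e.
have pb : midb h (~~ b) \in points D by case: (b).
have ub : up D (midb h (~~ b)) = true by case: (b) u0 u1 => [|_ ->].
have nE : midb h (~~ b) != E by apply: neqE_up.
have en : enters_node D (midb h (~~ b)) = false.
  by rewrite /enters_node /= /is_node e /= andbF.
have := idx_next wf good pb nE; rewrite (next_cap wf hh e) => i1.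
have := snum_next wf good pb nE; rewrite (next_cap wf hh e) en addn0 => s1.
split=> //; split => //; move: s1; rewrite -![(h, _)]/(midb h _).
by case: (b) => /=.
Qed.

(** The number of upward points of the strand on a level goes up by one at
   a cup and down by one at a cap.  A strand starts and ends upward, so it has
   as many caps as cups, and the number of its half turns is even. *)
Lemma half_turns_even (k : 'I_(last_strand D).+1) : half_turns k = turning k * 2.
Proof.
suff [z Ez] : exists z, half_turns k = z * 2 by rewrite /turning Ez mulzK.
pose F x : int := (up D x && (strand D x == k))%:R.
have FS x x' : side D x x' -> F x = F x'.
  move=> S; have [px px' u _ _] := side_points wf S; rewrite /F u.
  by rewrite -!(inj_eq val_inj) /= !strandE (side_snum wf good S).
have T := level_telescope wf FS.
pose cd (h : nat) : int := match piece_at h with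
   | Cup b => (strand D (h.+1, lpos h) == k)%:R
   | Cap b => - (strand D (h : nat, lpos h) == k)%:R
   | _ => 0 end.
have L (h : 'I_(size D)) : \sum_(i < size (top h)) F (midt h i) - \sum_(i < size (bot h)) F (midb h i)
   = cd h + (\sum_(i < ports (piece_at h)) (snum (midt h i) == k)%:R
             - \sum_(i < ports (piece_at h)) (snum (midb h i) == k)%:R).
  have nodeS : is_node D h -> \sum_(i < size (top h)) F (midt h i) - \sum_(i < size (bot h)) F (midb h i)
   = \sum_(i < ports (piece_at h)) (snum (midt h i) == k)%:R
             - \sum_(i < ports (piece_at h)) (snum (midb h i) == k)%:R.
    move=> nd; rewrite (ports_top nd) (ports_bot nd); congr (_ - _); apply: eq_bigr => i _.
      have [p l] := port_leave wf (ltn_ord h) (ltn_ord i).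
      by rewrite /F (leaves_up wf p l) -(inj_eq val_inj) /= strandE.
    have [p l] := port_enter wf (ltn_ord h) (ltn_ord i).
    by rewrite /F (enters_up wf l) -(inj_eq val_inj) /= strandE.
  rewrite /cd; move: nodeS; rewrite /is_node; case e : (piece_at h) => [s|b|b|m] H.
  - by rewrite add0r; apply: H.
  - have [p0 p1 u0 u1 [_ s1]] := cup_points (ltn_ord h) e.
    rewrite /= !big_ord_recl !big_ord0 !subr0 /F /bump /= ?addn0 u0 u1.
    rewrite -!(inj_eq val_inj) /= !strandE s1 /midt addn0.
    by case: (b); rewrite ?addr0 ?add0r.
  - have [p0 p1 u0 u1 [_ s1]] := cap_points (ltn_ord h) e.
    rewrite /= !big_ord_recl !big_ord0 ?subr0 ?sub0r /F /bump /= ?addn0 u0 u1.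
    rewrite -!(inj_eq val_inj) /= !strandE s1 /midb addn0.
    by case: (b); rewrite ?addr0 ?add0r.
  - by rewrite add0r; apply: H.
have C0 : \sum_(h < size D) cd h = 0.
  move: T; under eq_bigr do rewrite L.
  have kl : (k <= last_strand D)%N by rewrite -ltnS.
  rewrite big_split sumrB /= (enter_port_sum int kl) (leave_port_sum int kl).
  have FE : F E = (k == last_strand D :> nat)%:R.
    by rewrite /F /up level_end //= -(inj_eq val_inj) /= strandE snum_E // eq_sym.
  have FO : F O = (k == 0%N :> nat)%:R.
    by rewrite /F /up level0 //= -(inj_eq val_inj) /= strandE snum_O // eq_sym.
  by rewrite FE FO => /(canRL (addrK _)) ->; apply: strand_ends_count.
(* half of half_turns k minus the vanishing sum of cd *)
exists (\sum_(h < size D) match piece_at h with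
    | Cup b => if strand D (h.+1, lpos h) == k then (if b then -1 else 0) else 0
    | Cap b => if strand D (h : nat, lpos h) == k then (if b then 0 else 1) else 0
    | _ => 0
    end).
have -> : half_turns k = half_turns k - \sum_(h < size D) cd h by rewrite C0 subr0.
rewrite /half_turns -sumrB mulr_suml; apply: eq_bigr => h _.
by rewrite /cd; case: (piece_at h) => [s|[]|[]|m] //=; case: (_ == k).
Qed.
End HalfTurns.

(** * A Whitney formula for the total turning number *)

Lemma lt_adjacent (a a' b b' : nat) : b' = b.+1 \/ b = b'.+1 -> a' = a.+1 \/ a = a'.+1 ->
  a' <> b' -> a' <> b -> a <> b' -> a <> b -> (a < b)%N = (a' < b')%N.
Proof. by case=> -> [] -> *; apply/idP/idP; lia. Qed.

Section Whitney.
Variable D : diagram.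
Hypothesis wf : well_formed D.
Hypothesis good : perm_eq (traversal D) (points D).

Notation lpos := (Defs.lpos D).
Notation next := (Defs.next D).
Notation level := (Defs.level D).
Notation piece_at h := (layer_at D h).2.
Notation bot h := (bottom_side (piece_at h)).
Notation top h := (top_side (piece_at h)).
Notation E := ((size D, 0%N) : point).
Notation O := ((0%N, 0%N) : point).
Notation idx := (idx D).
Notation midb := (midb D).
Notation midt := (midt D).
Notation snum := (snum D).

Definition osgn (b : bool) : int := if b then 1 else -1.
Definition first (x y : point) : int := osgn (idx x < idx y)%N.
(** Sign of a pair of points of a level: the product of the orientations of
   both strands and of the order in which they are visited. *)
Definition pairing (x y : point) : int := osgn (up D x) * osgn (up D y) * first x y.

Lemma pairingC x y : x \in points D -> y \in points D -> x != y -> pairing x y = - pairing y x.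
Proof.
move=> px py nxy; have ni : idx x != idx y.
  by apply: contraNneq nxy => /(idx_inj good px py) ->.
by rewrite /pairing /first mulrC [osgn (up D y) * _]mulrC; case: ltngtP ni => //= _ _; rewrite /osgn; ring.
Qed.

(** Moving two points along their strands to adjacent points keeps the order
   of visit as long as the points stay distinct. *)
Lemma first_adj x x' y y' : x \in points D -> x' \in points D -> y \in points D -> y' \in points D ->
  adj D x x' -> adj D y y' -> x != y -> x != y' -> x' != y -> x' != y' -> first x y = first x' y'.
Proof.
move=> px px' py py' axx ayy n1 n2 n3 n4.
have NI u v : u \in points D -> v \in points D -> u != v -> idx u <> idx v.
  by move=> pu pv nuv /(idx_inj good pu pv) e; rewrite e eqxx in nuv.
have := NI _ _ px py n1; have := NI _ _ px py' n2; have := NI _ _ px' py n3; have := NI _ _ px' py' n4.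
have := adj_idx wf good px px' axx; have := adj_idx wf good py py' ayy.
rewrite /first; move: (idx x) (idx x') (idx y) (idx y') => a a' b b' h1 h2 m1 m2 m3 m4.
by congr osgn; apply: lt_adjacent.
Qed.

Lemma first_next z x x' : z \in points D -> x \in points D -> x' \in points D ->
  idx x' = (idx x).+1 -> z != x -> z != x' -> first z x = first z x'.
Proof.
move=> pz px px' e n1 n2.
have NI u v : u \in points D -> v \in points D -> u != v -> idx u <> idx v.
  by move=> pu pv nuv /(idx_inj good pu pv) e'; rewrite e' eqxx in nuv.
have := NI _ _ pz px n1; have := NI _ _ pz px' n2.
by rewrite /first => h1 h2; congr osgn; apply/idP/idP; lia.
Qed.

Definition mid_sum h (z z' : point) : Prop :=
  \sum_(i <- iota 0 (size (bot h))) pairing z (midb h i)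
  = \sum_(i <- iota 0 (size (top h))) pairing z' (midt h i).

Definition layer_turn h : int :=
  match piece_at h with Cup b | Cap b => if b then -1 else 1 | _ => 0 end.

Hypothesis noV : forall h n, piece_at h <> TwistVertex n.

Lemma crossing_points h s : (h < size D)%N -> piece_at h = Crossing s ->
  [/\ midb h 0 \in points D, midb h 1 \in points D, midt h 0 \in points D, midt h 1 \in points D &
    [/\ up D (midb h 0), up D (midb h 1), up D (midt h 0), up D (midt h 1) &
   [/\ next (midb h 0) = midt h 1, next (midb h 1) = midt h 0, midb h 0 != E & midb h 1 != E]]].
Proof.
move=> hh e; have h1 := size_bot wf hh; have h2 := size_levelS wf hh; rewrite e /= in h1 h2.
rewrite !mem_points /= hh (ltnW hh) /= /midb /midt !(up_bot wf) ?(up_top wf) ?e //.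
rewrite !(next_crossing wf hh e) // /midb; split; try lia.
by split => //; split => //; apply: neqE_up; rewrite ?up_bot ?e.
Qed.

(** The two legs of a cup or a cap cancel against any other strand of the
   level, being oppositely directed and visited consecutively; at a crossing the
   two ports are exchanged. *)
Lemma mid_sumP h z z' : (h < size D)%N -> side D z z' ->
  z.1 = h -> z'.1 = h.+1 ->
  (forall i, (i < size (bot h))%N -> z != midb h i) ->
  (forall i, (i < size (top h))%N -> z' != midt h i) -> mid_sum h z z'.
Proof.
move=> hh S z1 z1' nb nt; have [pz pz' u az _] := side_points wf S.
rewrite /mid_sum; case e : (piece_at h) nb nt => [s|b|b|n] nb nt.
- have [pb0 pb1 pt0 pt1 [ub0 ub1 ut0 ut1 [n0 n1 E0 E1]]] := crossing_points hh e.
  rewrite /= !big_cons !big_nil !addr0 addrC /pairing u ub0 ub1 ut0 ut1.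
  have dz x : x.1 = h.+1 -> z != x by apply: contra_eq_neq => <-; rewrite z1 ltn_eqF.
  have dz' x : x.1 = h -> z' != x by apply: contra_eq_neq => <-; rewrite z1' gtn_eqF.
  have a0 : adj D (midb h 0) (midt h 1) by left.
  have a1 : adj D (midb h 1) (midt h 0) by left.
  have nb0 : z != midb h 0 by apply: nb.
  have nb1 : z != midb h 1 by apply: nb.
  have nt0 : z' != midt h 0 by apply: nt.
  have nt1 : z' != midt h 1 by apply: nt.
  rewrite (first_adj pz pz' pb0 pt1 az a0 nb0 (dz (midt h 1) erefl) (dz' (midb h 0) erefl) nt1).
  by rewrite (first_adj pz pz' pb1 pt0 az a1 nb1 (dz (midt h 0) erefl) (dz' (midb h 1) erefl) nt0).
- have [p0 p1 u0 u1 [ii _]] := cup_points wf good hh e.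
  rewrite /= big_nil !big_cons big_nil addr0 /pairing u0 u1.
  have -> : first z' (midt h 0) = first z' (midt h 1).
    by case: (b) ii => ii; [symmetry|]; apply: (first_next _ _ _ ii) => //; apply: nt.
  by rewrite /osgn; case: (b) => /=; ring.
- have [p0 p1 u0 u1 [ii _]] := cap_points wf good hh e.
  rewrite /= big_nil !big_cons big_nil addr0 /pairing u0 u1.
  have -> : first z (midb h 0) = first z (midb h 1).
    by case: (b) ii => ii; [|symmetry]; apply: (first_next _ _ _ ii) => //; apply: nb.
  by rewrite /osgn; case: (b) => /=; ring.
- by case: (noV e).
Qed.

(** Only the pair formed by both ports of the piece changes its contribution:
   the two legs of a cup or a cap appear or disappear, and at a crossing the
   pair is exchanged. *)
Lemma layer_psum h : (h < size D)%N ->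
  psum pairing (lvl D h.+1) - psum pairing (lvl D h)
  = - layer_turn h - (if is_crossing D h then 2 * first (midb h 0) (midb h 1) else 0).
Proof.
move=> hh; rewrite (lvl_bot wf hh) (lvl_top wf hh).
set IL := iota 0 (lpos h); set IR := iota 0 (nright D h).
have sL p : p \in IL -> side D (leftb h p) (leftt h p).
  by rewrite mem_iota add0n /= => hp; exists h; split => //; left; exists p.
have sR p : p \in IR -> side D (rightb D h p) (rightt D h p).
  by rewrite mem_iota add0n /= => hp; exists h; split => //; right; exists p.
have Lt p : p \in IL -> (p < lpos h)%N by rewrite mem_iota add0n.
have ss x x' y y' : side D x x' -> side D y y' -> x.1 = h -> x'.1 = h.+1 -> y.1 = h -> y'.1 = h.+1 ->
    x != y -> x' != y' -> pairing x y = pairing x' y'.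
  move=> S S' x1 x1' y1 y1' n1 n2.
  have [px px' ux ax _] := side_points wf S; have [py py' uy ay _] := side_points wf S'.
  rewrite /pairing ux uy; congr (_ * _); apply: first_adj => //.
    by apply: contra_eq_neq x1 => ->; rewrite y1' gtn_eqF.
  by apply: contra_eq_neq x1' => ->; rewrite y1 ltn_eqF.
have eL : psum pairing (map (leftb h) IL) = psum pairing (map (leftt h) IL).
  apply: eq_psum; first exact: iota_uniq.
  by move=> x y hx hy nxy; apply: (ss _ _ _ _ (sL _ hx) (sL _ hy)) => //; rewrite xpair_eqE eqxx.
have eR : psum pairing (map (rightb D h) IR) = psum pairing (map (rightt D h) IR).
  apply: eq_psum; first exact: iota_uniq.
  by move=> x y hx hy nxy; apply: (ss _ _ _ _ (sR _ hx) (sR _ hy)) => //; rewrite xpair_eqE eqxx eqn_add2l.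
have eLR : \sum_(x <- map (leftb h) IL) \sum_(y <- map (rightb D h) IR) pairing x y
   = \sum_(x <- map (leftt h) IL) \sum_(y <- map (rightt D h) IR) pairing x y.
  rewrite !big_map; apply: eq_big_seq => x hx; rewrite !big_map; apply: eq_big_seq => y hy.
  have lx := Lt x hx.
  by apply: (ss _ _ _ _ (sL _ hx) (sR _ hy)) => //; rewrite xpair_eqE eqxx ltn_eqF //= -addnA ltn_addr.
have eLM : \sum_(x <- map (leftb h) IL) \sum_(y <- map (midb h) (iota 0 (size (bot h)))) pairing x y
   = \sum_(x <- map (leftt h) IL) \sum_(y <- map (midt h) (iota 0 (size (top h)))) pairing x y.
  rewrite !big_map; apply: eq_big_seq => x hx; rewrite !big_map.
  apply: mid_sumP => //; first exact: sL.
    by move=> i _; rewrite xpair_eqE eqxx ltn_eqF //= ltn_addr ?Lt.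
  by move=> i _; rewrite xpair_eqE eqxx ltn_eqF //= ltn_addr ?Lt.
have mb i : i \in iota 0 (size (bot h)) -> midb h i \in points D.
  by rewrite mem_iota add0n /= => hi; rewrite mem_points /= (ltnW hh) /=; have := size_bot wf hh; lia.
have mt i : i \in iota 0 (size (top h)) -> midt h i \in points D.
  rewrite mem_iota add0n /= => hi; rewrite mem_points /= hh /=.
  by have := size_bot wf hh; have := size_levelS wf hh; lia.
have eMR : \sum_(x <- map (midb h) (iota 0 (size (bot h)))) \sum_(y <- map (rightb D h) IR) pairing x y
   = \sum_(x <- map (midt h) (iota 0 (size (top h)))) \sum_(y <- map (rightt D h) IR) pairing x y.
  rewrite exchange_big [RHS]exchange_big /= !big_map; apply: eq_big_seq => y hy; rewrite !big_map.
  have [pr pr' _ _ _] := side_points wf (sR y hy).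
  transitivity (- \sum_(i <- iota 0 (size (bot h))) pairing (rightb D h y) (midb h i)).
    rewrite -sumrN; apply: eq_big_seq => i hi; apply: pairingC => //; first exact: mb.
    move: hi; rewrite mem_iota add0n /= => hi.
    by rewrite xpair_eqE eqxx ltn_eqF //= -addnA ltn_add2l ltn_addr.
  transitivity (- \sum_(i <- iota 0 (size (top h))) pairing (rightt D h y) (midt h i)).
    congr (- _); apply: mid_sumP => //; first exact: sR.
      by move=> i hi; rewrite xpair_eqE eqxx gtn_eqF //= -addnA ltn_add2l ltn_addr.
    by move=> i hi; rewrite xpair_eqE eqxx gtn_eqF //= -addnA ltn_add2l ltn_addr.
  rewrite -sumrN; apply: eq_big_seq => i hi; rewrite [RHS]pairingC //; first exact: mt.
  move: hi; rewrite mem_iota add0n /= => hi.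
  by rewrite xpair_eqE eqxx ltn_eqF //= -addnA ltn_add2l ltn_addr.
rewrite !psum_cat3 eL eR eLR eLM eMR.
transitivity (psum pairing [seq midt h i | i <- iota 0 (size (top h))]
   - psum pairing [seq midb h i | i <- iota 0 (size (bot h))]); first by ring.
rewrite /layer_turn /is_crossing; case e : (piece_at h) => [s|o|o|n] /=.
- have [pb0 pb1 pt0 pt1 [ub0 ub1 ut0 ut1 [n0 n1 E0 E1]]] := crossing_points hh e.
  rewrite !big_seq1 !big_nil !addr0 pairingC //; last first.
    by rewrite xpair_eqE eqxx eqn_add2l.
  rewrite /pairing ub0 ub1 ut0 ut1 /=.
  have -> : first (midt h 1) (midt h 0) = first (midb h 0) (midb h 1).
    symmetry; apply: first_adj => //; try (by left); by rewrite xpair_eqE ?eqn_add2l ?eqxx ?(ltn_eqF (ltnSn h)) ?(gtn_eqF (ltnSn h)).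
  by rewrite /osgn; ring.
- have [p0 p1 u0 u1 [ii _]] := cup_points wf good hh e.
  rewrite !big_seq1 !big_nil !addr0 /pairing u0 u1 /first.
  by case: (o) ii => /= ->; rewrite ?ltnSn /osgn ?ltnNge ?leqnSn /=; ring.
- have [p0 p1 u0 u1 [ii _]] := cap_points wf good hh e.
  rewrite !big_seq1 !big_nil !addr0 /pairing u0 u1 /first.
  by case: (o) ii => /= ->; rewrite ?ltnSn /osgn ?ltnNge ?leqnSn /=; ring.
- by case: (noV e).
Qed.

Lemma sum_half_turns : \sum_k half_turns (D := D) k = \sum_(h < size D) layer_turn h.
Proof.
rewrite /half_turns exchange_big; apply: eq_bigr => h _; rewrite /layer_turn.
case: (piece_at h) => [s|b|b|n]; [by rewrite big1 | | | by rewrite big1].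
  by rewrite -big_mkcond (big_pred1 (strand D (h.+1, lpos h))) // => k; rewrite eq_sym.
by rewrite -big_mkcond (big_pred1 (strand D (h : nat, lpos h))) // => k; rewrite eq_sym.
Qed.

(** The sum of the pairings over the pairs of a level telescopes to 0, as the
   bottom and the top level have one point each.  This is the analogue of the
   Whitney formula for the turning number of a curve. *)
Lemma whitney : \sum_k half_turns (D := D) k
  = - (2 * \sum_(h < size D | is_crossing D h) first (midb h 0) (midb h 1)).
Proof.
have := telescope_sumr (fun h => psum pairing (lvl D h)) (leq0n (size D)).
rewrite big_mkord; under eq_bigr do rewrite layer_psum ?ltn_ord //.
rewrite sumrB sumrN -sum_half_turns /lvl level_end // level0 /= !big_nil subrr.
rewrite -big_mkcond -mulr_sumr /= => /eqP; rewrite subr_eq0 eqr_oppLR => /eqP.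
by [].
Qed.

End Whitney.

(** * The Alexander polynomial as a determinant of the transition matrix *)

Section Numbering.
Variable D : diagram.
Hypothesis wf : well_formed D.

Notation lpos := (Defs.lpos D).
Notation next := (Defs.next D).
Notation level := (Defs.level D).
Notation piece_at h := (layer_at D h).2.
Notation bot h := (bottom_side (piece_at h)).
Notation top h := (top_side (piece_at h)).
Notation E := ((size D, 0%N) : point).
Notation O := ((0%N, 0%N) : point).
Notation idx := (idx D).
Notation midb := (midb D).
Notation midt := (midt D).
Notation snum := (snum D).

(** Index of the region to the left of position [p]: crossing an upward
   strand from left to right raises it by 1. *)
Definition height (h p : nat) : int := \sum_(o <- take p (level h)) osgn o.
(** Alexander numbering of the region on the left side of the oriented
   strand. *)
Definition alexander_index (x : point) : int := height x.1 x.2 - (~~ up D x)%:R.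

Lemma height_left h p : (h < size D)%N -> (p <= lpos h)%N -> height h.+1 p = height h p.
Proof.
move=> hh; have [A [B [<- e1 e2]]] := level_split wf hh.
by move=> hp; rewrite /height e1 e2 !takel_cat.
Qed.
Lemma height_bot h i : (h < size D)%N -> (i <= size (bot h))%N ->
  height h (lpos h + i) = height h (lpos h) + \sum_(o <- take i (bot h)) osgn o.
Proof.
move=> hh hi; have [A [B [<- e1 e2]]] := level_split wf hh.
rewrite /height e1 takeD !take_size_cat // drop_size_cat // big_cat /=.
by congr (_ + _); rewrite takel_cat.
Qed.
Lemma height_top h i : (h < size D)%N -> (i <= size (top h))%N ->
  height h.+1 (lpos h + i) = height h (lpos h) + \sum_(o <- take i (top h)) osgn o.
Proof.
move=> hh hi; rewrite -(height_left hh (leqnn _)); have [A [B [<- e1 e2]]] := level_split wf hh.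
rewrite /height e2 takeD !take_size_cat // drop_size_cat // big_cat /=.
by congr (_ + _); rewrite takel_cat.
Qed.
Lemma sides_balance x : \sum_(o <- bottom_side x) osgn o = \sum_(o <- top_side x) osgn o.
Proof. by case: x => [s|[]|[]|n] //=; rewrite !big_cons !big_nil. Qed.
Lemma height_right h p : (h < size D)%N ->
  height h.+1 (lpos h + size (top h) + p) = height h (lpos h + size (bot h) + p).
Proof.
move=> hh; have [A [B [<- e1 e2]]] := level_split wf hh.
rewrite /height e1 e2 !catA -!size_cat !takeD !take_size_cat // !drop_size_cat // !big_cat /=.
by rewrite sides_balance.
Qed.

Lemma index_next x : x \in points D -> x != E -> ~~ enters_node D x ->
  alexander_index (next x) = alexander_index x.
Proof.
move: x; suff H : forall x, x \in points D -> x != E ->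
    ~~ enters_node D x -> alexander_index (next x) = alexander_index x by move=> x; apply: H.
apply: (next_ind wf (P := fun x y => ~~ enters_node D x -> alexander_index y = alexander_index x)).
- by move=> h p hh hp _ _ _; rewrite /alexander_index /= up_left // height_left // ltnW.
- by move=> h p hh hp _ _ _; rewrite /alexander_index /= up_left // height_left // ltnW.
- by move=> h p x y hh _ _ _; rewrite /alexander_index /= up_right // height_right.
- by move=> h p x y hh _ _ _; rewrite /alexander_index /= up_right // height_right.
- move=> h s i hh e hi; rewrite /enters_node /is_node /= hh e leq_addr /= ltn_add2l.
  by rewrite hi.
- move=> h n i hh e hi; rewrite /enters_node /is_node /= hh e leq_addr /= ltn_add2l size_nseq.
  by rewrite hi.
- move=> h b hh e _; rewrite /alexander_index /= !height_bot ?e; try by case: (b).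
  rewrite !up_bot ?e; try by case: (b).
  by case: (b); rewrite /= !big_cons ?big_nil /osgn; ring.
- move=> h b hh e _; rewrite /alexander_index /= !height_top ?e; try by case: (b).
  rewrite !up_top ?e; try by case: (b).
  by case: (b); rewrite /= !big_cons ?big_nil /osgn; ring.
Qed.

Hypothesis good : perm_eq (traversal D) (points D).

(** The region on the left of a strand changes only when the strand passes
   a node. *)
Lemma index_strand x y : x \in points D -> y \in points D -> snum x = snum y ->
  alexander_index x = alexander_index y.
Proof.
wlog: x y / (idx x <= idx y)%N.
  move=> H px py e; case: (leqP (idx x) (idx y)) => h; first exact: H.
  by symmetry; apply: H => //; apply: ltnW.
move=> h px py; move en : (idx y - idx x)%N => n; elim: n x h px en => [|n IH] x h px en e.
  by congr alexander_index; apply: (idx_inj good) => //; lia.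
have xE : x != E.
  by apply/eqP => xe; have := idx_le_E wf good py; rewrite -xe; lia.
have ne : ~~ enters_node D x.
  by apply/negP => ex; have := snum_enter wf good px xE ex (_ : (idx x < idx y)%N); rewrite e ltnn; lia.
rewrite -(index_next px xE ne); have [pn _] := next_spec wf px xE.
by apply: IH => //; rewrite ?(idx_next wf good px xE) ?(snum_next wf good px xE) ?(negPf ne) ?addn0 //; lia.
Qed.

Definition strand_index (k : nat) : int :=
  alexander_index (nth O (points D) (find (fun z => snum z == k) (points D))).
Lemma strand_indexE x : x \in points D -> strand_index (snum x) = alexander_index x.
Proof.
move=> px; have hs : has (fun z => snum z == snum x) (points D) by apply/hasP; exists x.
apply: index_strand => //; first by apply: mem_nth; rewrite -has_find.
exact/eqP/(nth_find O hs).
Qed.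

Hypothesis noV : forall h n, piece_at h <> TwistVertex n.

Definition over_enter h := midb h (~~ is_positive D h).
Definition under_enter h := midb h (is_positive D h).
Definition over_leave h := midt h (is_positive D h).
Definition under_leave h := midt h (~~ is_positive D h).
Notation A := (transition D).
Notation sg := (csign D).

Lemma is_crossingP h : is_crossing D h -> exists s,
  [/\ (h < size D)%N, piece_at h = Crossing s, is_positive D h = s & sg h = (if s then 1 else -1)].
Proof.
rewrite /is_crossing /csign /is_positive; case e : (piece_at h) => [s|||] // _; exists s; split => //.
by rewrite ltnNge; apply/negP => hh; move: e; rewrite /layer_at nth_default.
Qed.

Record crossing_spec h : Prop := CrossingSpec {
  oi_pt : over_enter h \in points D; ui_pt : under_enter h \in points D;
  oo_pt : over_leave h \in points D; uo_pt : under_leave h \in points D;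
  oi_enter : enters_node D (over_enter h); ui_enter : enters_node D (under_enter h);
  snum_oo : snum (over_leave h) = (snum (over_enter h)).+1;
  snum_uo : snum (under_leave h) = (snum (under_enter h)).+1;
  snum_ou : snum (over_enter h) <> snum (under_enter h);
  index_oo : alexander_index (over_leave h) = alexander_index (over_enter h) + sg h;
  index_uo : alexander_index (under_leave h) = alexander_index (over_enter h);
  index_ui : alexander_index (under_enter h) = alexander_index (over_enter h) + sg h }.

(** The incoming strands of a crossing differ because a strand enters only
   one port; the indices of the four regions around a crossing give the
   indices of its strands. *)
Lemma crossingP h : is_crossing D h -> crossing_spec h.
Proof.
move=> /is_crossingP [s [hh e ps ss]].
have [pb0 pb1 pt0 pt1 [ub0 ub1 ut0 ut1 [n0 n1 E0 E1]]] := crossing_points wf good hh e.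
have en i : (i < 2)%N -> enters_node D (midb h i).
  by move=> hi; rewrite /enters_node /is_node /= hh e leq_addr ltn_add2l.
have s0 : snum (midt h 1) = (snum (midb h 0)).+1 by rewrite -n0 snum_next // en // addn1.
have s1 : snum (midt h 0) = (snum (midb h 1)).+1 by rewrite -n1 snum_next // en // addn1.
have i0 : alexander_index (midb h 1) = alexander_index (midb h 0) + 1.
  rewrite /alexander_index ub0 ub1 /= addn0 height_bot ?e //= big_seq1 /osgn; ring.
have i1 : alexander_index (midt h 0) = alexander_index (midb h 0).
  by rewrite /alexander_index ub0 ut0 /= !addn0 height_left.
have i2 : alexander_index (midt h 1) = alexander_index (midb h 0) + 1.
  rewrite /alexander_index ub0 ut1 /= addn0 height_top ?e //= big_seq1 /osgn; ring.
have d : snum (midb h 0) <> snum (midb h 1).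
  move=> /(enter_inj wf good pb0 pb1 (en 0%N isT) (en 1%N isT)) [] /eqP.
  by rewrite eqn_add2l.
by case: s ps ss {e} => ps ss; split; rewrite /over_enter /under_enter /over_leave /under_leave ?ps ?ss /= ?s0 ?s1 ?i0 ?i1 ?i2 ?en //;
   try ring; apply/nesym.
Qed.

Lemma port_crossing (V : zmodType) (F : nat -> nat -> V) :
  \sum_(h < size D) \sum_(i < ports (piece_at h)) F h i
  = \sum_(h < size D | is_crossing D h) (F h (~~ is_positive D h) + F h (is_positive D h)).
Proof.
rewrite [RHS]big_mkcond; apply: eq_bigr => h _; rewrite /is_crossing /is_positive.
case e : (piece_at h) => [s|b|b|n] /=; rewrite ?big_ord0 //; last by case: (noV e).
by rewrite !big_ord_recl big_ord0 addr0 /=; case: s {e}; rewrite // addrC.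
Qed.

Lemma over_in_sum k : (k <= last_strand D)%N ->
  \sum_(h < size D | is_crossing D h) ((snum (over_enter h) == k)%:R + (snum (under_enter h) == k)%:R)
  = (k < last_strand D)%N%:R :> int.
Proof.
by move=> kl; rewrite -(enter_port_sum wf good int kl) (port_crossing (fun h i => (snum (midb h i) == k)%:R)).
Qed.
Lemma over_out_sum (R : nzRingType) k : (0 < k <= last_strand D)%N ->
  \sum_(h < size D | is_crossing D h) ((snum (over_leave h) == k)%:R + (snum (under_leave h) == k)%:R) = 1 :> R.
Proof.
move=> /andP[k0 kl]; rewrite -[RHS]/(true%:R) -[in RHS]k0 -(leave_port_sum wf good R kl).
rewrite (port_crossing (fun h i => (snum (midt h i) == k)%:R)).
by apply: eq_bigr => h _; rewrite addrC.
Qed.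

Lemma transition_entry k l : A k l = \sum_(h < size D | is_crossing D h)
  (T ^ sg h * ((snum (over_enter h) == k)%:R * (snum (over_leave h) == l)%:R)
   + (1 - T ^ sg h) * ((snum (over_enter h) == k)%:R * (snum (under_leave h) == l)%:R)
   + (snum (under_enter h) == k)%:R * (snum (under_leave h) == l)%:R).
Proof.
have E2 (x : point) (j : 'I_(last_strand D).+1) : (j == strand D x) = (snum x == j).
  by rewrite -(inj_eq val_inj) /= strandE eq_sym.
rewrite /transition summxE [RHS]big_mkcond; apply: eq_bigr => h _; rewrite /is_crossing.
case e : (piece_at h) => [s|b|b|n]; rewrite ?mxE //; last by case: (noV e).
by rewrite /over_in /over_out /under_in /under_out !E2 -!mulnb !natrM.
Qed.

Lemma wirtinger_entry k l : wirtinger_matrix D k l = \sum_(h < size D | is_crossing D h)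
  ((snum (over_enter h) == k)%:R * ((snum (over_leave h) == l)%:R - (snum (over_enter h) == l)%:R)
   + (snum (under_enter h) == k)%:R * ((snum (under_leave h) == l)%:R - T ^ sg h * (snum (under_enter h) == l)%:R
       - (1 - T ^ sg h) * (snum (over_enter h) == l)%:R)).
Proof.
have E2 (x : point) (j : 'I_(last_strand D).+1) : (j == strand D x) = (snum x == j).
  by rewrite -(inj_eq val_inj) /= strandE eq_sym.
rewrite /wirtinger_matrix summxE; apply: eq_bigr => h _.
by rewrite !mxE /over_in /over_out /under_in /under_out !E2 -!mulnb !natrM; ring.
Qed.

(** Without its first row and column, [1 - A] is the transpose of the Fox
   Jacobian conjugated by the powers of T given by the Alexander numbering:
   the factors T^s of the Wirtinger relations at a crossing of sign s come
   from the differences of index around it. *)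
Lemma wirtinger_transition (a b : 'I_(last_strand D)) :
  wirtinger_matrix D (lift ord_max a) (lift ord0 b)
  = T ^ strand_index b.+1 * (1%:M - A) (lift ord0 b) (lift ord0 a) * T ^ (- strand_index a.+1).
Proof.
set k := lift ord0 b; set l := lift ord0 a.
have kE : k = b.+1 :> nat by []. have lE : l = a.+1 :> nat by [].
have aE : lift ord_max a = a :> nat by rewrite /= /bump leqNgt ltn_ord.
rewrite !mxE wirtinger_entry transition_entry mulrBr mulrBl.
have -> : T ^ strand_index b.+1 * (k == l)%:R * T ^ (- strand_index a.+1) = (k == l)%:R.
  case: eqP => [/(congr1 val) e|_]; last by rewrite mulr0 mul0r.
  have -> : b.+1 = a.+1 by exact: e.
  by rewrite mulr1 -TexpD subrr expr0z.
have hl : (0 < a.+1 <= last_strand D)%N by rewrite ltn_ord.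
have -> : (k == l)%:R = \sum_(h < size D | is_crossing D h)
    ((snum (over_leave h) == a.+1)%:R * (snum (over_leave h) == k)%:R + (snum (under_leave h) == a.+1)%:R * (snum (under_leave h) == k)%:R) :> ZT.
  transitivity ((k == l)%:R * \sum_(h < size D | is_crossing D h)
     ((snum (over_leave h) == a.+1)%:R + (snum (under_leave h) == a.+1)%:R) : ZT).
    by rewrite over_out_sum // mulr1.
  have -> : (k == l) = (b.+1 == a.+1) by rewrite -(inj_eq val_inj).
  rewrite mulr_sumr kE; apply: eq_bigr => h _; rewrite mulrDr.
  by congr (_ + _); case: (snum _ =P a.+1) => [->|_]; rewrite ?mulr0 ?mul0r // mulr1 mul1r eq_sym.
rewrite mulr_sumr mulr_suml -sumrB; apply: eq_bigr => h /crossingP [p1 p2 p3 p4 _ _ s1 s2 _ i1 i2 i3].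
rewrite aE lE kE; set S := strand_index.
have eo : (snum (over_enter h) == a) = (snum (over_leave h) == a.+1) by rewrite s1 eqSS.
have eu : (snum (under_enter h) == a) = (snum (under_leave h) == a.+1) by rewrite s2 eqSS.
rewrite eo eu.
have h1 : T ^ S b.+1 * (T ^ sg h * ((snum (over_enter h) == b.+1)%:R * (snum (over_leave h) == a.+1)%:R)) * T ^ (- S a.+1)
   = (snum (over_enter h) == b.+1)%:R * (snum (over_leave h) == a.+1)%:R.
  case: eqP => [<-|_]; last by rewrite !(mul0r, mulr0).
  case: eqP => [<-|_]; last by rewrite !(mul0r, mulr0).
  by rewrite /S !strand_indexE // i1 !mulr1 -!TexpD subrr expr0z.
have h2 : T ^ S b.+1 * ((1 - T ^ sg h) * ((snum (over_enter h) == b.+1)%:R * (snum (under_leave h) == a.+1)%:R)) * T ^ (- S a.+1)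
   = (1 - T ^ sg h) * ((snum (over_enter h) == b.+1)%:R * (snum (under_leave h) == a.+1)%:R).
  case: eqP => [<-|_]; last by rewrite !(mul0r, mulr0).
  case: eqP => [<-|_]; last by rewrite !(mul0r, mulr0).
  by rewrite /S !strand_indexE // i2 !mulr1 mulrAC -!TexpD subrr expr0z mul1r.
have h3 : T ^ S b.+1 * ((snum (under_enter h) == b.+1)%:R * (snum (under_leave h) == a.+1)%:R) * T ^ (- S a.+1)
   = T ^ sg h * ((snum (under_enter h) == b.+1)%:R * (snum (under_leave h) == a.+1)%:R).
  case: eqP => [<-|_]; last by rewrite !(mul0r, mulr0).
  case: eqP => [<-|_]; last by rewrite !(mul0r, mulr0).
  rewrite /S !strand_indexE // i2 i3 !mulr1 -!TexpD; congr (_ ^ _); ring.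
have dd (x y a1 b1 c1 : ZT) : x * (a1 + b1 + c1) * y = x * a1 * y + x * b1 * y + x * c1 * y by ring.
rewrite dd h1 h2 h3; ring.
Qed.

Lemma det_conj n (B : 'M[ZT]_n) (f g : 'I_n -> ZT) : (forall i, f i * g i = 1) ->
  \det (\matrix_(i, j) (f i * B i j * g j)) = \det B.
Proof.
move=> fg; pose Fm := diag_mx (\row_i f i); pose Gm := diag_mx (\row_i g i).
have -> : \matrix_(i, j) (f i * B i j * g j) = Fm *m B *m Gm.
  by apply/matrixP => i j; rewrite mul_mx_diag mul_diag_mx !mxE.
rewrite !det_mulmx !det_diag mulrAC -big_split /= big1 ?mul1r // => i _.
by rewrite !mxE.
Qed.

(** The first column of [1 - A] is a unit vector, as no transition leads to
   the first strand, so the determinant reduces to the minor. *)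
Lemma alexander_minor_det : alexander_minor D = \det (1%:M - A).
Proof.
have c0 k : A k ord0 = 0.
  by rewrite -[RHS](transition_first wf good k); congr (A k _); apply: val_inj; rewrite /= strandE snum_O.
transitivity (\det (row' ord0 (col' ord0 (1%:M - A)))); last first.
  rewrite (expand_det_col (1%:M - A) ord0) (bigD1 ord0) //= big1 ?addr0 => [|i ni]; last first.
    by rewrite !mxE c0 subr0 (negPf ni) mul0r.
  by rewrite !mxE c0 eqxx subr0 mul1r /cofactor addn0 expr0 mul1r.
rewrite /alexander_minor -det_tr -(det_conj (row' ord0 (col' ord0 (1%:M - A)))
   (f := fun b : 'I_(last_strand D) => T ^ strand_index b.+1)
   (g := fun a : 'I_(last_strand D) => T ^ (- strand_index a.+1))).
  congr (\det _); apply/matrixP => b a; rewrite [LHS]mxE [LHS]mxE [LHS]mxE [RHS]mxE.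
  by rewrite wirtinger_transition !mxE.
by move=> i; rewrite -TexpD subrr expr0z.
Qed.

End Numbering.

(** * The invariant as a bracket of polynomial terms *)

Lemma sum_delta n (F : nat -> int) x : (x < n)%N ->
  \sum_(k < n) F k * (x == k :> nat)%:R = F x.
Proof.
move=> xn; rewrite (bigD1 (Ordinal xn)) //= eqxx mulr1 big1 ?addr0 // => k nk.
by rewrite eq_sym -[x]/(nat_of_ord (Ordinal xn)) (inj_eq val_inj) (negPf nk) mulr0.
Qed.

Lemma R1_clear (F : fieldType) (d s a b c e f : F) : d != 0 -> 2%:R != 0 :> F ->
  d ^+ 2 * (s * (d^-1 * a * (d^-1 * b + d^-1 * c - d^-1 * e) - d^-1 * f * (d^-1 * c - 1) - 1 / 2%:R))
  = s * (a * (b + c - e) - f * (c - d) - 1 / 2%:R * d ^+ 2).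
Proof. by move=> d0 t0; field; apply/andP; split. Qed.
Lemma turn_clear (F : fieldType) (d p g : F) : d != 0 -> 2%:R != 0 :> F ->
  d ^+ 2 * (p * (d^-1 * g - 1 / 2%:R)) = p * 2%:R * ((g * d - d ^+ 2 / 2%:R) / 2%:R).
Proof. by move=> d0 t0; field; apply/andP; split. Qed.
Lemma turn_half (F : fieldType) (p g : F) : p * (g / 2%:R) = p / 2%:R * g.
Proof. by rewrite mulrA mulrAC. Qed.

Section Exponent.
Variable D : diagram.
Hypothesis wf : well_formed D.
Hypothesis good : perm_eq (traversal D) (points D).
Notation piece_at h := (layer_at D h).2.
Hypothesis noV : forall h n, piece_at h <> TwistVertex n.
Notation snum := (snum D).
Notation A := (transition D).
Notation sg := (csign D).
Notation last := (last_strand D).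
Notation oi := (over_enter D).
Notation ui := (under_enter D).
Notation oo := (over_leave D).
Notation uo := (under_leave D).

(** Signed count of the crossings that the knot passes first on the under-strand. *)
Definition under_first : int :=
  \sum_(h < size D | is_crossing D h) sg h * (snum (ui h) < snum (oi h))%N%:R.

(** At T = 1 the walker always moves on to the next strand. *)
Lemma transition_jet (k l : 'I_last.+1) : jet1 (A k l) (l == k.+1 :> nat)%:R
  (\sum_(h < size D | is_crossing D h) sg h *
     ((snum (oi h) == k)%:R * ((snum (oo h) == l)%:R - (snum (uo h) == l)%:R))).
Proof.
have jb (b : bool) : jet1 b%:R b%:R 0 by case: b; [exact: (jet1_const 1) | exact: (jet1_const 0)].
rewrite (transition_entry noV).
apply: (jet1_eq (a := \sum_(h < size D | is_crossing D h)
    ((snum (oi h) == k)%:R * (snum (oo h) == l)%:R + (snum (ui h) == k)%:R * (snum (uo h) == l)%:R))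
  (b := \sum_(h < size D | is_crossing D h) (sg h * ((snum (oi h) == k)%:R * (snum (oo h) == l)%:R)
      - sg h * ((snum (oi h) == k)%:R * (snum (uo h) == l)%:R)))).
- apply: jet1_sum => h _.
  have j1 := jet1M (jet1_T (sg h)) (jet1M (jb (snum (oi h) == k)) (jb (snum (oo h) == l))).
  have j2 := jet1M (jet1B (jet1_const 1) (jet1_T (sg h))) (jet1M (jb (snum (oi h) == k)) (jb (snum (uo h) == l))).
  have j3 := jet1M (jb (snum (ui h) == k)) (jb (snum (uo h) == l)).
  by apply: (jet1_eq (jet1D (jet1D j1 j2) j3)); ring.
- transitivity ((l == k.+1 :> nat)%:R * \sum_(h < size D | is_crossing D h)
     ((snum (oi h) == k)%:R + (snum (ui h) == k)%:R) : int).
    rewrite mulr_sumr; apply: eq_bigr => h /(crossingP wf good) c.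
    rewrite mulrDr (snum_oo c) (snum_uo c).
    by congr (_ + _); (case: (_ =P k :> nat) => [->|_]; last by rewrite mulr0 mul0r);
      rewrite mul1r mulr1 eq_sym.
  rewrite over_in_sum //; last by rewrite -ltnS.
  case: eqP => [e|_]; last by rewrite mul0r.
  by rewrite mul1r; have := ltn_ord l; rewrite e ltnS => ->.
- by apply: eq_bigr => h _; ring.
Qed.

(** Multiplying [1 - A] by the unitriangular matrix of ones sums its rows,
   and at T = 1 gives the identity matrix; the derivative is then the trace,
   to which a crossing contributes when its lower strand comes first. *)
Lemma det_jet : jet1 (\det (1%:M - A)) 1 under_first.
Proof.
(* left multiplication by N0 adds to each row all later ones *)
pose N0 : 'M[ZT]_last.+1 := \matrix_(i, j) (i <= j)%N%:R.
have dN : \det N0 = 1.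
  rewrite -det_tr det_trig; first by rewrite big1 // => i _; rewrite !mxE leqnn.
  by apply/is_trig_mxP => i j ij; rewrite !mxE leqNgt ij.
have jb (b : bool) : jet1 b%:R b%:R 0 by case: b; [exact: (jet1_const 1) | exact: (jet1_const 0)].
pose b1 (k l : 'I_last.+1) : int := (\sum_(h < size D | is_crossing D h) sg h *
     ((snum (oi h) == k)%:R * ((snum (oo h) == l)%:R - (snum (uo h) == l)%:R))).
pose b (k l : 'I_last.+1) : int := \sum_(k' < last.+1) - ((k <= k')%N%:R * b1 k' l).
have -> : \det (1%:M - A) = \det (N0 *m (1%:M - A)) by rewrite det_mulmx dN mul1r.
have jB (k l : 'I_last.+1) : jet1 ((N0 *m (1%:M - A)) k l) (k == l)%:Z (b k l).
  rewrite mxE; apply: (jet1_eq (a := \sum_(k' < last.+1)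
     (k <= k')%N%:R * ((k' == l)%:R - (l == k'.+1 :> nat)%:R)) (b := b k l)) => //.
    apply: jet1_sum => k' _; rewrite !mxE.
    have jd : jet1 ((k' == l)%:R - A k' l) _ _ := jet1B (jb (k' == l)) (transition_jet k' l).
    by apply: (jet1_eq (jet1M (jb (k <= k')%N) jd)) => //; rewrite mul0r addr0 sub0r mulrN.
  transitivity (\sum_(k' < last.+1) (k <= k')%N%:R * (l == k' :> nat)%:R
    - \sum_(k' < last.+1) (k <= k')%N%:R * (l == k'.+1 :> nat)%:R : int).
    by rewrite -sumrB; apply: eq_bigr => k' _; rewrite mulrBr [k' == l]eq_sym (inj_eq val_inj).
  rewrite (sum_delta (fun k' => (k <= k')%N%:R)) //.
  have -> : \sum_(k' < last.+1) (k <= k')%N%:R * (l == k'.+1 :> nat)%:R = (k < l)%N%:R :> int.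
    case: l => -[|l] hl /=; first by rewrite big1 // => i _; rewrite mulr0.
    under eq_bigr do rewrite eqSS.
    by rewrite (sum_delta (fun k' => (k <= k')%N%:R)) // ltnW.
  by rewrite -(inj_eq val_inj) /=; case: ltngtP.
apply: (jet1_eq (jet1_det jB) erefl).
rewrite /b /b1 /under_first.
under eq_bigr => k _ do under eq_bigr => k' _ do rewrite mulr_sumr -sumrN.
under eq_bigr => k _ do rewrite exchange_big /=.
rewrite exchange_big /=; apply: eq_bigr => h /(crossingP wf good) c.
have lt x : (snum x < last.+1)%N by rewrite ltnS snum_le.
transitivity (\sum_(k < last.+1) - (sg h * ((k <= snum (oi h))%N%:R *
     ((snum (oo h) == k)%:R - (snum (uo h) == k)%:R)))).
  apply: eq_bigr => k _.
  rewrite -(sum_delta (fun k' => - (sg h * ((k <= k')%N%:R * ((snum (oo h) == k)%:R - (snum (uo h) == k)%:R)))) (lt (oi h))).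
  by apply: eq_bigr => k' _; ring.
transitivity (- sg h * (\sum_(k < last.+1) (k <= snum (oi h))%N%:R * (snum (oo h) == k)%:R
    - \sum_(k < last.+1) (k <= snum (oi h))%N%:R * (snum (uo h) == k)%:R)).
  by rewrite -sumrB mulr_sumr; apply: eq_bigr => k _; ring.
rewrite !(sum_delta (fun k => (k <= snum (oi h))%N%:R)) //.
by rewrite (snum_oo c) (snum_uo c) ltnn sub0r mulrN mulNr opprK.
Qed.

Lemma det_neq0 : \det (1%:M - A) != 0.
Proof.
apply/eqP => e; have := det_jet; rewrite e => j.
by have [] := jet1_uniq j (jet1_const 0).
Qed.

(** In the Whitney formula each crossing contributes -1 or 1 according to
   its sign and to which strand is passed first; adding the sign leaves twice
   the signed count of the crossings that are passed first below. *)
Lemma turning_writhe : total_turning D + writhe D = under_first * 2.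
Proof.
have E1 : total_turning D = - \sum_(h < size D | is_crossing D h) first D (midb D h 0) (midb D h 1).
  have := whitney wf good noV; rewrite (eq_bigr (fun k => turning k * 2)) => [|k _]; last first.
    exact: half_turns_even.
  rewrite -mulr_suml -/(total_turning D); lia.
rewrite E1 /writhe addrC -sumrB /under_first mulr_suml; apply: eq_bigr => h ch.
have [p1 p2 _ _ e1 e2 _ _ ne _ _ _] := crossingP wf good ch.
have fE x y : x \in points D -> y \in points D -> enters_node D x -> enters_node D y ->
   snum x <> snum y -> (idx D x < idx D y)%N = (snum x < snum y)%N.
  move=> px py ex ey n; apply/idP/idP => h'.
    by apply: (snum_enter wf good px (enters_neqE px ex) ex h').
  rewrite ltnNge; apply/negP => h2; have := snum_mono (D := D) h2.
  by rewrite leqNgt h'.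
have [s [hh e ps ss]] := is_crossingP ch.
move: p1 p2 e1 e2 ne; rewrite /over_enter /under_enter ps ss /first.
case: (s) => /= p1 p2 e1 e2 ne; rewrite fE //; try exact: nesym; rewrite /osgn.
  by case: ltngtP ne => // _ _; ring.
by case: ltngtP ne => // _ _; ring.
Qed.

(** The power of T that symmetrizes the determinant is read off from its
   derivative at T = 1. *)
Lemma alexander_sq Delta : symmetrized_alexander D Delta ->
  Delta ^+ 2 = T ^ (- total_turning D - writhe D) * \det (1%:M - A) ^+ 2.
Proof.
have E := alexander_minor_det wf good noV; move=> hs.
have jm : jet1 (alexander_minor D) 1 under_first by rewrite E; apply: det_jet.
rewrite (symmetrized_alexander_sq hs jm) E -opprD turning_writhe; done.
Qed.

Lemma green_adj : green D = (\det (1%:M - A))^-1 *: \adj (1%:M - A).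
Proof. by rewrite /green /invmx unitmxE unitfE det_neq0. Qed.

(** Contribution of a cup or a cap to the turning term: half a turn of the
   strand through it. *)
Definition turn_term (h : nat) : ZT :=
  let g := \adj (1%:M - A) in let d := \det (1%:M - A) in
  match piece_at h with
  | Cup b => (if b then -1 else 1) / 2%:R *
      (g (strand D (h.+1, lpos D h)) (strand D (h.+1, lpos D h)) * d - d ^+ 2 / 2%:R)
  | Cap b => (if b then -1 else 1) / 2%:R *
      (g (strand D (h, lpos D h)) (strand D (h, lpos D h)) * d - d ^+ 2 / 2%:R)
  | _ => 0
  end.

(** The invariant multiplied by a power of T and with the denominators of
   the Green function replaced by the adjugate. *)
Definition rho_bracket : ZT :=
  \sum_(h < size D | is_crossing D h) R1_tilde D h - \sum_(h < size D) turn_term h.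

Lemma two_neq0 : 2%:R != 0 :> ZT.
Proof.
apply/eqP => e; have j2 : jet1 0 2 0 by rewrite -e; exact: (jet1_const 2).
by have [] := jet1_uniq j2 (jet1_const 0).
Qed.

Lemma R1_tildeE h : \det (1%:M - A) ^+ 2 * R1 D h = R1_tilde D h.
Proof.
rewrite /R1 /R1_tilde green_adj; set d := \det _; set g := \adj _.
have d0 : d != 0 by apply: det_neq0.
move: two_neq0 => t0; move: (_%:~R) d g d0 t0 => s d g d0 t0.
have gE i j : (d^-1 *: g) i j = d^-1 * g i j by rewrite mxE.
rewrite /= !gE; move: (g _ _) (g _ _) (g _ _) (g _ _) (g _ _) => a b c e f.
exact: (@R1_clear ZT d s f e c b a d0 t0).
Qed.

(** Summing over the strands, then over the half turns of each strand, is
   summing over the cups and caps. *)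
Lemma turning_sum : \det (1%:M - A) ^+ 2 * \sum_k (turning k)%:~R * (green D k k - 1 / 2%:R)
  = \sum_(h < size D) turn_term h.
Proof.
have t0 := two_neq0.
transitivity (\sum_k (half_turns (D := D) k)%:~R * ((\adj (1%:M - A) k k * \det (1%:M - A)
    - \det (1%:M - A) ^+ 2 / 2%:R) / 2%:R)).
  rewrite mulr_sumr; apply: eq_bigr => k _; rewrite half_turns_even // rmorphM /= green_adj.
  set d := \det _; set g := \adj _; have d0 : d != 0 by apply: det_neq0.
  have -> : (d^-1 *: g) k k = d^-1 * g k k by rewrite mxE.
  move: (_%:~R) (g k k) d d0 t0 => p x d d0 t0.
  have -> : (2 : int)%:~R = 2%:R :> ZT by [].
  exact: (@turn_clear ZT d p x d0 t0).
rewrite /half_turns; under eq_bigr do rewrite rmorph_sum mulr_suml /=.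
rewrite exchange_big /=; apply: eq_bigr => h _; rewrite /turn_term.
case: (piece_at h) => [s|b|b|n]; [by rewrite big1 // => k _; rewrite mul0r | | | by rewrite big1 // => k _; rewrite mul0r].
  rewrite (bigD1 (strand D (h.+1, lpos D h))) //= eqxx big1 ?addr0 => [|k nk]; last first.
    by rewrite eq_sym (negPf nk) mul0r.
  by rewrite turn_half; case: b; rewrite ?rmorphN ?rmorph1.
rewrite (bigD1 (strand D (h : nat, lpos D h))) //= eqxx big1 ?addr0 => [|k nk]; last first.
  by rewrite eq_sym (negPf nk) mul0r.
by rewrite turn_half; case: b; rewrite ?rmorphN ?rmorph1.
Qed.

Lemma rho_formula rho : is_rho1 D rho -> rho = T ^ (- total_turning D - writhe D) * rho_bracket.
Proof.
move=> [Delta /alexander_sq E ->]; rewrite E -mulrA mulrBr turning_sum mulr_sumr; congr (_ * (_ - _)).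
by apply: eq_bigr => h _; apply: R1_tildeE.
Qed.

End Exponent.

(** * Inserting a block of layers into a diagram *)

Local Open Scope nat_scope.

(** Position of a strand of the block above a layer; a twist vertex is
   traversed straight on. *)
Definition lstep (a : nat) (l : layer) : nat :=
  if l.2 is Crossing _ then wstep a l.1 else a.
(** Layers of a block occupy positions within its [n] strands. *)
Definition block_layer (n : nat) (l : layer) : bool :=
  match l.2 with
  | Crossing _ => l.1 + 2 <= n
  | TwistVertex k => l.1 + k <= n
  | _ => false
  end.

Lemma wstepK i : involutive (wstep ^~ i).
Proof.
move=> a; rewrite /wstep; case: (a =P i) => [->|n1].
  by rewrite eqxx [i.+1 == i]gtn_eqF.
case: (a =P i.+1) => [->|n2]; first by rewrite eqxx.
by case: (a =P i) n1 => // _ _; case: (a =P i.+1) n2.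
Qed.
Lemma lstepK l : involutive (lstep ^~ l).
Proof. by move=> a; rewrite /lstep; case: l.2 => // s; apply: wstepK. Qed.
Lemma foldl_lstepK s a : foldl lstep (foldl lstep a (rev s)) s = a.
Proof.
elim: s a => //= l s IH a; rewrite rev_cons foldl_rcons lstepK; exact: IH.
Qed.
Lemma lstep_lt n l a : block_layer n l -> a < n -> lstep a l < n.
Proof.
rewrite /block_layer /lstep /wstep; case: l.2 => // s h1 h2.
case: eqP => _; [lia | case: eqP => _; lia].
Qed.
Lemma foldl_lstep_lt n s a : all (block_layer n) s -> a < n -> foldl lstep a s < n.
Proof. by elim: s a => //= l s IH a /andP[h1 h2] h3; apply: IH => //; apply: lstep_lt. Qed.

Section Insert.
Variables (U : region) (n : nat) (E : diagram).
Notation L := (size (below U)).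
Notation q := (offset U).
Notation B := (base U).
Notation m := (size E).
Definition shiftE : diagram := [seq (q + l.1, l.2) | l <- E].
Notation D := (insert U E).

Hypothesis wfB : well_formed B.
Hypothesis n_gt0 : 0 < n.
Hypothesis strandsU : take n (drop q (level B L)) = nseq n true.
Hypothesis blockE : all (block_layer n) E.

Lemma block_take j : all (block_layer n) (take j E).
Proof. by move: blockE; rewrite -{1}(cat_take_drop j E) all_cat => /andP[]. Qed.
Lemma block_nth j : j < m -> block_layer n (nth (0, Cup true) E j).
Proof. exact: (all_nthP (0, Cup true) blockE). Qed.

Lemma size_insert : size D = size B + m.
Proof. by rewrite /insert /base !size_cat size_map addnA addnAC. Qed.
Lemma L_le : L <= size B.
Proof. by rewrite size_cat leq_addr. Qed.

Lemma layer_low h : h < L -> layer_at D h = layer_at B h.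
Proof. by move=> h1; rewrite /layer_at !nth_cat h1. Qed.
Lemma layer_mid j : j < m -> layer_at D (L + j) = nth (0, Cup true) shiftE j.
Proof.
move=> hj; rewrite /layer_at nth_cat ltnNge leq_addr /= addKn nth_cat size_map hj; done.
Qed.
Lemma layer_high h : L <= h -> layer_at D (h + m) = layer_at B h.
Proof.
move=> h1; rewrite /layer_at !nth_cat !ltnNge h1 (leq_trans h1) ?leq_addr //=.
by rewrite size_map -addnBAC // leq_addl addnK.
Qed.

Lemma strands_size : q + n <= size (level B L).
Proof.
have := congr1 size strandsU; rewrite size_nseq size_take_min size_drop.
by move=> h; have := geq_minr n (size (level B L) - q); rewrite h; lia.
Qed.
Lemma strands_up i : i < n -> nth true (level B L) (q + i) = true.
Proof. by move=> hi; rewrite -nth_drop -(nth_take _ hi) strandsU nth_nseq hi. Qed.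

(** The block lies on upward strands only, so its layers do not change the
   orientations of the level. *)
Lemma block_fits l : block_layer n l -> layer_fits (q + l.1, l.2) (level B L) /\
  apply_layer (level B L) (q + l.1, l.2) = level B L.
Proof.
move=> hl; have sz := strands_size; set o := level B L.
have [k [Ek1 Ek2 hk]] : exists k, [/\ bottom_side l.2 = nseq k true,
   top_side l.2 = nseq k true & l.1 + k <= n].
  by move: hl; rewrite /block_layer; case: l.2 => // [s|k] h; [exists 2 | exists k].
have T : take k (drop (q + l.1) o) = nseq k true.
  have s1 : size (take k (drop (q + l.1) o)) = k.
    by rewrite size_takel // size_drop /o; lia.
  apply: (@eq_from_nth _ true); first by rewrite s1 size_nseq.
  move=> i; rewrite s1 => hi; rewrite nth_take // nth_drop nth_nseq hi.
  by rewrite -addnA strands_up //; lia.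
split.
  rewrite /layer_fits /= Ek1; apply/andP; split; first by rewrite /o; lia.
  by apply/prefixP; exists (drop k (drop (q + l.1) o)); rewrite -T cat_take_drop.
rewrite /apply_layer /= Ek1 Ek2 size_nseq -T -/o.
by rewrite [q + l.1 + k]addnC -(drop_drop _ k) !cat_take_drop.
Qed.

Lemma take_low h : h <= L -> take h D = take h B.
Proof. by move=> h1; rewrite /insert /base !takel_cat. Qed.
Lemma level_low h : h <= L -> level D h = level B h.
Proof. by move=> h1; rewrite /level take_low. Qed.
Lemma foldl_block s : all (block_layer n) s ->
  foldl apply_layer (level B L) [seq (q + l.1, l.2) | l <- s] = level B L.
Proof.
elim: s => //= l s IH /andP[h1 h2]; have [_ ->] := block_fits h1; exact: IH.
Qed.
Lemma level_mid j : j <= m -> level D (L + j) = level B L.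
Proof.
move=> hj; rewrite {1}/level /insert takeD take_size_cat // drop_size_cat //.
rewrite takel_cat ?size_map // foldl_cat.
have -> : foldl apply_layer [:: true] (below U) = level B L.
  by rewrite /level /base take_size_cat.
rewrite -map_take; apply: foldl_block; exact: block_take.
Qed.
Lemma level_high h : L <= h -> level D (h + m) = level B h.
Proof.
move=> h1; have e1 : drop (L + m) D = above U.
  by rewrite /insert catA drop_size_cat // size_cat size_map.
have e2 : drop L B = above U by rewrite /base drop_size_cat.
rewrite -(subnKC h1) addnAC /level [take (L + m + _) _]takeD [take (L + (h - L)) B]takeD.
by rewrite !foldl_cat e1 e2; congr (foldl _ _ _); apply: level_mid.
Qed.

Lemma wf_insert : well_formed D.
Proof.
have [/allP hw /eqP he] := andP wfB.
apply/andP; split; last by rewrite size_insert level_high ?L_le // he.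
apply/allP => h; rewrite mem_iota add0n /= size_insert => hh.
case: (ltnP h L) => h1.
  rewrite (layer_low h1) (level_low (ltnW h1)); apply: hw.
  by rewrite mem_iota; apply: (leq_trans h1 L_le).
case: (ltnP h (L + m)) => h2.
  have hj : h - L < m by lia.
  rewrite -(subnKC h1) (layer_mid hj) (level_mid (ltnW hj)) (nth_map (0, Cup true)) //.
  by have [] := block_fits (block_nth hj).
have h3 : L <= h - m by lia.
have -> : h = h - m + m by lia.
rewrite (layer_high h3) (level_high h3); apply: hw; rewrite mem_iota add0n /=; lia.
Qed.

(** The block separates two copies, bottom and top, of the points of its level
   line; points of lower levels count as bottom copies.  The copy visited last
   is the bottom one exactly on lower levels and on downward strands. *)
Definition lowlast (x : point) := (x.1 < L) || ((x.1 == L) && ~~ up B x).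
(** The copy visited first is the bottom one exactly on lower levels and on
   upward strands. *)
Definition lowfirst (x : point) := (x.1 < L) || ((x.1 == L) && up B x).
Definition raise (x : point) : point := (x.1 + m, x.2).

Lemma next_lowlast x : lowlast x -> Defs.next D x = Defs.next B x.
Proof.
case: x => h p; rewrite /lowlast /up /Defs.next /= => hl.
have lh : h <= L by lia.
rewrite level_low //; case e : (nth true (level B h) p).
  have h1 : h < L by move: hl; rewrite e andbF orbF.
  by rewrite layer_low // size_insert (leq_trans h1 L_le) ltn_addr // (leq_trans h1 L_le).
case: h hl lh e => [|h] hl lh e /=.
  by rewrite level0 in e; case: p {hl} e => [|[|]].
by rewrite layer_low.
Qed.
Lemma next_high x : (L <= x.1) -> ~~ lowlast x -> Defs.next D (raise x) = raise (Defs.next B x).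
Proof.
case: x => h p /= h1; rewrite /lowlast /up /Defs.next /raise /= => hl.
rewrite level_high //; case e : (nth true (level B h) p).
  rewrite layer_high // size_insert ltn_add2r; case: ifP => // _.
  case: (layer_at B h) => i x /=.
  by case: ifP => // _; case: ifP => // _; case: x.
have h2 : L <= h.-1 /\ 0 < h by move: hl; rewrite e; lia.
have -> : (h + m).-1 = h.-1 + m by lia.
rewrite layer_high; last by case: h2.
case: (layer_at B h.-1) => i x /=.
by case: ifP => // _; case: ifP.
Qed.
Lemma lowlast_next x : x \in points B -> x != (size B, 0) -> lowlast x = lowfirst (Defs.next B x).
Proof.
move: x; apply: (next_ind wfB (P := fun x y => lowlast x = lowfirst y)); rewrite /lowlast /lowfirst /=.
- by move=> h p hh hp _ u; rewrite (up_left wfB hh hp) u; lia.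
- by move=> h p hh hp _ /negPf u; rewrite -(up_left wfB hh hp) u; lia.
- by move=> h p hh _ u; rewrite (up_right wfB _ hh) u; lia.
- by move=> h p hh _ /negPf u; rewrite -(up_right wfB _ hh) u; lia.
- move=> h s i hh e hi.
  have ub : up B (h, lpos B h + i) by rewrite up_bot ?e //; case: i hi => [|[|]].
  have ut : up B (h.+1, lpos B h + (1 - i)) by rewrite up_top ?e //; case: i hi {ub} => [|[|]].
  rewrite ub ut; lia.
- move=> h k i hh e hi.
  have ub : up B (h, lpos B h + i) by rewrite up_bot ?e /= ?size_nseq // nth_nseq hi.
  have ut : up B (h.+1, lpos B h + i) by rewrite up_top ?e /= ?size_nseq // nth_nseq hi.
  rewrite ub ut; lia.
- move=> h b hh e; by rewrite !up_bot ?e //; case: (b).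
- move=> h b hh e; by rewrite !up_top ?e //; case: (b).
Qed.

(** Position at height [j] of the block of the strand entering it at [p]. *)
Definition pos j p := if (q <= p < q + n) then q + foldl lstep (p - q) (take j E) else p.

Lemma next_up j p : j < m -> nth true (level B L) p -> Defs.next D (L + j, pos j p) = (L + j.+1, pos j.+1 p).
Proof.
move=> hj u; have lm := level_mid (ltnW hj).
have u' : nth true (level B L) (pos j p).
  rewrite /pos; case: ifP => // /andP[h1 h2]; rewrite strands_up //.
  by apply: foldl_lstep_lt; [exact: block_take | lia].
have hb := block_nth hj.
rewrite /Defs.next lm u' size_insert (leq_trans (_ : L + j < L + m)) ?leq_add2r ?L_le ?ltn_add2l //.
rewrite layer_mid // (nth_map (0, Cup true)) // /pos (take_nth (0, Cup true)) // foldl_rcons addnS.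
move: (nth (0, Cup true) E j) hb => [i x] /=; rewrite /block_layer /lstep /= => hb.
case hp : (q <= p < q + n); last first.
  case: ifP => h1 //; rewrite ifT; last first.
    by move: hb h1 hp; case: x => //= [s|k]; rewrite ?size_nseq; lia.
  by congr pair; move: hb h1 hp; case: x => //= [s|k]; rewrite ?size_nseq; lia.
set a := foldl _ _ _; have an : a < n.
  by apply: foldl_lstep_lt; [exact: block_take | lia].
rewrite ltn_add2l -addnA leq_add2l.
case: x hb => //= [s|k] hb; rewrite ?size_nseq.
  rewrite /wstep; case: ifP => h1; first by rewrite !ifF //; lia.
  case: ifP => h2; first by rewrite !ifF; [congr pair | |]; lia.
  case: (a =P i) => h3; first by congr pair; lia.
  by rewrite ifT; [congr pair | ]; lia.
by case: ifP => // h1; case: ifP => // h2; congr pair; lia.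
Qed.

Lemma next_down j p : j < m -> ~~ nth true (level B L) p -> Defs.next D (L + j.+1, p) = (L + j, p).
Proof.
move=> hj u; have lm := level_mid hj.
have hb := block_nth hj.
rewrite /Defs.next lm (negPf u) addnS /= layer_mid // (nth_map (0, Cup true)) //.
move: (nth (0, Cup true) E j) hb => [i x] /=; rewrite /block_layer /= => hb.
have np a : a < n -> p <> q + a by move=> han ep; move: u; rewrite ep strands_up.
case: ifP => // h1; case: ifP => h2.
  by congr pair; move: hb h2; case: x => //= [s|k]; rewrite ?size_nseq; lia.
have := np (p - q); rewrite subnKC; last by lia.
case: x hb h2 => //= [s|k] hb; rewrite ?size_nseq => h2; move=> H; exfalso; apply: H => //; lia.
Qed.

Definition trivial_perm := forall a, a < n -> foldl lstep a E = a.
Hypothesis permE : trivial_perm.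
Hypothesis goodB : perm_eq (traversal B) (points B).

Definition firstx (x : point) := if lowfirst x then x else raise x.
Definition lastx (x : point) := if lowlast x then x else raise x.
(** Points of the block visited after the first copy of [x]. *)
Definition restx (x : point) : seq point :=
  if x.1 == L then
    if up B x then [seq (L + j.+1, pos j.+1 x.2) | j <- iota 0 m]
    else [seq (L + (m - j.+1), x.2) | j <- iota 0 m]
  else [::].

Lemma pos0 p : pos 0 p = p.
Proof. by rewrite /pos take0 /=; case: ifP => // /andP[h _]; rewrite subnKC. Qed.
Lemma pos_last p : pos m p = p.
Proof.
by rewrite /pos take_size; case: ifP => // /andP[h1 h2]; rewrite permE ?subnKC; lia.
Qed.

Lemma fpath_iota (T : eqType) (f : T -> T) (g : nat -> T) k l :
  (forall j, k <= j < k + l -> f (g j) = g j.+1) ->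
  fpath f (g k) [seq g j.+1 | j <- iota k l] /\ last (g k) [seq g j.+1 | j <- iota k l] = g (k + l).
Proof.
elim: l k => [|l IH] k H /=; first by rewrite addn0.
rewrite H ?eqxx ?leqnn ?addnS ?ltnS ?leq_addr //=.
by rewrite -addSn; apply: IH => j hj; apply: H; lia.
Qed.

Lemma restP x : fpath (Defs.next D) (firstx x) (restx x) /\ last (firstx x) (restx x) = lastx x.
Proof.
rewrite /restx /firstx /lastx /lowfirst /lowlast; case: (x.1 =P L) => [e|_]; last first.
  by rewrite /= !orbF; case: ifP.
rewrite e ltnn /=; case: ifP => u /=.
  have ex : x = (L + 0, pos 0 x.2) by rewrite pos0 addn0 -e; case: (x).
  have [|h1 h2] := @fpath_iota _ (Defs.next D) (fun j => (L + j, pos j x.2)) 0 m.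
    by move=> j /andP[_ hj]; apply: next_up => //; move: u; rewrite /up e.
  by rewrite {1 3}ex h1 h2 add0n pos_last /raise e.
have ex : raise x = (L + (m - 0), x.2) by rewrite subn0 /raise e.
have [|h1 h2] := @fpath_iota _ (Defs.next D) (fun j => (L + (m - j), x.2)) 0 m.
  move=> j /andP[_ hj]; have -> : m - j = (m - j.+1).+1 by lia.
  by apply: next_down; [lia | move: u; rewrite /up e => ->].
by rewrite ex h1 h2 add0n subnn addn0 -e; case: (x).
Qed.

Lemma next_lastx x : x \in points B -> x != (size B, 0) -> Defs.next D (lastx x) = firstx (Defs.next B x).
Proof.
move=> px xE; rewrite /lastx /firstx -lowlast_next //; case: ifP => h; first exact: next_lowlast.
apply: next_high; last by rewrite h.
by move: h; rewrite /lowlast; case: ltngtP.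
Qed.

(** The points visited in the new diagram while the old traversal is at [x]. *)
Definition expand x := firstx x :: restx x.
Definition full := flatten [seq expand x | x <- traversal B].

Lemma expand_path x s : fpath (Defs.next B) x s -> uniq (x :: s) -> {subset x :: s <= points B} ->
  fpath (Defs.next D) (firstx x) (restx x ++ flatten [seq expand y | y <- s]).
Proof.
elim: s x => [|y s IH] x; first by rewrite /= cats0; have [] := restP x.
rewrite [fpath _ x _]/= => /andP[/eqP xy ps] us sub.
rewrite /= cat_path; have [-> ->] := restP x; rewrite /= next_lastx ?xy.
- rewrite eqxx /=; apply: IH => //; first by case/andP: us.
  by move=> z hz; apply: sub; rewrite inE hz orbT.
- by apply: sub; rewrite inE eqxx.
apply/eqP => xe; move: us; rewrite /= inE -xy xe next_end // eqxx; done.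
Qed.

Lemma size_points_sum (F : diagram) : size (points F) = \sum_(h <- iota 0 (size F).+1) size (level F h).
Proof.
rewrite /points size_allpairs_dep sumnE big_map; apply: eq_bigr => h _; exact: size_iota.
Qed.

(** Both count the points of all levels; the level of the block is repeated
   [m] more times. *)
Lemma size_full : size full = size (points D).
Proof.
rewrite /full size_flatten /shape -map_comp sumnE big_map (perm_big _ goodB) /=.
rewrite size_points_sum size_insert.
have szE x : (size (restx x)).+1 = if x.1 == L then m.+1 else 1.
  by rewrite /restx; case: ifP => //; case: ifP => _ _; rewrite size_map size_iota.
under eq_bigr do rewrite szE.
have iotaS : (size B + m).+1 = L + (m.+1 + size (above U)) by rewrite /base size_cat; lia.
have iotaB : (size B).+1 = L + (1 + size (above U)) by rewrite /base size_cat; lia.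
rewrite /points big_allpairs_dep iotaS iotaB !iotaD !big_cat add0n /= big_seq1.
have cst (h c : nat) : \sum_(j <- iota 0 h) c = h * c by rewrite big_const_seq count_predT size_iota iter_addn_0 mulnC.
congr (_ + (_ + _)).
- apply: eq_big_seq => h; rewrite mem_iota add0n /= => hh.
  by rewrite cst ltn_eqF // muln1 level_low // ltnW.
- rewrite cst eqxx mulnC.
  rewrite (eq_big_seq (fun=> size (level B L))); last first.
    move=> h; rewrite -[L :: _]/(iota L m.+1) mem_iota => hh.
    by have -> : h = L + (h - L); [lia | rewrite level_mid //; lia].
  by rewrite -[L :: _]/(iota L m.+1) big_const_seq count_predT size_iota iter_addn_0 mulnC.
rewrite addn1 [L + m.+1]addnS -addSn addnC iotaDl big_map.
apply: eq_big_seq => h; rewrite mem_iota => hh.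
have h1 : L < h by lia.
by rewrite cst (gtn_eqF h1) muln1 addnC level_high // ltnW.
Qed.

Lemma points_full : {subset points D <= full}.
Proof.
move=> [h p]; rewrite mem_points size_insert /= => /andP[h1 hp].
have inexp x y : x \in points B -> y \in expand x -> y \in full.
  by move=> px yx; apply/flatten_mapP; exists x => //; rewrite (perm_mem goodB).
case: (ltnP h L) => hL.
  apply: (inexp (h, p)); first by rewrite mem_points /= -level_low ?hp ?(ltnW hL) ?(leq_trans (ltnW hL)) ?L_le.
  by rewrite /expand /firstx /lowfirst /= hL inE eqxx.
case: (ltnP (L + m) h) => hm.
  have e : h = h - m + m by lia.
  apply: (inexp (h - m, p)).
    by rewrite mem_points /= -level_high; [rewrite -e hp; lia | lia].
  rewrite /expand /firstx /lowfirst /= ltnNge gtn_eqF; last lia.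
  have -> : L <= h - m by lia.
  by rewrite /= inE /raise /= -e eqxx.
have ej : h = L + (h - L) by lia.
have hj : h - L <= m by lia.
move: hp; rewrite ej level_mid // => hp; set j := h - L in hj *.
have restm x y k : x.1 = L -> k < m -> y = nth y (restx x) k -> y \in expand x.
  move=> xL km ->; rewrite inE mem_nth ?orbT // /restx xL eqxx.
  by case: ifP; rewrite size_map size_iota.
have inL r : r < size (level B L) -> (L, r) \in points B by rewrite mem_points /= L_le.
case u : (nth true (level B L) p); last first.
  apply: (inexp (L, p)); first exact: inL.
  rewrite /expand /firstx /lowfirst /restx /= eqxx ltnn /up /= u /= inE.
  case: (eqVneq j m) => [->|jm]; first by rewrite /raise /= eqxx.
  apply/orP; right; apply/mapP; exists (m - j.+1); first by rewrite mem_iota; lia.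
  by congr (_, _); lia.
have [r [hr ur er]] : exists r, [/\ r < size (level B L), nth true (level B L) r & pos j r = p].
  have [hb|hb] := boolP (q <= p < q + n); last by exists p; rewrite /pos (negPf hb).
  have bt : all (block_layer n) (rev (take j E)).
    by rewrite all_rev block_take.
  have ra := foldl_lstep_lt bt (_ : p - q < n).
  have {}ra := ra ltac:(lia).
  exists (q + foldl lstep (p - q) (rev (take j E))); split.
  - by have := strands_size; lia.
  - by rewrite strands_up.
  - by rewrite /pos leq_addr ltn_add2l ra /= addKn foldl_lstepK subnKC //; lia.
apply: (inexp (L, r)); first exact: inL.
rewrite /expand /firstx /lowfirst /restx /= eqxx ltnn /up /= ur /= inE.
case: (posnP j) => [j0|j0]; first by rewrite -er j0 pos0 addn0 eqxx.
apply/orP; right; apply/mapP; exists j.-1; first by rewrite mem_iota; lia.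
by rewrite prednK // er.
Qed.

(** If the block permutes its strands trivially, the new traversal is the
   old one with every point replaced by its expansion; it has the same length
   as the list of all points and contains them all. *)
Lemma good_insert : perm_eq (traversal D) (points D).
Proof.
have wfD := wf_insert.
have pf : perm_eq full (points D).
  have uf : uniq full.
    by apply: (leq_size_uniq (uniq_points D) points_full); rewrite size_full.
  have [_ eq] := uniq_min_size (uniq_points D) points_full (eq_leq size_full).
  by apply: uniq_perm => //; exact: uniq_points.
suff -> : traversal D = full by [].
have [k Ek] : exists k, size (points B) = k.+1.
  by exists (size (points B)).-1; case: (points B) (O_point B).
have tB : traversal B = (0, 0) :: traject (Defs.next B) (Defs.next B (0, 0)) k by rewrite /traversal Ek.
have fO : firstx (0, 0) = (0, 0).
  by rewrite /firstx /lowfirst /= /up /= level0 /= andbT; case: L.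
have uB := uniq_traversal goodB; have sB := mem_traversal goodB.
have sub : {subset traversal B <= points B} by move=> x; rewrite sB.
rewrite tB in uB sub.
have := expand_path (fpath_traject _ _ _) uB sub; rewrite fO => /fpathP [l El].
have Ef : full = traject (Defs.next D) (0, 0) l.+1 by rewrite /full tB /= /expand fO -El.
rewrite Ef /traversal; congr traject; rewrite -(size_full).
by rewrite Ef size_traject.
Qed.

End Insert.

Local Open Scope ring_scope.

(** * The transition matrix of a block as a list of matrices *)

Lemma pred_above l a : (l < a)%N -> (l + (a - l).-1 = a.-1)%N.
Proof. lia. Qed.

Definition weights := nat -> nat -> ZT.
Definition layer_weights (l : layer) : weights := fun a b =>
  if (l.1 <= a < l.1 + ports l.2)%N then
    if (l.1 <= b < l.1 + ports l.2)%N then node_weight l.2 (a - l.1) (b - l.1) else 0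
  else (b == a)%:R.

Section Model.
Variables (U : region) (n : nat).
Notation L := (size (below U)).
Notation q := (offset U).
Notation B := (base U).
Definition oU (p : nat) : bool := nth true (level B L) p.

Definition in_block (p : nat) : bool := (q <= p < q + n)%N.
Definition block_weights (W : weights) : weights := fun p p' =>
  if in_block p then (if in_block p' then W (p - q)%N (p' - q)%N else 0) else (p' == p)%:R.

(** Point weights of a diagram whose block is replaced by a stack of
   arbitrary matrices of weights, one for each layer.  The matrices need not
   come from braids, which allows merging layers and passing to the limit. *)
Definition model_weight (Ws : seq weights) (x y : point) : ZT :=
  let m := size Ws in
  if ((x.1 < L) || (x.1 == L) && ~~ oU x.2)%N then
    if (y.1 <= L)%N then point_weight B x y else 0
  else if ((L + m < x.1) || (x.1 == L + m) && oU x.2)%N then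
    if (L + m <= y.1)%N then point_weight B (x.1 - m, x.2)%N (y.1 - m, y.2)%N else 0
  else if oU x.2 then
    if (y.1 == x.1.+1)%N then block_weights (nth (fun _ _ => 0) Ws (x.1 - L)) x.2 y.2 else 0
  else (y == (x.1.-1, x.2))%:R.

(** The level line of the block is repeated between its layers. *)
Definition model_level (m h : nat) : seq bool :=
  level B (if (h <= L)%N then h else maxn L (h - m)).
Definition model_points (m : nat) : seq point :=
  [seq (h, p) | h <- iota 0 (size B + m).+1, p <- iota 0 (size (model_level m h))].
Definition modelM (Ws : seq weights) (x y : point) : ZT := (x == y)%:R - model_weight Ws x y.

Lemma mem_model_points m x :
  (x \in model_points m) = (x.1 <= size B + m)%N && (x.2 < size (model_level m x.1))%N.
Proof.
case: x => h p /=; apply/allpairsPdep/idP.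
  by move=> [h' [p' []]]; rewrite !mem_iota !add0n /= => h1 h2 [-> ->]; rewrite -ltnS h1.
by move=> /andP[h1 h2]; exists h, p; split => //; rewrite mem_iota.
Qed.
Lemma uniq_model_points m : uniq (model_points m).
Proof.
rewrite /model_points; apply: allpairs_uniq_dep; rewrite ?iota_uniq //.
  by move=> *; apply: iota_uniq.
by move=> [h p] [h' p'] _ _ /= [-> ->].
Qed.

Hypothesis wfB : well_formed B.
Hypothesis n_gt0 : (0 < n)%N.
Hypothesis strandsU : take n (drop q (level B L)) = nseq n true.

Lemma oU_block p : in_block p -> oU p.
Proof.
by rewrite /in_block /oU => /andP[h1 h2]; rewrite -(subnKC h1) (strands_up strandsU) // ltn_subLR.
Qed.

Section Insert.
Variable E : diagram.
Hypothesis blockE : all (block_layer n) E.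
Notation D := (insert U E).
Notation m := (size E).

Lemma points_insert : points D = model_points m.
Proof.
rewrite /points /model_points size_insert.
have e h : h \in iota 0 (size B + m).+1 -> level D h = model_level m h.
  move=> _; rewrite /model_level; case: leqP => h1; first exact: level_low.
  case: (leqP h (L + m)) => h2.
    rewrite (maxn_idPl _); last by lia.
    by rewrite -(subnKC (ltnW h1)) (level_mid wfB n_gt0 strandsU blockE) //; lia.
  rewrite (maxn_idPr _); last by lia.
  have h3 : (L <= h - m)%N by lia.
  have {1}-> : h = (h - m + m)%N by lia.
  exact: (level_high wfB n_gt0 strandsU blockE).
by congr flatten; apply/eq_in_map => h hh; rewrite e.
Qed.

Lemma enters_low x : x \in points D -> lowlast U x -> enters_node D x = enters_node B x.
Proof.
have wfD := wf_insert wfB n_gt0 strandsU blockE.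
rewrite /lowlast => px /orP[h1|/andP[/eqP h1 d]].
  rewrite /enters_node /is_node /lpos layer_low // size_insert.
  have := L_le U; case: x px h1 => h p /= _ h1 h2.
  have -> : (h < size B + m)%N by lia.
  by have -> : (h < size B)%N by lia.
have -> : enters_node B x = false by apply/negP => /(enters_up wfB); apply/negP.
apply/negP => /(enters_up wfD); rewrite /up h1 level_low // -/(up _ _).
by move: d; rewrite /up h1 => /negPf ->.
Qed.

Lemma point_weight_low x y : x \in points D -> lowlast U x ->
  point_weight D x y = if (y.1 <= L)%N then point_weight B x y else 0.
Proof.
move=> px lx; have xL : (x.1 <= L)%N by case/orP: (lx) => [/ltnW|/andP[/eqP -> _]].
have px' : x \in points B.
  by move: px; rewrite !mem_points (level_low _ xL) => /andP[_ ->]; rewrite (leq_trans xL (L_le U)).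
have nB : x != (size B, 0%N).
  apply/eqP => e; move: lx; rewrite e /lowlast /= ltnNge L_le /= /up /= level_end //= andbF.
  by [].
have nD : x != (size D, 0%N).
  apply/eqP => e; have e1 : size B = L /\ m = 0%N.
    by move: xL; rewrite e size_insert /=; have := L_le U; lia.
  by move: nB; rewrite e size_insert e1.2 addn0 eqxx.
rewrite /point_weight (negPf nB) (negPf nD) enters_low //.
case: ifP => ex.
  have x1 : (x.1 < L)%N.
    by move: lx; rewrite /lowlast (enters_up wfB ex) andbF orbF.
  rewrite /lpos layer_low //.
  by case: (y.1 =P x.1.+1) => [->|_] /=; [rewrite x1 | case: ifP].
rewrite (next_lowlast wfB n_gt0 blockE) //; case: ifP => // y1; case: eqP => // e.
have := lowlast_next wfB n_gt0 blockE px' nB; rewrite lx -e /lowfirst.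
by have := y1; case: ltngtP.
Qed.

Lemma point_weight_high x y : (L <= x.1)%N -> ~~ lowlast U x -> x \in points B ->
  point_weight D (raise E x) y = if (L + m <= y.1)%N then point_weight B x (y.1 - m, y.2)%N else 0.
Proof.
move=> xL lx px.
have eE : (raise E x == (size D, 0%N)) = (x == (size B, 0%N)).
  by case: x {xL lx px} => h p; rewrite /raise size_insert !xpair_eqE /= eqn_add2r.
have en : enters_node D (raise E x) = enters_node B x.
  by rewrite /enters_node /is_node /lpos /raise /= size_insert ltn_add2r layer_high.
rewrite /point_weight eE en (next_high wfB n_gt0 strandsU blockE) // /lpos layer_high //=.
case: (enters_node B x).
  case: (leqP (L + m) y.1) => y1.
    by have -> : (y.1 == (x.1 + m).+1)%N = (y.1 - m == x.1.+1)%N by apply/eqP/eqP; lia.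
  by rewrite ifF //; apply/negP => /and3P[/eqP e _ _]; lia.
case: eqP => [_|/eqP nB]; first by case: ifP.
have lf : ~~ lowfirst U (Defs.next B x) by rewrite -(lowlast_next wfB n_gt0 blockE px nB).
have nL : (L <= (Defs.next B x).1)%N by move: lf; rewrite /lowfirst; case: ltngtP.
case: (leqP (L + m) y.1) => y1.
  case: y y1 => h p /= y1; rewrite /raise; case: (Defs.next B x) => h' p' /=.
  rewrite !xpair_eqE; have -> : (h == h' + m)%N = (h - m == h')%N by apply/eqP/eqP; lia.
  by [].
by case: eqP => // e; move: y1; rewrite e /raise /=; lia.
Qed.

Lemma point_weight_up j p y : (j < m)%N -> (L + j, p)%N \in points D -> oU p ->
  point_weight D (L + j, p)%N y
  = if (y.1 == (L + j).+1)%N then block_weights (layer_weights (nth (0%N, Cup true) E j)) p y.2 else 0.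
Proof.
move=> hj px u; have wfD := wf_insert wfB n_gt0 strandsU blockE.
have lm := level_mid wfB n_gt0 strandsU blockE (ltnW hj).
have hD : (L + j < size D)%N by rewrite size_insert; have := L_le U; lia.
have la : layer_at D (L + j) = ((q + (nth (0, Cup true) E j).1)%N, (nth (0%N, Cup true) E j).2).
  by rewrite layer_mid // (nth_map (0%N, Cup true)).
have hb := block_nth blockE hj.
have ux : up D (L + j, p)%N by rewrite /up /= lm.
have lp : lpos D (L + j) = (q + (nth (0, Cup true) E j).1)%N by rewrite /lpos la.
have nE : ((L + j, p)%N == (size D, 0%N)) = false by apply/eqP => -[e _]; lia.
rewrite /point_weight /enters_node /is_node hD /lpos la nE /=.
have nu := next_up_left hD _ ux; have nr := next_up_right (p := p - (lpos D (L + j) + size (bottom_side (layer_at D (L + j)).2))) wfD hD.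
rewrite lp la /= in nu nr.
move: (nth (0%N, Cup true) E j) hb nu nr => [i e] /=; rewrite /block_layer /= => hb nu nr.
have [kn ebs ets hk] : [/\ (if e is Crossing _ then true else if e is TwistVertex _ then true else false),
   size (bottom_side e) = ports e, size (top_side e) = ports e & (i + ports e <= n)%N].
  by move: hb; case: (e) => //= k; rewrite size_nseq.
have -> : match e with Crossing _ | TwistVertex _ => true | _ => false end = true.
  by move: kn; case: (e).
rewrite ebs ets /= in nr *; rewrite /block_weights /layer_weights /=.
case: ifP => hp.
  case: (y.1 =P _) => [e1|_] //=; rewrite /in_block.
  have -> : (q <= p < q + n)%N by clear -hp hk; lia.
  have -> : (i <= p - q < i + ports e)%N by clear -hp; lia.
  case: ifP => hy.
    have -> : (q <= y.2 < q + n)%N by clear -hy hk; lia.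
    have -> : (i <= y.2 - q < i + ports e)%N by clear -hy; lia.
    by congr node_weight; clear; lia.
  by case: ifP => // hy'; case: ifP => // hy''; clear -hy hy' hy''; lia.
have nx : Defs.next D (L + j, p)%N = ((L + j).+1, p).
  case: (ltnP p (q + i)) => h1; first exact: nu.
  have h2 : (q + i + ports e <= p)%N by lia.
  by rewrite !subnKC // in nr; apply: nr.
rewrite nx; case: y => h p'; rewrite xpair_eqE /=; case: (h =P _) => //= _.
case: ifP => hb1 //; case: ifP => hb2; last by case: eqP => // e1; move: hb2; rewrite e1 hb1.
move: hb1 hb2; rewrite /in_block => hb1 hb2; rewrite ifF; last by clear -hp hb1; lia.
have -> : (p' - q == p - q)%N = (p' == p); last by [].
by clear -hb1 hb2; apply/eqP/eqP; lia.
Qed.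

Lemma point_weight_down j p y : (j < m)%N -> ~~ oU p ->
  point_weight D (L + j.+1, p)%N y = (y == (L + j, p)%N)%:R.
Proof.
move=> hj u; have wfD := wf_insert wfB n_gt0 strandsU blockE.
have lm := level_mid wfB n_gt0 strandsU blockE hj.
have d : ~~ up D (L + j.+1, p)%N by rewrite /up /= lm.
rewrite /point_weight ifF; last by apply/negP => /(enters_up wfD); apply/negP.
rewrite ifF; last first.
  by apply/eqP => e; move: d; rewrite e /up /= level_end.
by rewrite (next_down wfB n_gt0 strandsU blockE).
Qed.

(** Below and above the block the weights are those of the base diagram, up
   to a shift of the levels. *)
Lemma point_weight_insert x y : x \in points D ->
  point_weight D x y = model_weight (map layer_weights E) x y.
Proof.
move=> px; rewrite /model_weight size_map.
have lE : ((x.1 < L) || (x.1 == L) && ~~ oU x.2)%N = lowlast U x.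
  by rewrite /lowlast /up; case: (ltngtP x.1 L) => //= ->.
rewrite lE; case: ifP => lx; first exact: point_weight_low.
have xL : (L <= x.1)%N by move: lx; rewrite /lowlast; case: ltngtP.
case: ifP => hx.
  have x1 : (L + m <= x.1)%N by move: hx; case: ltngtP.
  have ex : x = raise E (x.1 - m, x.2)%N.
    by case: (x) x1 => h p /= h1; rewrite /raise /= subnK //; lia.
  rewrite {1}ex point_weight_high //=; first by lia.
    rewrite /lowlast /up /=; move: hx; case: (ltngtP (L + m) x.1) x1 => //= [h1 _ _|h1 _ u].
      by rewrite ltnNge gtn_eqF; lia.
    by rewrite -h1 addnK ltnn eqxx negbK.
  have xm : (L <= x.1 - m)%N by lia.
  have := px; rewrite {1}ex !mem_points /raise /= (level_high wfB n_gt0 strandsU blockE xm).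
  by rewrite size_insert leq_add2r.
have ex : x = (L + (x.1 - L), x.2)%N by rewrite subnKC //; case: (x).
case: ifP => u.
  have hj : (x.1 - L < m)%N by move: hx; rewrite u andbT ltn_subLR //; case: ltngtP.
  rewrite {1}ex point_weight_up //; last by rewrite -ex.
  by rewrite subnKC // (nth_map (0%N, Cup true)).
have x0 : (L < x.1)%N by move: lx; rewrite -lE u andbT; case: ltngtP.
have hj : (x.1 - L).-1.+1 = (x.1 - L)%N by lia.
have hjm : ((x.1 - L).-1 < m)%N.
  by rewrite hj leq_subLR; move: hx; rewrite u andbF orbF ltnNge => /negbFE.
rewrite {1}ex -hj point_weight_down ?u //.
by rewrite (pred_above x0).
Qed.

Lemma pointM_insert : {in points D &, pointM D =2 modelM (map layer_weights E)}.
Proof. by move=> x y px py; rewrite /pointM /modelM point_weight_insert. Qed.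

Lemma sdet_insert : sdet (points D) (pointM D) = sdet (model_points m) (modelM (map layer_weights E)).
Proof. by rewrite (eq_sdet pointM_insert) points_insert. Qed.
Lemma sadj_insert x y : sadj (points D) (pointM D) x y
  = sadj (model_points m) (modelM (map layer_weights E)) x y.
Proof. by rewrite (eq_sadj x y pointM_insert) points_insert. Qed.

End Insert.
End Model.

(** * Merging consecutive layers of a block *)

Section Merge.
Variables (U : region) (n : nat).
Notation L := (size (below U)).
Notation q := (offset U).
Notation B := (base U).
Notation oU := (oU U).
Notation mw := (model_weight U n).
Notation pts := (model_points U).
Hypothesis strandsU : take n (drop q (level B L)) = nseq n true.
Hypothesis sizeU : (q + n <= size (level B L))%N.

Definition wcomp (X Y : weights) : weights := fun a b => \sum_(c < n) X a c * Y c b.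

(** A walker inside the block stays on upward strands. *)
Lemma block_up (W : weights) p p' : oU p -> block_weights U n W p p' != 0 -> oU p'.
Proof.
rewrite /block_weights; case: ifP => hp op.
  by case: ifP => [hp' _|_]; [apply: (oU_block strandsU) | rewrite eqxx].
by case: (p' =P p) => [-> //|_]; rewrite eqxx.
Qed.

Lemma block_comp (X Y : weights) p p' : (p < size (level B L))%N ->
  \sum_(r <- iota 0 (size (level B L))) block_weights U n X p r * block_weights U n Y r p'
  = block_weights U n (wcomp X Y) p p'.
Proof.
move=> hp; case ep : (in_block U n p); last first.
  rewrite (bigD1_seq p) ?mem_iota ?iota_uniq //= big1 ?addr0; last first.
    by move=> r /negPf nr; rewrite /block_weights ep nr mul0r.
  by rewrite /block_weights ep eqxx mul1r.
have -> : size (level B L) = (q + (n + (size (level B L) - (q + n))))%N by rewrite addnA subnKC.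
rewrite !iotaD !big_cat /= !add0n big1_seq ?add0r; last first.
  move=> r; rewrite mem_iota /= add0n => hr; rewrite {1}/block_weights ep ifF ?mul0r //.
  by rewrite /in_block; lia.
rewrite [X in _ + X]big1_seq ?addr0; last first.
  move=> r; rewrite mem_iota /= => hr; rewrite {1}/block_weights ep ifF ?mul0r //.
  by rewrite /in_block; lia.
rewrite -[X in iota X]addn0 iotaDl big_map.
have inb c : (c < n)%N -> in_block U n (q + c) by move=> hc; rewrite /in_block leq_addr ltn_add2l.
case ep' : (in_block U n p'); last first.
  rewrite {3}/block_weights ep ep' big1_seq // => c; rewrite mem_iota add0n /= => hc.
  by rewrite [X in _ * X]/block_weights ep' inb // mulr0.
rewrite {3}/block_weights ep ep' /wcomp -(big_mkord xpredT (fun c => X (p - q)%N c * Y c (p' - q)%N)).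
rewrite /index_iota subn0; apply: eq_big_seq => c; rewrite mem_iota add0n /= => hc.
by rewrite /block_weights ep ep' !inb // addKn.
Qed.

Section Step.
Variables (Ws1 Ws2 : seq weights) (X Y : weights).
Notation Ws := (Ws1 ++ X :: Y :: Ws2).
Notation Ws' := (Ws1 ++ wcomp X Y :: Ws2).
Notation a1 := (size Ws1).
Notation m := (size Ws).
Notation m' := (size Ws').
Let c := (L + a1).+1.
(** Renumbering of the levels after inserting the level [c]. *)
Definition skip (x : point) : point := (bump c x.1, x.2).
Let K : seq point := [seq (c, p) | p <- iota 0 (size (level B L))].

Lemma mS : m = m'.+1.
Proof. by rewrite !size_cat /= !addnS. Qed.
Lemma c_le : (L < c <= L + m')%N.
Proof. by rewrite size_cat /= /c; lia. Qed.

Lemma skip_inj : injective skip.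
Proof. by move=> [h p] [h' p'] [/(can_inj (bumpK c)) -> ->]. Qed.
Lemma skip_notin x : skip x \notin K.
Proof. by apply/mapP => -[p _ [e _]]; have := neq_bump c x.1; rewrite e eqxx. Qed.

Lemma mw_c p y : mw Ws (c, p) y = if oU p then
   (if y.1 == c.+1 then block_weights U n Y p y.2 else 0) else (y == ((L + a1)%N, p))%:R.
Proof.
rewrite /model_weight /= mS; have := c_le => /andP[h1 h2].
rewrite ifF; last by rewrite gtn_eqF //; lia.
rewrite ifF; last by rewrite ltn_eqF /= ?orbF; lia.
have -> : (c - L = a1.+1)%N by rewrite /c; lia.
by rewrite nth_cat ltnNge leqnSn /= subSnn.
Qed.

Lemma mw_to_c x p : (x.1 < L)%N || (x.1 == L) && ~~ oU x.2 || (L + m < x.1)%N || (x.1 == L + m)%N && oU x.2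
  -> mw Ws x (c, p) = 0.
Proof.
have := c_le => /andP[h1 h2]; have := mS => h3.
rewrite /model_weight /=; case: ifP => _ h.
  by rewrite ifF //; lia.
rewrite ifT; last by move: h; case: ltngtP => //=; lia.
by rewrite ifF //; lia.
Qed.

(** From a point outside the level between [X] and [Y] the walker reaches
   another one directly or through that level; in the block this gives the
   product of both matrices, and on a downward strand two steps instead of one. *)
Lemma merge_weight u v : u \in pts m' -> mw Ws' u v
  = mw Ws (skip u) (skip v) + \sum_(l <- K) mw Ws (skip u) l * mw Ws l (skip v).
Proof.
case: u => h p; case: v => h' p' pu; have := c_le => /andP[cl1 cl2]; have mS' := mS.
have [low|nlow] := boolP ((h < L)%N || (h == L) && ~~ oU p).
  have hc : (h < c)%N by lia.
  have sb : bump c h = h by rewrite /bump leqNgt hc.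
  rewrite big_map big1 ?addr0; last first.
    by move=> r _; rewrite mw_to_c ?mul0r //= sb low.
  rewrite /model_weight /= sb low; have -> : (bump c h' <= L)%N = (h' <= L)%N by rewrite /bump; lia.
  by case: ifP => // h1; congr point_weight; rewrite /skip /= /bump; congr pair; lia.
have [high|nhigh] := boolP ((L + m' < h)%N || (h == L + m')%N && oU p).
  have hc : (c <= h)%N by lia.
  have sb : bump c h = h.+1 by rewrite /bump hc.
  rewrite big_map big1 ?addr0; last first.
    by move=> r _; rewrite mw_to_c ?mul0r //= sb mS'; lia.
  have e1 : ((h.+1 < L) || (h.+1 == L) && ~~ oU p)%N = false by lia.
  have e2 : ((L + m < h.+1) || (h.+1 == L + m) && oU p)%N by rewrite mS'; lia.
  rewrite /model_weight /= sb (negPf nlow) high e1 e2.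
  have -> : (L + m <= bump c h')%N = (L + m' <= h')%N by rewrite mS' /bump; lia.
  by case: ifP => // h1; congr point_weight; congr pair; rewrite mS' ?subSS /bump; lia.
have hL : (L <= h <= L + m')%N by lia.
have hp : (p < size (level B L))%N.
  move: pu; rewrite mem_model_points /= => /andP[_]; rewrite /model_level.
  by have -> : (if (h <= L)%N then h else maxn L (h - m')) = L by case: (leqP h L); lia.
case up : (oU p).
  have hm : (h < L + m')%N by move: nhigh hL; rewrite up; lia.
  have lhs w : mw Ws' (h, p) w = if w.1 == h.+1 then block_weights U n (nth (fun _ _ => 0) Ws' (h - L)) p w.2 else 0.
    by rewrite /model_weight /= (negPf nlow) (negPf nhigh) up.
  have midE g w : (L <= g)%N -> (g < L + m)%N -> mw Ws (g, p) w
     = if w.1 == g.+1 then block_weights U n (nth (fun _ _ => 0) Ws (g - L)) p w.2 else 0.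
    move=> g1 g2; rewrite /model_weight /= up andbF andbT orbF ifF; last by lia.
    by rewrite ifF //; lia.
  rewrite lhs /=; case: (ltngtP h (L + a1)) => ha.
  - have sb : bump c h = h by rewrite /bump /c; lia.
    rewrite /skip /= sb midE; try lia.
    rewrite big_map big1 ?addr0; last first.
      by move=> r _; rewrite midE /=; try lia; rewrite ifF ?mul0r //; rewrite /c; lia.
    have -> : (bump c h' == h.+1) = (h' == h.+1) by rewrite /bump /c; lia.
    by rewrite /= !nth_cat; have -> : (h - L < a1)%N by lia.
  - have sb : bump c h = h.+1 by rewrite /bump /c; lia.
    rewrite /skip /= sb midE; try lia.
    rewrite big_map big1 ?addr0; last first.
      by move=> r _; rewrite midE /=; try lia; rewrite ifF ?mul0r //; rewrite /c; lia.
    have -> : (bump c h' == h.+2) = (h' == h.+1) by rewrite /bump /c; lia.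
    rewrite /= !nth_cat; have -> : (h - L < a1)%N = false by lia.
    have -> : (h.+1 - L < a1)%N = false by lia.
    have [k ek] : exists k, (h - L - a1 = k.+1)%N by exists (h - L - a1).-1; lia.
    rewrite ek; by have -> : (h.+1 - L - a1 = k.+2)%N by lia.
  have sb : bump c h = h by rewrite /bump /c; lia.
  have hc : h.+1 = c by rewrite /c; lia.
  rewrite /skip /= sb midE; try lia.
  rewrite hc [bump c h' == c]eq_sym (negPf (neq_bump c h')) add0r big_map.
  rewrite nth_cat ha addKn ltnn subnn /=.
  have -> : (h' == c) = (bump c h' == c.+1) by rewrite /bump; lia.
  rewrite -(block_comp _ _ _ hp).
  transitivity (\sum_(r <- iota 0 (size (level B L)))
     if bump c h' == c.+1 then block_weights U n X p r * block_weights U n Y r p' else 0).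
    by case: ifP => // _; rewrite big1.
  apply: eq_bigr => r _; rewrite mw_c midE; try lia.
  rewrite /= eqxx nth_cat addKn ltnn subnn /=.
  have [-> |nz] := eqVneq (block_weights U n X p r) 0; first by rewrite !mul0r; case: ifP.
  by rewrite (block_up up nz); case: ifP => //; rewrite mulr0.
have hl : (L < h)%N by move: nlow hL; rewrite up; lia.
have lhs w : mw Ws' (h, p) w = (w == (h.-1, p))%:R.
  by rewrite /model_weight /= (negPf nlow) (negPf nhigh) up.
have midE g w : (L < g)%N -> (g <= L + m)%N -> mw Ws (g, p) w = (w == (g.-1, p))%:R.
  move=> g1 g2; rewrite /model_weight /= up andbF orbF andbT ifF; last by lia.
  by rewrite ifF //; lia.
rewrite lhs !xpair_eqE /=; case: (ltngtP h c) => ha.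
- have sb : bump c h = h by rewrite /bump; lia.
  rewrite /skip /= sb midE; try lia.
  rewrite big_map big1 ?addr0; last first.
    by move=> r _; rewrite midE; try lia; rewrite xpair_eqE gtn_eqF ?mul0r //; lia.
  by rewrite xpair_eqE /=; have -> : (bump c h' == h.-1) = (h' == h.-1) by rewrite /bump; lia.
- have sb : bump c h = h.+1 by rewrite /bump; lia.
  rewrite /skip /= sb midE; try lia.
  rewrite big_map big1 ?addr0; last first.
    by move=> r _; rewrite midE; try lia; rewrite xpair_eqE ltn_eqF ?mul0r //; lia.
  by rewrite xpair_eqE /=; have -> : (bump c h' == h) = (h' == h.-1) by rewrite /bump; lia.
have sb : bump c h = c.+1 by rewrite /bump; lia.
rewrite /skip /= sb midE; try lia.
rewrite xpair_eqE /= [bump c h' == c]eq_sym (negPf (neq_bump c h')) add0r big_map.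
rewrite (bigD1_seq p) ?mem_iota ?iota_uniq //= big1 ?addr0; last first.
  by move=> r nr; rewrite midE; try lia; rewrite xpair_eqE (negPf nr) andbF mul0r.
rewrite midE; try lia.
rewrite mw_c up eqxx mul1r xpair_eqE /=.
by have -> : (bump c h' == (L + a1)%N) = (h' == h.-1) by rewrite /bump /c; lia.
Qed.

Lemma model_level_skip h : model_level U m (bump c h) = model_level U m' h.
Proof.
have := c_le => /andP[cl1 cl2]; have mS' := mS; rewrite /model_level; congr (level B _).
rewrite mS' /bump; case: (leqP c h) => hc /=; rewrite ?add0n ?add1n.
  by case: (leqP h.+1 L) => h1; case: (leqP h L) => h2; lia.
by case: (leqP h L) => h2; lia.
Qed.

Lemma perm_skip : perm_eq (pts m) (map skip (pts m') ++ K).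
Proof.
have := c_le => /andP[cl1 cl2]; have mS' := mS; have LB := L_le U.
apply: uniq_perm; first exact: uniq_model_points.
  rewrite cat_uniq map_inj_uniq ?uniq_model_points; last exact: skip_inj.
  apply/and3P; split => //; last by rewrite map_inj_uniq ?iota_uniq // => ? ? [].
  by apply/hasPn => x xK; apply/negP => /mapP[y _ e]; have := skip_notin y; rewrite -e xK.
move=> [h p]; rewrite [RHS]mem_cat [LHS]mem_model_points /=; case: (eqVneq h c) => [->|hc].
  have -> : ((c, p) \in map skip (pts m')) = false.
    by apply/negP => /mapP[[h' p'] _ [e _]]; have := neq_bump c h'; rewrite -e eqxx.
  rewrite /= mem_map ?mem_iota ?add0n /model_level; last by move=> ? ? [].
  have -> : (if (c <= L)%N then c else maxn L (c - m)) = L by rewrite mS'; case: (leqP c L); lia.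
  by have -> : (c <= size B + m)%N by rewrite mS'; lia.
have -> : ((h, p) \in K) = false by apply/negP => /mapP[r _ [e _]]; rewrite e eqxx in hc.
have eh : h = bump c (unbump c h) by rewrite unbumpKcond (negPf hc) add0n.
have -> : (h, p) = skip (unbump c h, p) by rewrite /skip /= -eh.
rewrite orbF (mem_map skip_inj) mem_model_points /= {2}eh model_level_skip; congr (_ && _).
by rewrite mS' /unbump; lia.
Qed.

Lemma modelM_skip u v : u \in pts m' -> modelM U n Ws (skip u) (skip v)
  + \sum_(l <- K) modelM U n Ws (skip u) l * mw Ws l (skip v) = modelM U n Ws' u v.
Proof.
move=> pu; rewrite /modelM (merge_weight _ pu) (inj_eq skip_inj).
rewrite opprD addrA -sumrN; congr (_ + _); rewrite big_seq [RHS]big_seq; apply: eq_bigr => l lK.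
have -> : (skip u == l) = false by apply/negP => /eqP e; have := skip_notin u; rewrite e lK.
by rewrite sub0r mulNr.
Qed.

Lemma mw_K k l : k \in K -> l \in K -> mw Ws k l = 0.
Proof.
move=> /mapP[p _ ->] /mapP[p' _ ->]; rewrite mw_c /= ltn_eqF // xpair_eqE /c gtn_eqF //.
by case: ifP.
Qed.

Lemma elim_K k j : k \in K -> j \in map skip (pts m') ->
  modelM U n Ws k j + \sum_(l <- K) modelM U n Ws k l * mw Ws l j = 0.
Proof.
move=> kK /mapP[u _ ->]; have uK : uniq K by rewrite map_inj_uniq ?iota_uniq // => ? ? [].
rewrite (bigD1_seq k) //= big_seq_cond big1 ?addr0; last first.
  by move=> l /andP[lK nl]; rewrite /modelM mw_K // eq_sym (negPf nl) subrr mul0r.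
rewrite /modelM (mw_K kK kK) eqxx subr0 mul1r.
have -> : (k == skip u) = false by apply/negP => /eqP e; have := skip_notin u; rewrite -e kK.
by rewrite sub0r addNr.
Qed.

(** No transition joins two points of the eliminated level. *)
Lemma sdet_skipped : sdet K (modelM U n Ws) = 1.
Proof.
apply: sdet0_rank; first by rewrite map_inj_uniq ?iota_uniq // => ? ? [].
by move=> x y xK yK; rewrite /modelM mw_K // subr0.
Qed.

(** Eliminating the points of the level between two layers replaces both
   matrices by their product. *)
Lemma sdet_merge : sdet (pts m) (modelM U n Ws) = sdet (pts m') (modelM U n Ws').
Proof.
rewrite (sdet_perm _ perm_skip) (sdet_elim elim_K) sdet_skipped mulr1 sdet_map.
by apply: eq_sdet => u v pu _; apply: modelM_skip.
Qed.
Lemma sadj_merge u v : sadj (pts m) (modelM U n Ws) (skip u) (skip v)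
  = sadj (pts m') (modelM U n Ws') u v.
Proof.
rewrite (sadj_perm _ _ _ perm_skip) (sadj_elim (skip_notin u) (skip_notin v) elim_K) sdet_skipped mulr1.
rewrite sadj_map; last by move=> ? ? _ _; apply: skip_inj.
by apply: eq_sadj => x y px _; apply: modelM_skip.
Qed.
End Step.
End Merge.

(** * Reduction of powers of the full twist *)

(** The expression of the crossing term through determinants of a matrix
   indexed by points. *)
Definition R1_at (s : seq point) (M : point -> point -> ZT) (i j j' : point) (sg : int) : ZT :=
  sg%:~R * (sadj s M j i * (sadj s M j' j + sadj s M j j' - sadj s M i j)
    - sadj s M i i * (sadj s M j j' - sdet s M) - 1 / 2%:R * sdet s M ^+ 2).
(** The expression of the turning term of a cup or a cap, with [c] the sign
   of its half turn. *)
Definition turn_at (s : seq point) (M : point -> point -> ZT) (x : point) (c : ZT) : ZT :=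
  c / 2%:R * (sadj s M x x * sdet s M - sdet s M ^+ 2 / 2%:R).

Lemma R1_tilde_points D h : well_formed D -> perm_eq (traversal D) (points D) -> is_crossing D h ->
  R1_tilde D h = R1_at (points D) (pointM D) (over_enter D h) (under_enter D h) (under_leave D h) (csign D h).
Proof.
move=> wf good ch; have c := crossingP wf good ch.
have A x y : x \in points D -> y \in points D -> (x == y) || (strand D x != strand D y) ->
  \adj (1%:M - transition D) (strand D x) (strand D y) = sadj (points D) (pointM D) x y.
  exact: adj_points.
have ne x y : snum D x <> snum D y -> strand D x != strand D y.
  by move=> nxy; rewrite strand_eq; apply/eqP.
have [pi pj _ pj' _ _ _ sj nij _ _ _] := c.
have nij' : snum D (under_enter D h) <> snum D (over_enter D h) by exact: nesym.
have nj : snum D (under_leave D h) <> snum D (under_enter D h) by rewrite sj; lia.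
have nj' : snum D (under_enter D h) <> snum D (under_leave D h) by exact: nesym.
rewrite /R1_tilde /R1_at (det_points wf good).
rewrite -(A _ _ pj pi) ?ne ?orbT // -(A _ _ pj' pj) ?ne ?orbT // -(A _ _ pj pj') ?ne ?orbT //.
by rewrite -(A _ _ pi pj) ?ne ?orbT // -(A _ _ pi pi) ?eqxx.
Qed.

(** Renumbering of the levels after inserting [k] levels at [c]. *)
Definition skipn (k c : nat) (x : point) : point := (if (c <= x.1)%N then (x.1 + k)%N else x.1, x.2).

(** A constant coefficient 1 makes the sum of powers invertible as a power
   series. *)
Lemma tausum_lead n : (0 < n)%N ->
  tausum T n = tofrac (\sum_(j < n) 'X^j) /\ (\sum_(j < n) 'X^j : {poly int})`_0 = 1.
Proof.
move=> n_gt0; split; first by rewrite /tausum rmorph_sum; apply: eq_bigr => j _; rewrite /= tofracXn.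
rewrite coef_sum (bigD1 (Ordinal n_gt0)) //= coefXn eqxx big1 ?addr0 // => i ni.
rewrite coefXn; case: eqP => // e; case/eqP: ni; apply: val_inj => /=; by rewrite -e.
Qed.
Lemma tausum_neq0 n : (0 < n)%N -> tausum T n != 0.
Proof.
move=> /tausum_lead[-> c]; rewrite tofrac_eq0; apply/eqP => e.
by move: c; rewrite e coef0.
Qed.

Section Reduce.
Variables (U : region) (n : nat).
Notation L := (size (below U)).
Notation q := (offset U).
Notation B := (base U).
Notation mw := (model_weight U n).
Notation pts := (model_points U).
Hypothesis strandsU : take n (drop q (level B L)) = nseq n true.
Hypothesis sizeU : (q + n <= size (level B L))%N.
Notation mdet Ws := (sdet (pts (size Ws)) (modelM U n Ws)).
Notation madj Ws := (sadj (pts (size Ws)) (modelM U n Ws)).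

Lemma merge_list rest X Ws1 Ws2 :
  mdet (Ws1 ++ X :: rest ++ Ws2) = mdet (Ws1 ++ foldl (wcomp n) X rest :: Ws2) /\
  forall u v, madj (Ws1 ++ X :: rest ++ Ws2) (skipn (size rest) (L + size Ws1).+1 u)
       (skipn (size rest) (L + size Ws1).+1 v)
     = madj (Ws1 ++ foldl (wcomp n) X rest :: Ws2) u v.
Proof.
elim: rest X => [|Y rest IH] X.
  have s0 c u : skipn 0 c u = u by case: u => h p; rewrite /skipn /= addn0; case: ifP.
  by split; [exact: erefl | move=> u v; rewrite !s0].
have [E1 E2] := IH (wcomp n X Y); rewrite /= -E1; split; first exact: sdet_merge.
move=> u v; rewrite -E2 -(sadj_merge strandsU sizeU).
have sk x : skipn (size rest).+1 (L + size Ws1).+1 x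
     = skip U Ws1 (skipn (size rest) (L + size Ws1).+1 x).
  rewrite /skip /skipn /bump /=; congr pair; case: (leqP (L + size Ws1).+1 x.1) => h.
    by rewrite (leq_trans h (leq_addr _ _)) addnS.
  by rewrite leqNgt h.
by rewrite !sk.
Qed.

Definition weq (W W' : weights) : Prop := forall a b, (a < n)%N -> (b < n)%N -> W a b = W' a b.

Lemma block_weq W W' p p' : weq W W' -> block_weights U n W p p' = block_weights U n W' p p'.
Proof.
move=> e; rewrite /block_weights /in_block; case: ifP => // h1; case: ifP => // h2.
by apply: e; lia.
Qed.
Lemma model_weq W W' Ws1 Ws2 x y : weq W W' ->
  mw (Ws1 ++ W :: Ws2) x y = mw (Ws1 ++ W' :: Ws2) x y.
Proof.
move=> e; rewrite /model_weight !size_cat /=; do 3![case: ifP => // _]; case: ifP => // _.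
by rewrite !nth_cat; case: ifP => // _; case: (_ - size Ws1)%N => //= ; apply: block_weq.
Qed.
Lemma mdet_weq W W' Ws1 Ws2 : weq W W' -> mdet (Ws1 ++ W :: Ws2) = mdet (Ws1 ++ W' :: Ws2).
Proof.
move=> e; rewrite !size_cat; apply: eq_sdet => x y _ _; rewrite /modelM (model_weq _ _ _ _ e).
by [].
Qed.
Lemma madj_weq W W' Ws1 Ws2 x y : weq W W' -> madj (Ws1 ++ W :: Ws2) x y = madj (Ws1 ++ W' :: Ws2) x y.
Proof.
move=> e; rewrite !size_cat; apply: eq_sadj => u v _ _; rewrite /modelM (model_weq _ _ _ _ e).
by [].
Qed.

Definition wapp (W : weights) (f : nat -> ZT) (a : nat) : ZT := \sum_(c < n) W a c * f c.

Lemma wapp_comp X Y f a : wapp (wcomp n X Y) f a = wapp X (wapp Y f) a.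
Proof.
rewrite /wapp; under eq_bigr do rewrite mulr_suml.
rewrite exchange_big; apply: eq_bigr => c _; rewrite mulr_sumr.
by apply: eq_bigr => d _; rewrite mulrA.
Qed.
Lemma wapp_delta W a b : (b < n)%N -> wapp W (fun c => (c == b)%:R) a = W a b.
Proof.
move=> hb; rewrite /wapp (bigD1 (Ordinal hb)) //= eqxx mulr1 big1 ?addr0 // => c nc.
by rewrite -[b]/(nat_of_ord (Ordinal hb)) (inj_eq val_inj) (negPf nc) mulr0.
Qed.
Lemma eq_wapp W f g a : (forall c, (c < n)%N -> f c = g c) -> wapp W f a = wapp W g a.
Proof. by move=> e; apply: eq_bigr => c _; rewrite e. Qed.

(** The weights of a crossing act on functions as the Burau matrix. *)
Lemma wapp_crossing i f a : (i.+1 < n)%N -> (a < n)%N ->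
  wapp (layer_weights (i, Crossing true)) f a = burau_step T (true, i) f a.
Proof.
move=> hi ha; have dl b : (b < n)%N -> \sum_(c < n) (c == b :> nat)%:R * f c = f b.
  move=> hb; rewrite (bigD1 (Ordinal hb)) //= eqxx mul1r big1 ?addr0 // => c nc.
  by rewrite -[b]/(nat_of_ord (Ordinal hb)) (inj_eq val_inj) (negPf nc) mul0r.
rewrite /wapp /layer_weights /burau_step /= /crossing_weight /= expr1z.
case: (a =P i) => [->|na].
  have -> : (i <= i < i + 2)%N by lia.
  rewrite subnn /= -(dl i) ?(ltnW hi) // -(dl i.+1) // !mulr_sumr -big_split /=.
  apply: eq_bigr => c _.
  have -> : (i <= c < i + 2)%N = (c == i :> nat) || (c == i.+1 :> nat) by lia.
  case: (c =P i :> nat) => [->|nc]; first by rewrite subnn (ltn_eqF (ltnSn i)) /=; ring.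
  case: (c =P i.+1 :> nat) => [->|nc']; last by rewrite /=; ring.
  by rewrite /= subSnn /=; ring.
case: (a =P i.+1) => [->|na'].
  have -> : (i <= i.+1 < i + 2)%N by lia.
  rewrite subSnn /= -(dl i) ?(ltnW hi) //; apply: eq_bigr => c _; congr (_ * _).
  by case: ifP => h; [congr (_%:R); congr nat_of_bool; apply/eqP/eqP; lia | case: eqP => //; lia].
have -> : (i <= a < i + 2)%N = false by lia.
by rewrite dl.
Qed.

Lemma wapp_crossings w X f a : all (fun i => i.+1 < n)%N w ->
  wapp (foldl (wcomp n) X (map layer_weights (braid_diagram w))) f a
  = wapp X (burau T (braid_word w) f) a.
Proof.
elim: w X a => //= i w IH X a /andP[hi hw]; rewrite IH // wapp_comp; apply: eq_wapp => c hc.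
by rewrite wapp_crossing.
Qed.

Definition limit_weights : weights := vertex_weight n.
(** Matrix of [k] full twists, as computed by [burau_twist_pow]. *)
Definition twist_weights (k : nat) : weights := fun a b =>
  vertex_weight n a b + (T ^+ n) ^+ k * ((a == b)%:R - vertex_weight n a b).

Variable w : seq nat.
Hypothesis tw : full_twist n w.
Hypothesis n_gt1 : (1 < n)%N.

Definition Wtw : seq weights := map layer_weights (braid_diagram w).
Notation N := (size w).

Lemma size_Wtw : size Wtw = N.
Proof. by rewrite !size_map. Qed.
Lemma N_gt0 : (0 < N)%N.
Proof. rewrite (full_twist_size tw); nia. Qed.

(** Merging leaves one matrix, unless there is nothing to merge. *)
Definition twist_list (k : nat) : seq weights := if k == 0%N then [::] else [:: twist_weights k].
Lemma size_twist_list k : size (twist_list k) = (k != 0%N).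
Proof. by case: k. Qed.

Lemma twist_block k : (0 < k)%N -> exists X rest, flatten (nseq k Wtw) = X :: rest /\
  weq (foldl (wcomp n) X rest) (twist_weights k).
Proof.
move=> k0; have [hw _] := tw.
have E : flatten (nseq k Wtw) = map layer_weights (braid_diagram (flatten (nseq k w))).
  by rewrite /braid_diagram !map_flatten !map_nseq.
have hk : all (fun i => i.+1 < n)%N (flatten (nseq k w)).
  by elim: (k) => //= j IH; rewrite all_cat hw.
case Ek : (flatten (nseq k w)) => [|i v].
  have := congr1 size Ek; rewrite size_flatten /shape map_nseq sumn_nseq /=.
  have := N_gt0; nia.
rewrite E Ek /=; exists (layer_weights (i, Crossing true)), (map layer_weights (braid_diagram v)).
split => // a b ha hb.
move: hk; rewrite Ek /= => /andP[hi hv].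
rewrite -(wapp_delta _ _ hb) wapp_crossings // wapp_crossing //.
have := burau_twist_pow T_neq0 (ltnW n_gt1) (tausum_neq0 (ltnW n_gt1)) k (fun c => (c == b)%:R) tw ha.
rewrite Ek /= => ->.
have -> : taumean T n (fun c => (c == b)%:R) = vertex_weight n a b.
  rewrite /taumean /vertex_weight; congr (_ / _).
  rewrite (bigD1 (Ordinal hb)) //= eqxx mulr1 big1 ?addr0 // => c nc.
  by rewrite -[b]/(nat_of_ord (Ordinal hb)) (inj_eq val_inj) (negPf nc) mulr0.
by rewrite /twist_weights.
Qed.

Lemma skipn0 c u : skipn 0 c u = u.
Proof. by case: u => h p; rewrite /skipn /= addn0; case: ifP. Qed.

(** The number of levels of the model does not depend on [k] any more, so
   that models of different twisted diagrams can be compared entry by entry. *)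
Lemma reduce_at k Ws1 Ws2 :
  mdet (Ws1 ++ flatten (nseq k Wtw) ++ Ws2) = mdet (Ws1 ++ twist_list k ++ Ws2) /\
  forall u v, madj (Ws1 ++ flatten (nseq k Wtw) ++ Ws2)
       (skipn (k * N - (k != 0%N)) (L + size Ws1).+1 u) (skipn (k * N - (k != 0%N)) (L + size Ws1).+1 v)
     = madj (Ws1 ++ twist_list k ++ Ws2) u v.
Proof.
have [|k0] := leqP k 0.
  by rewrite leqn0 => /eqP ->; split; [exact: erefl | move=> u v; rewrite mul0n !skipn0].
have [X [rest [E We]]] := twist_block k0.
have sr : (k * N - (k != 0%N))%N = size rest.
  have := congr1 size E; rewrite size_flatten /shape map_nseq sumn_nseq size_Wtw /= => es.
  by rewrite mulnC es -lt0n k0 subn1.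
rewrite sr E /twist_list (gtn_eqF k0) cat_cons /=; have [E1 E2] := merge_list rest X Ws1 Ws2.
split; first by rewrite E1; apply: mdet_weq.
by move=> u v; rewrite E2; apply: madj_weq.
Qed.

End Reduce.

(** * The bracket of a twisted diagram *)

Lemma sum_blocks (V : zmodType) (F : nat -> V) t N :
  \sum_(j < t * N) F j = \sum_(s < t) \sum_(k < N) F (s * N + k)%N.
Proof.
elim: t => [|t IH]; first by rewrite mul0n !big_ord0.
rewrite big_ord_recr /= -IH mulSnr big_split_ord /=; congr (_ + _).
Qed.

Section Family.
Variables (U : region) (n : nat) (w : seq nat).
Notation L := (size (below U)).
Notation q := (offset U).
Notation B := (base U).
Notation N := (size w).
Notation pts := (model_points U).
Notation Wtw := (Wtw w).
Notation twist_list := (twist_list n).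

Hypothesis knotB : long_knot B.
Hypothesis strandsU : take n (drop q (level B L)) = nseq n true.
Hypothesis tw : full_twist n w.
Hypothesis n_gt1 : (1 < n)%N.

Definition twisted (t : nat) : diagram := insert U (braid_diagram (flatten (nseq t w))).

Let wfB : well_formed B. Proof. by case: knotB. Qed.
Let goodB : perm_eq (traversal B) (points B). Proof. by case: knotB. Qed.
Let n_gt0 : (0 < n)%N. Proof. exact: ltnW. Qed.
Let sizeU : (q + n <= size (level B L))%N. Proof. exact: (@strands_size U n [::] wfB n_gt0 strandsU isT). Qed.

Lemma no_vertex_base h k : (layer_at B h).2 <> TwistVertex k.
Proof.
case: knotB => _ _ H; rewrite /layer_at; case: (ltnP h (size B)) => hh; last by rewrite nth_default.
by have /= := all_nthP (0%N, Cup true) H h hh; case: (_.2).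
Qed.

Lemma twist_indices t : all (fun i => i.+1 < n)%N (flatten (nseq t w)).
Proof. by case: tw => hw _; elim: t => //= t IH; rewrite all_cat hw. Qed.

Lemma braid_block v : all (fun i => i.+1 < n)%N v -> all (block_layer n) (braid_diagram v).
Proof. by rewrite all_map; apply: sub_all => i /=; rewrite /block_layer /= addn2. Qed.

Lemma braid_perm v a : foldl lstep a (braid_diagram v) = wperm v a.
Proof. by elim: v a => //= i v IH a; rewrite IH. Qed.

Lemma wperm_pow t a : (a < n)%N -> wperm (flatten (nseq t w)) a = a.
Proof.
move=> ha; elim: t => //= t IH; rewrite /wperm foldl_cat -/(wperm w a) (full_twist_perm tw) //.
Qed.

Lemma wf_twisted t : well_formed (twisted t).
Proof. exact: (wf_insert wfB n_gt0 strandsU (braid_block (twist_indices t))). Qed.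
Lemma good_twisted t : perm_eq (traversal (twisted t)) (points (twisted t)).
Proof.
apply: (good_insert wfB n_gt0 strandsU (braid_block (twist_indices t))) => // a ha.
by rewrite braid_perm wperm_pow.
Qed.
Lemma size_pow t : size (flatten (nseq t w)) = (t * N)%N.
Proof. by rewrite size_flatten /shape map_nseq sumn_nseq mulnC. Qed.
Lemma size_braid v : size (braid_diagram v) = size v.
Proof. by rewrite size_map. Qed.
Lemma size_twisted t : size (twisted t) = (size B + t * N)%N.
Proof. by rewrite /twisted size_insert size_braid size_pow. Qed.

Lemma layer_twisted_mid t j : (j < t * N)%N ->
  layer_at (twisted t) (L + j) = ((q + nth 0 (flatten (nseq t w)) j)%N, Crossing true).
Proof.
move=> hj; rewrite layer_mid ?size_braid ?size_pow // /shiftE -map_comp.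
by rewrite (nth_map 0%N) ?size_pow.
Qed.
Lemma no_vertex_twisted t h k : (layer_at (twisted t) h).2 <> TwistVertex k.
Proof.
case: (ltnP h L) => h1; first by rewrite layer_low //; apply: no_vertex_base.
case: (ltnP h (L + t * N)) => h2.
  by rewrite -(subnKC h1) layer_twisted_mid //; lia.
have -> : h = (h - t * N + size (braid_diagram (flatten (nseq t w))))%N.
  by rewrite size_braid size_pow; lia.
by rewrite layer_high; [apply: no_vertex_base | lia].
Qed.
Lemma nth_pow t s k : (s < t)%N -> (k < N)%N -> nth 0%N (flatten (nseq t w)) (s * N + k) = nth 0%N w k.
Proof.
elim: s t => [|s IH] [|t] //= st kN; first by rewrite mul0n add0n nth_cat kN.
rewrite nth_cat mulSn ifF; last by lia.
by rewrite -addnA addKn IH.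
Qed.

Definition model_R1 (Ws : seq weights) := R1_at (pts (size Ws)) (modelM U n Ws).
Definition model_turn (Ws : seq weights) := turn_at (pts (size Ws)) (modelM U n Ws).

Lemma model_R1_reduce k Ws1 Ws2 i j j' sg :
  let sk := skipn (k * N - (k != 0%N)) (L + size Ws1).+1 in
  model_R1 (Ws1 ++ flatten (nseq k Wtw) ++ Ws2) (sk i) (sk j) (sk j') sg
  = model_R1 (Ws1 ++ twist_list k ++ Ws2) i j j' sg.
Proof.
have [E1 E2] := reduce_at strandsU sizeU tw n_gt1 k Ws1 Ws2.
by rewrite /model_R1 /R1_at E1 !E2.
Qed.
Lemma model_turn_reduce k Ws1 Ws2 x c :
  let sk := skipn (k * N - (k != 0%N)) (L + size Ws1).+1 in
  model_turn (Ws1 ++ flatten (nseq k Wtw) ++ Ws2) (sk x) c = model_turn (Ws1 ++ twist_list k ++ Ws2) x c.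
Proof.
have [E1 E2] := reduce_at strandsU sizeU tw n_gt1 k Ws1 Ws2.
by rewrite /model_turn /turn_at E1 !E2.
Qed.

Lemma weights_pow t : map layer_weights (braid_diagram (flatten (nseq t w))) = flatten (nseq t Wtw).
Proof. by rewrite /braid_diagram !map_flatten !map_nseq. Qed.

Lemma R1_twisted t h s : is_crossing (twisted t) h -> is_positive (twisted t) h = s ->
  R1_tilde (twisted t) h = model_R1 (flatten (nseq t Wtw))
    (h, lpos (twisted t) h + ~~ s)%N (h, lpos (twisted t) h + s)%N
    (h.+1, lpos (twisted t) h + ~~ s)%N (if s then 1 else -1).
Proof.
move=> ch ps; rewrite (R1_tilde_points (wf_twisted t) (good_twisted t) ch).
have bl := braid_block (twist_indices t).
rewrite /R1_at /model_R1 /R1_at !(sdet_insert wfB n_gt0 strandsU bl) !(sadj_insert wfB n_gt0 strandsU bl).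
by rewrite -weights_pow size_map /over_enter /under_enter /under_leave /csign ps.
Qed.

(** Contribution of the crossing [k] of a full twist that has [a] full twists
   below it and [b] above it.  The twists below and above are merged, and only
   the middle one keeps its crossings. *)
Definition mid_term (a b k : nat) : ZT :=
  let h := (L + size (twist_list a) + k)%N in let p := (q + nth 0%N w k)%N in
  model_R1 (twist_list a ++ Wtw ++ twist_list b) (h, p) (h, p.+1) (h.+1, p) 1.

(** Merging does not change the adjugate entries at the remaining points,
   so both stacks of twists around the middle one can be merged in turn. *)
Lemma R1_mid a b k : (k < N)%N -> R1_tilde (twisted (a + b).+1) (L + a * N + k) = mid_term a b k.
Proof.
move=> kN; have hj : (a * N + k < (a + b).+1 * N)%N by nia.
have la := layer_twisted_mid hj; rewrite nth_pow ?ltnS ?leq_addr // in la.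
rewrite -addnA (R1_twisted (s := true)); first last.
- by rewrite /is_positive la.
- by rewrite /is_crossing la.
rewrite /lpos la /= addn0 addn1.
have -> : Wtw ++ flatten (nseq (a + b) Wtw) = [::] ++ flatten (nseq a Wtw) ++ (Wtw ++ flatten (nseq b Wtw)).
  by rewrite -[LHS]/(flatten (nseq (a + b).+1 Wtw)) -addnS nseqD flatten_cat.
have sk j p : (j <= N)%N -> ((L + (a * N + j))%N, p)
    = skipn (a * N - (a != 0%N)) (L + size ([::] : seq weights)).+1 ((L + size (twist_list a) + j)%N, p).
  move=> hjN; rewrite /skipn size_twist_list /= addn0; congr pair; case: (a) => [|a'].
    by rewrite /= mul0n sub0n !addn0; case: ifP.
  rewrite /= ifT; last by lia.
  by have := N_gt0 sizeU tw n_gt1; nia.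
set h := (L + size (twist_list a) + k)%N; set p := (q + nth 0%N w k)%N.
have e1 (p' : nat) := sk k p' (ltnW kN); have e2 (p' : nat) := sk k.+1 p' kN.
rewrite -!addnS !e1 e2 (model_R1_reduce a [::] (Wtw ++ flatten (nseq b Wtw))) /=.
have sk2 j p' : (j <= N)%N -> ((L + size (twist_list a) + j)%N, p')
    = skipn (b * N - (b != 0%N)) (L + size (twist_list a ++ Wtw)).+1 ((L + size (twist_list a) + j)%N, p').
  by move=> hjN; rewrite /skipn /= ifF // size_cat size_Wtw; lia.
have := model_R1_reduce b (twist_list a ++ Wtw) [::] (h, p) (h, p.+1) (h.+1, p) 1.
have hS : h.+1 = (L + size (twist_list a) + k.+1)%N by rewrite addnS.
rewrite [(q + (nth 0 w k).+1)%N]addnS hS /h -!sk2 ?(ltnW kN) // !cats0 -!catA => ->.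
by rewrite /mid_term -hS.
Qed.

(** The same contribution between two infinite twist vertices. *)
Definition mid_limit (k : nat) : ZT :=
  let h := (L + 1 + k)%N in let p := (q + nth 0%N w k)%N in
  model_R1 (limit_weights n :: Wtw ++ [:: limit_weights n]) (h, p) (h, p.+1) (h.+1, p) 1.

Lemma R1_infty k : (k < N)%N -> R1_tilde (D_infty n U w) (tau_crossing U k) = mid_limit k.
Proof.
move=> kN; set E := (0%N, TwistVertex n) :: braid_diagram w ++ [:: (0%N, TwistVertex n)].
have hw : all (fun i => i.+1 < n)%N w by case: tw.
have bl : all (block_layer n) E.
  by rewrite /E /= all_cat braid_block //= /block_layer /= add0n leqnn.
have wfD : well_formed (D_infty n U w) := wf_insert wfB n_gt0 strandsU bl.
have goodD : perm_eq (traversal (D_infty n U w)) (points (D_infty n U w)).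
  apply: (good_insert wfB n_gt0 strandsU bl) => // a ha.
  by rewrite /E /= foldl_cat /= /lstep /= -/lstep braid_perm (full_twist_perm tw).
have hk : (k.+1 < size E)%N by rewrite /E /= size_cat size_map /= addn1 !ltnS ltnW.
have la : layer_at (D_infty n U w) (tau_crossing U k) = ((q + nth 0 w k)%N, Crossing true).
  rewrite /tau_crossing -addnA add1n (layer_mid _ hk) /shiftE (nth_map (0%N, Cup true)) //=.
  by rewrite nth_cat size_map kN (nth_map 0%N).
rewrite (R1_tilde_points wfD goodD); last by rewrite /is_crossing la.
rewrite /over_enter /under_enter /under_leave /midb /midt /csign /is_positive /lpos la /= addn0 addn1.
rewrite /R1_at !(sdet_insert wfB n_gt0 strandsU bl) !(sadj_insert wfB n_gt0 strandsU bl).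
have eP : weq n (layer_weights (0%N, TwistVertex n)) (limit_weights n).
  by move=> a b ha hb; rewrite /layer_weights /= add0n ha hb !subn0.
have EW : map layer_weights E = [::] ++ layer_weights (0%N, TwistVertex n) :: Wtw ++ [:: layer_weights (0%N, TwistVertex n)].
  by rewrite /E /= map_cat.
have D1 := mdet_weq sizeU [::] (Wtw ++ [:: layer_weights (0%N, TwistVertex n)]) eP.
have D2 := mdet_weq sizeU ([::] ++ limit_weights n :: Wtw) [::] eP.
have A1 x y := madj_weq sizeU [::] (Wtw ++ [:: layer_weights (0%N, TwistVertex n)]) x y eP.
have A2 x y := madj_weq sizeU ([::] ++ limit_weights n :: Wtw) [::] x y eP.
rewrite -!catA /= in D1 D2 A1 A2.
have sE : size E = size (map layer_weights E) by rewrite size_map.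
rewrite sE EW /= /mid_limit /model_R1 /R1_at /tau_crossing.
by rewrite D1 D2 !A1 !A2.
Qed.

(** Contribution of a layer of the base diagram outside the twist region, all
   twists being merged into one block with the matrix [W]; [bump] skips the
   layer of the block. *)
Definition outer_term (W : weights) (h : nat) : ZT :=
  let l := bump L h in let p := lpos B h in
  match (layer_at B h).2 with
  | Crossing s => model_R1 [:: W] (l, p + ~~ s)%N (l, p + s)%N (l.+1, p + ~~ s)%N (if s then 1 else -1)
  | Cup b => - model_turn [:: W] (l.+1, p) (if b then -1 else 1)
  | Cap b => - model_turn [:: W] (l, p) (if b then -1 else 1)
  | TwistVertex _ => 0
  end.

Definition layer_term (D : diagram) (h : nat) : ZT :=
  (if is_crossing D h then R1_tilde D h else 0) - turn_term D h.

Lemma turn_twisted t x c : x \in points (twisted t) ->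
  c / 2%:R * (\adj (1%:M - transition (twisted t)) (strand (twisted t) x) (strand (twisted t) x)
     * \det (1%:M - transition (twisted t)) - \det (1%:M - transition (twisted t)) ^+ 2 / 2%:R)
  = model_turn (flatten (nseq t Wtw)) x c.
Proof.
move=> px; rewrite (adj_points (wf_twisted t) (good_twisted t)) ?eqxx // (det_points (wf_twisted t) (good_twisted t)).
have bl := braid_block (twist_indices t).
rewrite /model_turn /turn_at !(sdet_insert wfB n_gt0 strandsU bl) !(sadj_insert wfB n_gt0 strandsU bl).
by rewrite -weights_pow size_map.
Qed.

Lemma layer_term_outer t h : (0 < t)%N -> (h < size B)%N ->
  layer_term (twisted t) (if (h < L)%N then h else (h + t * N)%N) = outer_term (twist_weights n t) h.
Proof.
move=> t0 hB; set g := if _ then _ else _.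
have la : layer_at (twisted t) g = layer_at B h.
  rewrite /g; case: ltnP => hL; first exact: layer_low.
  by rewrite -size_pow -size_braid layer_high.
have gD : (g < size (twisted t))%N by rewrite size_twisted /g; case: ifP => _; lia.
have lp : lpos (twisted t) g = lpos B h by rewrite /lpos la.
have Nt : (0 < t * N)%N by have := N_gt0 sizeU tw n_gt1; nia.
have tn0 : (t != 0%N) = true by rewrite -lt0n.
have sk1 p : (g, p) = skipn (t * N - (t != 0%N)) (L + size ([::] : seq weights)).+1 (bump L h, p).
  rewrite tn0 /skipn /g /bump /= addn0; congr pair; case: (ltnP h L) => hL /=.
    by rewrite add0n ifF //; lia.
  by rewrite add1n ltnS hL; lia.
have sk2 p : (g.+1, p) = skipn (t * N - (t != 0%N)) (L + size ([::] : seq weights)).+1 ((bump L h).+1, p).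
  rewrite tn0 /skipn /g /bump /= addn0; congr pair; case: (ltnP h L) => hL /=.
    by rewrite add0n ifF //; lia.
  by rewrite add1n ifT; lia.
have Ef : flatten (nseq t Wtw) = [::] ++ flatten (nseq t Wtw) ++ [::] by rewrite cats0.
have lowt : [::] ++ twist_list t ++ [::] = [:: twist_weights n t] by rewrite /@twist_list (gtn_eqF t0).
rewrite /layer_term /outer_term /turn_term /is_crossing la lp.
case e : (layer_at B h).2 => [s|b|b|k]; last by case: (no_vertex_base e).
- have pos : is_positive (twisted t) g = s by rewrite /is_positive la e.
  rewrite subr0 (R1_twisted _ pos); last by rewrite /is_crossing la e.
  by rewrite lp Ef !sk1 sk2 model_R1_reduce lowt.
- rewrite sub0r turn_twisted; last first.
    have := size_bot (wf_twisted t) gD; have := size_levelS (wf_twisted t) gD; rewrite la e lp /= => h1 h2.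
    by rewrite mem_points /= gD /=; lia.
  by rewrite Ef sk2 model_turn_reduce lowt.
rewrite sub0r turn_twisted; last first.
  have := size_bot (wf_twisted t) gD; rewrite la e lp /= => h1.
  by rewrite mem_points /= ltnW //=; lia.
by rewrite Ef sk1 model_turn_reduce lowt.
Qed.

Lemma layer_term_mid t j : (j < t * N)%N -> layer_term (twisted t) (L + j) = R1_tilde (twisted t) (L + j).
Proof.
move=> hj; have la := layer_twisted_mid hj.
by rewrite /layer_term /is_crossing /turn_term la subr0.
Qed.

(** The crossings of the t full twists are sorted by the number s of full
   twists below them.  For a fixed crossing, t enters only through the
   matrices of the merged twists, from which convergence is read off. *)
Lemma bracket_twisted t : (0 < t)%N -> rho_bracket (twisted t)
  = \sum_(h < size B) outer_term (twist_weights n t) h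
    + \sum_(s < t) \sum_(k < N) mid_term s (t.-1 - s) k.
Proof.
move=> t0; have -> : rho_bracket (twisted t) = \sum_(h < size (twisted t)) layer_term (twisted t) h.
  by rewrite /rho_bracket [X in X - _]big_mkcond -sumrB.
have sB : size B = (L + size (above U))%N by rewrite size_cat.
have sD : size (twisted t) = (L + (t * N + size (above U)))%N by rewrite size_twisted sB; lia.
rewrite sD sB !big_split_ord /= addrA -!addrA; congr (_ + _).
  apply: eq_bigr => h _; rewrite -layer_term_outer //; first by rewrite ltn_ord.
  by rewrite sB; have := ltn_ord h; lia.
rewrite addrC; congr (_ + _).
  apply: eq_bigr => h _; rewrite -layer_term_outer //; last by rewrite sB ltn_add2l.
  by rewrite ltnNge leq_addr /=; congr layer_term; lia.
transitivity (\sum_(j < t * N) R1_tilde (twisted t) (L + j)).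
  by apply: eq_bigr => j _; apply: layer_term_mid.
rewrite (sum_blocks (fun j => R1_tilde (twisted t) (L + j)%N)); apply: eq_bigr => s _; apply: eq_bigr => k _.
have st : t = (s + (t.-1 - s)).+1 by have := ltn_ord s; lia.
by rewrite addnA {1}st R1_mid.
Qed.

End Family.

(** * Continuity in the T-adic order *)

(** [f] and [g] have poles of order at most [S] at T = 0 and agree up to
   order [e - S].  The loss [S] adds up under products, so a polynomial in the
   matrix entries loses a bounded order, independent of [e]. *)
Definition near (S : nat) (e : int) (f g : ZT) : Prop :=
  [/\ Vge (- S%:Z) f, Vge (- S%:Z) g & Vge (e - S%:Z) (f - g)].

Lemma near_leq S S' e f g : (S <= S')%N -> near S e f g -> near S' e f g.
Proof.
by move=> h [vf vg vd]; split; [apply: Vge_leq vf | apply: Vge_leq vg | apply: Vge_leq vd]; lia.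
Qed.
Lemma near_refl S e f : Vge (- S%:Z) f -> near S e f f.
Proof. by move=> v; split=> //; rewrite subrr; apply: Vge0. Qed.
Lemma nearD S e f g f' g' : near S e f g -> near S e f' g' -> near S e (f + f') (g + g').
Proof.
move=> [a b c] [a' b' c']; split; [exact: VgeD | exact: VgeD |].
by rewrite opprD addrACA; apply: VgeD.
Qed.
Lemma nearN S e f g : near S e f g -> near S e (- f) (- g).
Proof. by move=> [a b c]; split; rewrite -?opprD; apply: VgeN. Qed.
Lemma nearB S e f g f' g' : near S e f g -> near S e f' g' -> near S e (f - f') (g - g').
Proof. by move=> h h'; apply: nearD => //; apply: nearN. Qed.
Lemma nearM S S' e f g f' g' : near S e f g -> near S' e f' g' -> near (S + S') e (f * f') (g * g').
Proof.
move=> [a b c] [a' b' c'].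
have E : - (S + S')%N%:Z = - S%:Z + - S'%:Z by lia.
split; rewrite ?E; [exact: VgeM | exact: VgeM |].
have -> : f * f' - g * g' = (f - g) * f' + g * (f' - g') by rewrite mulrBl mulrBr addrA subrK.
apply: VgeD.
  by have := VgeM c a'; congr (Vge _ _); lia.
by have := VgeM b c'; congr (Vge _ _); lia.
Qed.
Lemma near_sum S e (I : Type) (r : seq I) (P : pred I) (F G : I -> ZT) :
  (forall i, P i -> near S e (F i) (G i)) -> near S e (\sum_(i <- r | P i) F i) (\sum_(i <- r | P i) G i).
Proof.
move=> h; elim/big_ind2: _ => //; first by apply: near_refl; apply: Vge0.
by move=> *; apply: nearD.
Qed.

Lemma near_prod m e (F G : 'I_m -> ZT) : (forall i, near 1 e (F i) (G i)) ->
  near m e (\prod_i F i) (\prod_i G i).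
Proof.
elim: m F G => [|m IH] F G h; first by rewrite !big_ord0; apply: near_refl; apply: Vge1.
by rewrite !big_ord_recl; apply: (@near_leq (1 + m)) => //; apply: nearM; [exact: h | apply: IH => i; exact: h].
Qed.

(** Leibniz formula; each factor loses one order at most. *)
Lemma near_sdet (X : eqType) (s : seq X) e (M M' : X -> X -> ZT) :
  (forall x y, x \in s -> y \in s -> near 1 e (M x y) (M' x y)) -> near (size s) e (sdet s M) (sdet s M').
Proof.
move=> h; rewrite /sdet /tdet /determinant; apply: near_sum => p _.
apply: (@near_leq (0 + size s)) => //; apply: nearM.
  by apply: near_refl; rewrite oppr0 -signr_odd; case: odd; [apply: (Vge_int (-1)) | apply: Vge1].
by apply: near_prod => i; rewrite !mxE; apply: h; apply: mem_tnth.
Qed.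

Lemma Vge_opp S f : Vge 0 f -> Vge (- S%:Z) f.
Proof. by apply: Vge_leq; lia. Qed.

Lemma near_sadj (X : eqType) (s : seq X) e (M M' : X -> X -> ZT) x y :
  (forall x y, x \in s -> y \in s -> near 1 e (M x y) (M' x y)) ->
  near (size s) e (sadj s M x y) (sadj s M' x y).
Proof.
move=> h; apply: near_sdet => u v us vs; rewrite /row_set; case: eqP => _; last exact: h.
by apply: near_refl; apply: Vge_opp; apply: Vge_nat.
Qed.

Lemma Vge_half : Vge 0 (2%:R^-1).
Proof.
have := @Vge_inv 2%:R; rewrite rmorph_nat; apply.
by rewrite coefMn coef1.
Qed.

Lemma near_R1 (s : seq point) e M M' i j j' sg :
  (forall x y, x \in s -> y \in s -> near 1 e (M x y) (M' x y)) ->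
  near (size s + size s) e (R1_at s M i j j' sg) (R1_at s M' i j j' sg).
Proof.
move=> h; have d := near_sdet h; have a x y := near_sadj x y h.
have k c S (vc : Vge 0 c) : near S e c c := near_refl e (Vge_opp S vc).
rewrite /R1_at !expr2 -[(size s + size s)%N]add0n; apply: nearM; first by apply: k; apply: Vge_int.
apply: nearB; first apply: nearB.
- exact (nearM (a _ _) (nearB (nearD (a _ _) (a _ _)) (a _ _))).
- exact (nearM (a _ _) (nearB (a _ _) d)).
rewrite -[(size s + size s)%N]add0n; apply: nearM; last exact (nearM d d).
by rewrite mul1r; apply: k; apply: Vge_half.
Qed.

Lemma near_turn (s : seq point) e M M' x c : Vge 0 c ->
  (forall x y, x \in s -> y \in s -> near 1 e (M x y) (M' x y)) ->
  near (size s + size s) e (turn_at s M x c) (turn_at s M' x c).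
Proof.
move=> vc h; have d := near_sdet h; have a u v := near_sadj u v h.
have k c' S (v : Vge 0 c') : near S e c' c' := near_refl e (Vge_opp S v).
rewrite /turn_at !expr2 -[(size s + size s)%N]add0n; apply: nearM.
  by apply: k; rewrite -[0]addr0; apply: VgeM => //; apply: Vge_half.
apply: nearB; first exact (nearM (a _ _) d).
rewrite -[(size s + size s)%N]addn0; apply: nearM; first exact (nearM d d).
by apply: k; apply: Vge_half.
Qed.

Section Weights.
Variables (U : region) (n : nat).
Hypothesis n_gt0 : (0 < n)%N.
Hypothesis noV : forall h k, (layer_at (base U) h).2 <> TwistVertex k.

Definition wnear (e : int) (W W' : weights) := forall a b, near 1 e (W a b) (W' a b).
(** Entrywise closeness of two stacks of matrices of the same height. *)
Definition wsnear e (Ws Ws' : seq weights) :=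
  size Ws = size Ws' /\ forall i, wnear e (nth (fun _ _ => 0) Ws i) (nth (fun _ _ => 0) Ws' i).

(** The entries T^(-1) and 1 - T^(-1) of negative crossings have a simple
   pole. *)
Lemma Vge_crossing s i j : Vge (-1) (crossing_weight s i j).
Proof.
have v0 f : Vge 0 f -> Vge (-1) f by apply: Vge_leq.
have vT (b : bool) : Vge (-1) (T ^ (if b then 1 else -1)).
  by apply: Vge_leq (VgeT _); case: b.
have v1 : Vge (-1) 1 by apply: v0; apply: Vge1.
rewrite /crossing_weight; case: (i == _); last by apply: v0; apply: Vge_nat.
by case: (j == _); [exact: vT | apply: VgeB => //; exact: vT].
Qed.

Lemma Vge_vertex a b : Vge 0 (vertex_weight n a b).
Proof.
rewrite /vertex_weight -[0]addr0; apply: VgeM; first by rewrite /T -tofracXn; apply: Vge_poly.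
have [E c] := tausum_lead n_gt0; rewrite -/(tausum T n) E; apply: Vge_inv; by rewrite c.
Qed.

Lemma Vge_delta a b : Vge 0 ((a == b :> nat)%:R - vertex_weight n a b).
Proof. by apply: VgeB; [apply: Vge_nat | apply: Vge_vertex]. Qed.

(** The difference is T^(nk) times a matrix without poles. *)
Lemma Vge_twist_gap k a b : Vge k%:Z (twist_weights n k a b - limit_weights n a b).
Proof.
rewrite /twist_weights /limit_weights addrC addKr -[k%:Z]addr0; apply: VgeM; last exact: Vge_delta.
rewrite -exprM -[T ^+ _]/(T ^ (n * k)%N%:Z); apply: Vge_leq (VgeT _); rewrite lez_nat; nia.
Qed.

Lemma near_limit k (e : int) a b : e <= k%:Z -> near 0 e (twist_weights n k a b) (limit_weights n a b).
Proof.
move=> ek; have v : Vge 0 (limit_weights n a b) by apply: Vge_vertex.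
have d := Vge_twist_gap k a b; split; rewrite ?oppr0 ?subr0 //.
  rewrite -[twist_weights n k a b](subrK (limit_weights n a b)); apply: VgeD => //.
  by apply: Vge_leq d.
exact: Vge_leq d.
Qed.

Lemma near_sym S e f g : near S e f g -> near S e g f.
Proof. by move=> [a b c]; split=> //; rewrite -[g - f]opprB; apply: VgeN. Qed.
Lemma near_trans S e f g h : near S e f g -> near S e g h -> near S e f h.
Proof. by move=> [a b c] [_ b' c']; split=> //; rewrite -[f](subrK g) -[_ + g - h]addrA; apply: VgeD. Qed.

Lemma wnear_limit k (e : int) : e <= k%:Z -> wnear e (twist_weights n k) (limit_weights n).
Proof. by move=> ek a b; apply: (@near_leq 0) => //; apply: near_limit. Qed.
Lemma wnear_twist k k' (e : int) : e <= k%:Z -> e <= k'%:Z ->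
  wnear e (twist_weights n k) (twist_weights n k').
Proof.
move=> h h' a b; apply: near_trans (wnear_limit h a b) _; apply: near_sym; exact: wnear_limit.
Qed.

Lemma wsnear1 e W W' : wnear e W W' -> wsnear e [:: W] [:: W'].
Proof.
move=> h; split=> // -[|i] a b /=; first exact: h.
by rewrite nth_nil; apply: near_refl; apply: Vge0.
Qed.
Lemma wsnear_cat e Ws1 Ws2 Ws1' Ws2' : wsnear e Ws1 Ws1' -> wsnear e Ws2 Ws2' ->
  wsnear e (Ws1 ++ Ws2) (Ws1' ++ Ws2').
Proof.
move=> [s1 h1] [s2 h2]; split; first by rewrite !size_cat s1 s2.
by move=> i; rewrite !nth_cat s1; case: ifP => _.
Qed.
Lemma wsnear0 e : wsnear e [::] [::].
Proof. by split=> // i a b; rewrite nth_nil; apply: near_refl; apply: Vge0. Qed.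
Lemma wsnear_tw e w : wsnear e (Wtw w) (Wtw w).
Proof.
split=> // i a b; apply: near_refl; case: (ltnP i (size w)) => h; last first.
  by rewrite nth_default ?size_Wtw //; apply: Vge0.
rewrite /Wtw /braid_diagram -map_comp (nth_map 0%N) //= /layer_weights /=.
case: ifP => _; last by apply: Vge_opp; apply: Vge_nat.
case: ifP => _; [exact: Vge_crossing | exact: Vge0].
Qed.
Lemma wsnear_twist_list e a a' : (a != 0%N) = (a' != 0%N) ->
  (a = a' \/ e <= a%:Z /\ e <= a'%:Z) -> wsnear e (twist_list n a) (twist_list n a').
Proof.
case: a a' => [|a] [|a'] //= _ h; first exact: wsnear0.
rewrite /twist_list; apply: wsnear1; case: h => [<-|[h h']]; last exact: wnear_twist.
have le : (0 : int) <= a.+1%:Z by [].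
move=> x y; apply: near_refl; have [v _ _] := near_limit x y le; apply: Vge_leq v; lia.
Qed.

Lemma Vge_point x y : Vge (-1) (point_weight (base U) x y).
Proof.
have v0 f : Vge 0 f -> Vge (-1) f by apply: Vge_leq.
rewrite /point_weight; case: ifP => _.
  case: ifP => _; last exact: Vge0.
  case e : (layer_at (base U) x.1).2 => [s|b|b|k]; [exact: Vge_crossing | exact: Vge0 | exact: Vge0 |].
  by case: (noV e).
by case: ifP => _; [exact: Vge0 | apply: v0; apply: Vge_nat].
Qed.

Lemma near_model e Ws Ws' x y : wsnear e Ws Ws' -> near 1 e (modelM U n Ws x y) (modelM U n Ws' x y).
Proof.
move=> [s h]; have k c (v : Vge (-1) c) : near 1 e c c := near_refl e v.
have v0 f : Vge 0 f -> Vge (-1) f by apply: Vge_leq.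
have vz : Vge (-1) 0 by apply: Vge0.
have vn (b : nat) : Vge (-1) b%:R by apply: v0; apply: Vge_nat.
rewrite /modelM; apply: nearB; first exact: k.
rewrite /model_weight s; case: ifP => _.
  by apply: k; case: ifP => _ //; apply: Vge_point.
case: ifP => _; first by apply: k; case: ifP => _ //; apply: Vge_point.
case: ifP => _; last exact: k.
case: ifP => _; last exact: k.
rewrite /block_weights; case: ifP => _; last exact: k.
by case: ifP => _; [apply: h | apply: k].
Qed.

(** Order lost by a quadratic expression in determinants. *)
Definition pole (m : nat) : nat := size (model_points U m) + size (model_points U m).

Lemma near_model_R1 e Ws Ws' i j j' sg : wsnear e Ws Ws' ->
  near (pole (size Ws)) e (model_R1 U n Ws i j j' sg) (model_R1 U n Ws' i j j' sg).
Proof.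
move=> h; have [s _] := h; rewrite /model_R1 -s; apply: near_R1 => x y _ _; exact: near_model.
Qed.
Lemma near_model_turn e Ws Ws' x c : Vge 0 c -> wsnear e Ws Ws' ->
  near (pole (size Ws)) e (model_turn U n Ws x c) (model_turn U n Ws' x c).
Proof.
move=> v h; have [s _] := h; rewrite /model_turn -s; apply: near_turn => // u u' _ _; exact: near_model.
Qed.

Variable w : seq nat.
Notation N := (size w).
(** The summands belong to the heights of the blocks that occur, with one
   merged matrix alone, or with the middle full twist and none, one or two
   merged neighbours. *)
Definition pole_bound : nat := pole 1 + pole N + pole N.+1 + pole N.+2.

(** The contribution depends on [a] only through the matrix of [a] full
   twists, which is almost constant for large [a]; the same holds for [b].
   For [a = 0] the stack is lower, whence the condition on zeros. *)
Lemma near_mid e a b a' b' k : (a != 0%N) = (a' != 0%N) -> (b != 0%N) = (b' != 0%N) ->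
  (a = a' \/ e <= a%:Z /\ e <= a'%:Z) -> (b = b' \/ e <= b%:Z /\ e <= b'%:Z) ->
  near pole_bound e (mid_term U n w a b k) (mid_term U n w a' b' k).
Proof.
move=> za zb ha hb; have ws : wsnear e (twist_list n a ++ Wtw w ++ twist_list n b) (twist_list n a' ++ Wtw w ++ twist_list n b').
  by apply: wsnear_cat; [exact: wsnear_twist_list | apply: wsnear_cat; [exact: wsnear_tw | exact: wsnear_twist_list]].
rewrite /mid_term !size_twist_list -za; apply: near_leq (near_model_R1 _ _ _ _ ws).
rewrite !size_cat !size_twist_list size_Wtw /pole_bound.
by case: (a != _); case: (b != _); rewrite ?addn0 ?add0n ?add1n ?addn1 ?addnS; lia.
Qed.

Lemma near_mid_limit (e : int) a b k : (0 < a)%N -> (0 < b)%N -> e <= a%:Z -> e <= b%:Z ->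
  near pole_bound e (mid_term U n w a b k) (mid_limit U n w k).
Proof.
move=> a0 b0 ha hb; have lo c : (0 < c)%N -> twist_list n c = [:: twist_weights n c].
  by move=> c0; rewrite /twist_list (gtn_eqF c0).
have ws : wsnear e (twist_list n a ++ Wtw w ++ twist_list n b) ([:: limit_weights n] ++ Wtw w ++ [:: limit_weights n]).
  rewrite !lo //; apply: wsnear_cat; first by apply: wsnear1; apply: wnear_limit.
  by apply: wsnear_cat; [exact: wsnear_tw | apply: wsnear1; apply: wnear_limit].
rewrite /mid_term /mid_limit; have -> : size (twist_list n a) = 1%N by rewrite lo.
apply: near_leq (near_model_R1 _ _ _ _ ws).
by rewrite !size_cat !lo // size_Wtw /pole_bound /= addn1 add1n leq_addl.
Qed.

Lemma near_outer (e : int) t t' h : e <= t%:Z -> e <= t'%:Z ->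
  near pole_bound e (outer_term U n (twist_weights n t) h) (outer_term U n (twist_weights n t') h).
Proof.
move=> ht ht'; have ws : wsnear e [:: twist_weights n t] [:: twist_weights n t'].
  by apply: wsnear1; apply: wnear_twist.
have vc (b : bool) : Vge 0 (if b then -1 else 1 : ZT).
  by case: b; [apply: (Vge_int (-1)) | apply: Vge1].
have le : (pole (size [:: twist_weights n t]) <= pole_bound)%N by rewrite /pole_bound /=; lia.
rewrite /outer_term; case: (_.2) => [s|b|b|k].
- by apply: near_leq (near_model_R1 _ _ _ _ ws).
- by apply: nearN; apply: near_leq (near_model_turn _ _ ws).
- by apply: nearN; apply: near_leq (near_model_turn _ _ ws).
by apply: near_refl; apply: Vge0.
Qed.

End Weights.

(** * Convergence of the twisted invariants *)

(** The terms of the longer antidiagonal are matched with those of the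
   shorter one: in the first [m] terms the second argument drops by one, in the
   last [r] terms the first one does, and the term (m, r) is left over. *)
Lemma antidiagonal_gap (V : zmodType) (f : nat -> nat -> V) m r :
  \sum_(s < (m + r).+1) f s (m + r - s)%N - \sum_(s < m + r) f s ((m + r).-1 - s)%N
  = \sum_(s < m) (f s (m + r - s)%N - f s ((m + r).-1 - s)%N) + f m r
    + \sum_(s < r) (f (m + s).+1 (r.-1 - s)%N - f (m + s)%N (r.-1 - s)%N).
Proof.
have -> : \sum_(s < (m + r).+1) f s (m + r - s)%N = \sum_(s < m) f s (m + r - s)%N + f m r
    + \sum_(s < r) f (m + s).+1 (r.-1 - s)%N.
  have -> : \sum_(s < (m + r).+1) f s (m + r - s)%N = \sum_(s < m + r.+1) f s (m + r - s)%N.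
    by rewrite addnS.
  rewrite big_split_ord /= -addrA; congr (_ + _); rewrite big_ord_recl /= addn0 addKn; congr (_ + _).
  by apply: eq_bigr => s _; rewrite /bump /= add1n addnS; congr f; have := ltn_ord s; lia.
rewrite [X in _ - X]big_split_ord /= !sumrB opprD addrACA [_ + f m r - _]addrAC; congr (_ + (_ - _)).
by apply: eq_bigr => s _; congr f; have := ltn_ord s; lia.
Qed.

Lemma gap_split (V : zmodType) (a b x y z : V) : a + x - (b + y) - z = (a - b) + ((x - y) - z).
Proof. by rewrite opprD addrACA -!addrA. Qed.

Lemma gap_middle (V : zmodType) (x y z l : V) : x + y + z - l = x + (y - l) + z.
Proof. by rewrite addrAC addrA. Qed.

Lemma gap_swap (V : zmodType) (a b c e : V) : a - c - (b - e) = (a - b) - (c - e).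
Proof. by rewrite opprD addrACA -opprD. Qed.

Section Sums.
Variables (U : region) (n : nat) (w : seq nat).
Notation L := (size (below U)).
Notation q := (offset U).
Notation B := (base U).
Notation N := (size w).
Notation twisted := (twisted U w).
Hypothesis knotB : long_knot B.
Hypothesis strandsU : take n (drop q (level B L)) = nseq n true.
Hypothesis tw : full_twist n w.
Hypothesis n_gt1 : (1 < n)%N.
Let noVB := no_vertex_base knotB.
Let n_gt0 : (0 < n)%N. Proof. exact: ltnW. Qed.
Notation Cp := (pole_bound U w).

(** Both arguments of the leftover term are about t / 2, so it is close to
   its limit up to order t / 2.  In every matched pair the argument that changes
   is at least t / 2, so the pairs cancel up to that order, and so do the
   contributions of the layers outside the twist region. *)
Lemma bracket_gap t : (1 < t)%N ->
  Vge (t./2%:Z - Cp%:Z) (rho_bracket (twisted t.+1) - rho_bracket (twisted t) - \sum_(k < N) mid_limit U n w k).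
Proof.
move=> t1; rewrite !(bracket_twisted knotB strandsU tw n_gt1) ?(ltnW t1) //.
(* the antidiagonals are cut in the middle *)
set m := t./2; set e := m%:Z.
have m0 : (0 < m)%N by rewrite /m; lia.
have tE : t = (m + (t - m))%N by rewrite /m; lia.
have rm : (m <= t - m)%N by rewrite /m; lia.
move: (t - m)%N rm tE => r rm tE.
pose f a b := \sum_(k < N) mid_term U n w a b k.
have fnear a b a' b' : (a != 0%N) = (a' != 0%N) -> (b != 0%N) = (b' != 0%N) ->
  (a = a' \/ e <= a%:Z /\ e <= a'%:Z) -> (b = b' \/ e <= b%:Z /\ e <= b'%:Z) -> Vge (e - Cp%:Z) (f a b - f a' b').
  move=> h1 h2 h3 h4; suff [] : near Cp e (f a b) (f a' b') by [].
  by apply: near_sum => k _; apply: near_mid.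
set O1 := \sum_(h < size B) outer_term U n (twist_weights n t.+1) h.
set O2 := \sum_(h < size B) outer_term U n (twist_weights n t) h.
have vO : Vge (e - Cp%:Z) (O1 - O2).
  suff [] : near Cp e O1 O2 by [].
  by apply: near_sum => h _; apply: near_outer => //; rewrite /e lez_nat; lia.
rewrite gap_split; apply: VgeD => //; rewrite /= tE (antidiagonal_gap f).
set l := \sum_(k < N) _.
rewrite gap_middle.
apply: VgeD; first apply: VgeD.
- by apply: Vge_sum => s _; have := ltn_ord s => hs; apply: fnear; rewrite ?eqxx //; [lia | by left | right; rewrite /e !lez_nat; lia].
- suff [] : near Cp e (f m r) l by [].
  by apply: near_sum => k _; apply: near_mid_limit => //; rewrite /e ?lez_nat; lia.
by apply: Vge_sum => s _; have := ltn_ord s => hs; apply: fnear; rewrite ?eqxx //; [lia | right; rewrite /e !lez_nat; lia | by left].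
Qed.

Lemma sum_layers (V : zmodType) (F : layer -> V) D :
  \sum_(h < size D) F (layer_at D h) = \sum_(l <- D) F l.
Proof. by rewrite (big_nth (0%N, Cup true)) big_mkord. Qed.

Lemma sum_twisted (F : layer -> int) c t : (forall i, F (i, Crossing true) = c) ->
  \sum_(l <- twisted t) F l = \sum_(l <- twisted 0) F l + c * (t * N)%N%:Z.
Proof.
move=> h; rewrite /@twisted /insert /= !big_cat /= !big_map.
have -> : \sum_(i <- flatten (nseq t w)) F (q + i, Crossing true)%N = c * (t * N)%N%:Z.
  by under eq_bigr do rewrite h; rewrite big_const_seq count_predT iter_addr_0 size_pow -mulr_natr natz.
by rewrite [_ * _ + _]addrC addrA.
Qed.

(** Each full twist adds its positive crossings. *)
Lemma writhe_twisted t : writhe (twisted t) = writhe (twisted 0) + (t * N)%N%:Z.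
Proof.
pose F (l : layer) : int := match l.2 with Crossing s => if s then 1 else -1 | _ => 0 end.
have E D : writhe D = \sum_(l <- D) F l.
  rewrite /writhe big_mkcond -sum_layers; apply: eq_bigr => h _.
  by rewrite /is_crossing /csign /is_positive /F; case: (layer_at D h).2.
by rewrite !E (sum_twisted (c := 1)) // mul1r.
Qed.

(** The total turning number is half a sum over cups and caps, and twisting
   adds none. *)
Lemma turning_twisted t : total_turning (twisted t) = total_turning (twisted 0).
Proof.
pose F (l : layer) : int := match l.2 with Cup b | Cap b => if b then -1 else 1 | _ => 0 end.
have E r : total_turning (twisted r) * 2 = \sum_(l <- twisted r) F l.
  rewrite -sum_layers /total_turning mulr_suml.
  rewrite -[RHS](sum_half_turns (twisted r)); apply: eq_bigr => k _; rewrite half_turns_even //.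
  - exact: (wf_twisted knotB strandsU tw n_gt1).
  exact: (good_twisted knotB strandsU tw n_gt1).
apply: (mulIf (x := 2)) => //.
by rewrite !E (sum_twisted (c := 0)) // mul0r addr0.
Qed.
End Sums.

Section Laurent.
Variable D : diagram.
Hypothesis wf : well_formed D.
Hypothesis good : perm_eq (traversal D) (points D).
Notation piece_at h := (layer_at D h).2.
Hypothesis noV : forall h n, piece_at h <> TwistVertex n.
Notation A := (transition D).

Lemma laurent_nat (b : nat) : is_laurent b%:R.
Proof. exact: (laurent_int b%:Z). Qed.

Lemma laurent_entry i j : is_laurent ((1%:M - A) i j).
Proof.
rewrite !mxE; apply: laurentB; first exact: laurent_nat.
rewrite transition_entry //; apply: laurent_sum => h _.
apply: laurentD; [apply: laurentD|].
- by apply: laurentM (laurent_T _) (laurentM (laurent_nat _) (laurent_nat _)).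
- by apply: laurentM (laurentB laurent1 (laurent_T _)) (laurentM (laurent_nat _) (laurent_nat _)).
exact: laurentM (laurent_nat _) (laurent_nat _).
Qed.

(** The denominators 2 cancel: the halves in the crossing terms and in the
   turning terms add up to the multiple (writhe - turning) / 2 of the squared
   determinant, and the writhe and the turning number have the same parity. *)
Lemma laurent_bracket : is_laurent (rho_bracket D).
Proof.
rewrite /rho_bracket -turning_sum // green_adj //.
have gL := laurent_adj laurent_entry; have dL := laurent_det laurent_entry; have d0 := det_neq0 wf good noV.
have t0 := two_neq0.
move: dL d0 gL; rewrite /R1_tilde; set d := \det _; set g := \adj _ => dL d0 gL.
rewrite mulr_sumr.
(* I and J collect the parts without denominators *)
pose I h := (csign D h)%:~R * (g (under_in D h) (over_in D h) *
   (g (under_out D h) (under_in D h) + g (under_in D h) (under_out D h) - g (over_in D h) (under_in D h))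
   - g (over_in D h) (over_in D h) * (g (under_in D h) (under_out D h) - d)).
pose J k := (turning k)%:~R * (g k k * d) : ZT.
have EI : \sum_(h < size D | is_crossing D h) R1_tilde D h
    = \sum_(h < size D | is_crossing D h) I h - (writhe D)%:~R * (d ^+ 2 / 2%:R).
  rewrite /writhe rmorph_sum /= mulr_suml -sumrB; apply: eq_bigr => h _.
  by rewrite /R1_tilde /I -/d -/g -mulrBr mul1r [2%:R^-1 * _]mulrC.
have EJ : \sum_k d ^+ 2 * ((turning k)%:~R * ((d^-1 *: g) k k - 1 / 2%:R))
    = \sum_k J k - (total_turning D)%:~R * (d ^+ 2 / 2%:R).
  rewrite /total_turning rmorph_sum /= mulr_suml -sumrB; apply: eq_bigr => k _.
  have -> : (d^-1 *: g) k k = d^-1 * g k k by rewrite mxE.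
  rewrite /J; move: (g k k) (_%:~R) => x y.
  have {2}-> : x = d * (d^-1 * x) by rewrite mulVKf.
  rewrite mul1r expr2; move: (d^-1 * x) (2%:R^-1) => z u; ring.
rewrite -/(R1_tilde D) EI EJ.
rewrite gap_swap.
have -> : (writhe D)%:~R * (d ^+ 2 / 2%:R) - (total_turning D)%:~R * (d ^+ 2 / 2%:R)
    = (under_first D - total_turning D)%:~R * d ^+ 2.
  rewrite -mulrBl -rmorphB /=; have -> : writhe D - total_turning D = (under_first D - total_turning D) * 2.
    by have := turning_writhe wf good noV; lia.
  rewrite rmorphM /= mulrAC -mulrA; congr (_ * _).
  exact: (divfK t0).
apply: laurentB; last by apply: laurentM; [exact: laurent_int | rewrite expr2; exact: laurentM].
apply: laurentB; apply: laurent_sum => h _.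
  apply: laurentM; first exact: laurent_int.
  by apply: laurentB; apply: laurentM => //; apply: laurentB => //; apply: laurentD.
by apply: laurentM; [exact: laurent_int | exact: laurentM].
Qed.
End Laurent.

Theorem theorem6p3 (n : nat) (U : region) (w : seq nat) (D : nat -> diagram)
    (rho : nat -> ZT) (hn : (2 <= n)%N) (hD : compatible n U w D)
    (hrho : forall t : nat, is_rho1 (D t) (rho t)) :
  let d (t : nat) : ZT :=
    T ^+ (t * n * (n - 1)) * (T ^+ (n * (n - 1)) * rho t.+1 - rho t) in
  let lim_d : ZT :=
    T ^ (- total_turning (D 0%N) - writhe (D 0%N))
    * \sum_(k < n * (n - 1)) R1_tilde (D_infty n U w) (tau_crossing U k) in
  exists (c : nat -> int -> int) (s : int -> int),
    [/\ forall t : nat, laurent_coefs (d t) (c t),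
        stabilizes_positively c,
        limit_of c s
      & laurent_expansion lim_d s].
Proof.
move=> d lim_d; have [knotB strandsU tw eD] := hD.
have sw : size w = (n * (n - 1))%N := full_twist_size tw.
pose X : int := - total_turning (D 0%N) - writhe (D 0%N).
have good t := good_twisted knotB strandsU tw hn t; have wf t := wf_twisted knotB strandsU tw hn t.
have noV t h k : (layer_at (twisted U w t) h).2 <> TwistVertex k by apply: no_vertex_twisted; eassumption.
(* twisting changes the writhe only, which absorbs the power of T in d *)
have rhoE t : rho t = T ^ (X - (t * (n * (n - 1)))%N%:Z) * rho_bracket (twisted U w t).
  have := hrho t; rewrite eD => /(rho_formula (wf t) (good t) (noV t)) ->.
  rewrite (turning_twisted knotB strandsU tw hn) writhe_twisted sw; congr (T ^ _ * _).
  by rewrite /X eD opprD addrA.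
have dE t : d t = T ^ X * (rho_bracket (twisted U w t.+1) - rho_bracket (twisted U w t)).
  rewrite /d !rhoE -mulnA exprnP [T ^+ (n * _)]exprnP.
  rewrite [LHS]mulrBr [RHS]mulrBr !mulrA -!TexpD mulSn PoszD.
  by congr (T ^ _ * _ - T ^ _ * _); lia.
apply: (@laurent_limit d lim_d 2 (pole_bound U w + `|X|)%N) => t.
  rewrite dE; apply: laurentM; first exact: laurent_T.
  by apply: laurentB; apply: laurent_bracket.
move=> t2; rewrite dE /lim_d -sw.
have -> : \sum_(k < size w) R1_tilde (D_infty n U w) (tau_crossing U k)
   = \sum_(k < size w) mid_limit U n w k.
  by apply: eq_bigr => k _; apply: R1_infty.
rewrite -mulrBr; have := VgeM (VgeT X) (bracket_gap knotB strandsU tw hn t2).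
apply: Vge_leq; lia.
Qed.
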